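(* Let $t\in\Delta^+$ be an injective-reachable quantum seed. Assume that a given subalgebra $\mathrm A(t)\subset\mathcal U_q(t)$ possesses the triangular basis $\mathbf L^t$ with respect to $t$. If $\mathbf L^t$ is compatibly pointed at $t,t[1]$ and, moreover, $(\mu_{t[1],t}^* )^{-1}\mathbf L^t$ is the triangular basis $\mathbf L^{t[1]}$ for the seed $t[1]$, then $\mathbf L^t$ is the common triangular basis.
   Context: **Quantum seeds.** $\Bbbk=\mathbb Z[q^{\pm1/2}]$, $v=q^{1/2}$, $\mathbf m=v^{-1}\mathbb Z[v^{-1}]$, $[x]_+=\max(x,0)$ (componentwise for vectors), $\mathbb N=\{0,1,\dots\}$. $I=I_{uf}\sqcup I_f$ is a finite set (unfrozen/frozen vertices). A quantum seed $t$ consists of an integer matrix $\tilde B(t)=(b_{ij})_{i\in I,j\in I_{uf}}$ of full rank $|I_{uf}|$ whose square part $B(t)=(b_{ij})_{i,j\in I_{uf}}$ is skew-symmetrizable, a skew-symmetric integer matrix $\Lambda(t)=(\Lambda_{ij})_{i,j\in I}$ with $\tilde B(t)^T\Lambda(t)=(D'\ 0)$, $D'=\mathrm{diag}(d'_k)_{k\in I_{uf}}$, $d'_k\in\mathbb Z_{>0}$, and variables $X_i(t)$, $i\in I$. $M^\circ(t)=\bigoplus_{i\in I}\mathbb Zf_i\cong\mathbb Z^I$ carries $\lambda(f_i,f_j)=\Lambda_{ij}$. $\mathcal{LP}(t)=\bigoplus_{m\in M^\circ(t)}\Bbbk X(t)^m$ has commutative product $X^m\cdot X^{m'}=X^{m+m'}$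 and twisted product $X^m*X^{m'}=v^{\lambda(m,m')}X^{m+m'}$; $X_i(t)=X(t)^{f_i}$; as an algebra it is taken with $*$, and $\mathcal F(t)$ is its skew-field of fractions. $Y(t)^n=X(t)^{\tilde B(t)n}$ for $n\in\mathbb Z^{I_{uf}}$. The bar involution is the $\mathbb Z$-linear anti-automorphism with $v\mapsto v^{-1}$, $X(t)^m\mapsto X(t)^m$. For $k\in I_{uf}$, $t'=\mu_kt$ has $b'_{ij}=-b_{ij}$ if $k\in\{i,j\}$, otherwise $b'_{ij}=b_{ij}+b_{ik}[b_{kj}]_++[-b_{ik}]_+b_{kj}$; $\Lambda(t')_{ij}=\lambda(f'_i,f'_j)$ with $f'_i=f_i$ ($i\ne k$), $f'_k=-f_k+\sum_j[-b_{jk}]_+f_j$; and $\mu_k^*:\mathcal F(t')\cong\mathcal F(t)$ sends $X_i(t')\mapsto X_i(t)$ ($i\ne k$), $X_k(t')\mapsto X(t)^{-f_k+\sum_j[-b_{jk}]_+f_j}+X(t)^{-f_k+\sum_j[b_{jk}]_+f_j}$. $\Delta^+$ is the set of seeds obtained from an initial seed by iterated mutations. A mutation sequence $\overleftarrow\mu$ with $t_2=\overleftarrow\mu t_1$ induces the composite $\overleftarrow\mu^*:\mathcal F(t_2)\cong\mathcal F(t_1)$, which depends only on $t_1,t_2$ and is also written $\mu^*_{t_2,t_1}$. $\mathcal U_q(t)=\bigcap_{t'\in\Delta^+}\mu^*_{t',t}\mathcal{LP}(t')$. Quantum cluster monomials of a seed $s$ are the $\mu^*_{s,t}X(s)^m$,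 $m\in\mathbb N^I$. **Degrees.** $m'\preceq_tm$ in $M^\circ(t)$ iff $m'=m+\tilde B(t)n$ for some $n\in\mathbb N^{I_{uf}}$. An element is $g$-pointed (pointed at $g$, of degree $g$) if it has the form $X(t)^g\cdot(1+\sum_{0\ne n\in\mathbb N^{I_{uf}}}c_nY(t)^n)$, $c_n\in\Bbbk$. If $Z$ has a unique $\prec_t$-maximal Laurent degree, $[Z]^t$ denotes $Z$ divided by the coefficient at that degree. **Tropical transformations, compatibility.** For $t'=\mu_kt$, $\phi_{t',t}:M^\circ(t)\to M^\circ(t')$, $g\mapsto g'$, is $g'_k=-g_k$, $g'_i=g_i+[b_{ik}]_+g_k$ if $i\neq k,g_k\ge0$, $g'_i=g_i+[-b_{ik}]_+g_k$ if $i\ne k,g_k<0$; for general $t'\in\Delta^+$, $\phi_{t',t}$ is the composite along a mutation sequence from $t$ to $t'$ (independent of the choice). $Z\in\mathcal{LP}(t)\cap\mu^*_{t',t}\mathcal{LP}(t')$ is compatibly pointed at $t,t'$ if $Z$ is $g$-pointed for some $g\in M^\circ(t)$ and $\mu^*_{t,t'}Z$ is a $\phi_{t',t}(g)$-pointed element of $\mathcal{LP}(t')$; a set is compatibly pointed if all its elements are. Pointed sets $\{S_g\}\subset\mathcal{LP}(t)$ and $\{S'_{g'}\}\subset\mathcal{LP}(t')$ are compatible if $\mu^*_{t,t'}S_g=S'_{\phi_{t',t}g}$ for all $g$. **Injective-reachability.** $t$ is injective-reachable if there are $t[1]=\overleftarrow\mu t\in\Delta^+$ and a permutation $\sigma$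 of $I_{uf}$ such that for each $k\in I_{uf}$ the $I_{uf}$-part of the degree of $\overleftarrow\mu^*X_{\sigma k}(t[1])\in\mathcal{LP}(t)$ is $-f_k$; the property then holds for all seeds of $\Delta^+$. **Triangular bases.** A $\Bbbk$-basis $\mathbf L$ of the subalgebra $\mathrm A(t)\subset\mathcal U_q(t)$ is the triangular basis for $t$ if: (1) its elements are bar-invariant; (2) it contains the quantum cluster monomials of $t$ and $t[1]$; (3) $\mathbf L=\{\mathbf L_g\mid g\in M^\circ(t)\}$ with $\mathbf L_g$ $g$-pointed; (4) for all $i\in I$, $g$: $[X_i(t)*\mathbf L_g]^t=\mathbf L_{g+f_i}+\sum_{g'\prec_tg+f_i}b_{g'}\mathbf L_{g'}$, $b_{g'}\in\mathbf m$. It is the common triangular basis if $\mu^*_{t,t'}\mathbf L$ is the triangular basis of $\mathrm A(t'):=\mu^*_{t,t'}\mathrm A(t)$ for every $t'\in\Delta^+$ and these bases are pairwise compatible. *)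

(* Defs.v *)
From HB Require Import structures.
From mathcomp Require Import all_boot all_order all_algebra.
From mathcomp Require Import perm finmap ring.
From mathcomp Require Import boolp classical_sets.
From mathcomp.multinomials Require Import monalg.

Set Implicit Arguments.
Unset Strict Implicit.
Unset Printing Implicit Defensive.

Import Order.TTheory GRing.Theory Num.Theory.
Local Open Scope classical_set_scope.
Local Open Scope ring_scope.

(** * Twisted group algebras

    [talg w] is the free [R]-module on the abelian group [G], with product
    [<< g >> * << h >> = w g h *: << g + h >>].  The rings of [monalg] cannot be
    used: their monoids of exponents are not allowed to contain inverses. *)

Record cocycle (R : comNzRingType) (G : zmodType) := Cocycle {
  cocycle_val :> G -> G -> R;
  cocycle0l : forall a, cocycle_val 0 a = 1;
  cocycle0r : forall a, cocycle_val a 0 = 1;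
  cocycleA : forall a b c,
    cocycle_val a b * cocycle_val (a + b) c =
    cocycle_val b c * cocycle_val a (b + c)
}.

Definition talg (R : comNzRingType) (G : zmodType) (w : cocycle R G) : Type :=
  {malg R[G]}.

Section TwistedAlgebra.
Variables (R : comNzRingType) (G : zmodType) (w : cocycle R G).

HB.instance Definition _ := GRing.Lmodule.copy (talg w) {malg R[G]}.

Implicit Types a b c : talg w.

Definition tmul a b : talg w :=
  \sum_(g <- msupp a) \sum_(h <- msupp b) << a@_g * b@_h * w g h *g g + h >>.

Definition tone : talg w := << 0 >>.

Lemma tmulw (d1 d2 : {fset G}) a b :
  (msupp a `<=` d1)%fset -> (msupp b `<=` d2)%fset ->
  tmul a b = \sum_(g <- d1) \sum_(h <- d2) << a@_g * b@_h * w g h *g g + h >>.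
Proof.
move=> le1 le2; rewrite /tmul (big_fset_incl _ le1) /=.
  apply/eq_bigr => g _; apply/big_fset_incl => // h _ /mcoeff_outdom ->.
  by rewrite mulr0 mul0r monalgU0.
move=> g _ /mcoeff_outdom ->.
by rewrite big1 // => h _; rewrite !mul0r monalgU0.
Qed.

Lemma tmul0g : left_zero 0 tmul.
Proof. by move=> a; rewrite /tmul msupp0 big_seq_fset0. Qed.

Lemma tmulg0 : right_zero 0 tmul.
Proof. by move=> a; rewrite /tmul big1 // => g _; rewrite msupp0 big_seq_fset0. Qed.

Lemma tmulUU (x y : R) g h :
  tmul << x *g g >> << y *g h >> = << x * y * w g h *g g + h >>.
Proof. by rewrite (tmulw msuppU_le msuppU_le) !big_seq_fset1 !mcoeffUU. Qed.

Lemma tmulDl : left_distributive tmul +%R.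
Proof.
move=> a b c.
rewrite (tmulw (msuppD_le a b) (fsubset_refl (msupp c))).
rewrite (tmulw (fsubsetUl (msupp a) (msupp b)) (fsubset_refl (msupp c))).
rewrite (tmulw (fsubsetUr (msupp a) (msupp b)) (fsubset_refl (msupp c))).
rewrite -big_split; apply/eq_bigr => g _.
rewrite -big_split; apply/eq_bigr => h _.
by rewrite mcoeffD !mulrDl monalgUD.
Qed.

Lemma tmulDr : right_distributive tmul +%R.
Proof.
move=> c a b.
rewrite (tmulw (fsubset_refl (msupp c)) (msuppD_le a b)).
rewrite (tmulw (fsubset_refl (msupp c)) (fsubsetUl (msupp a) (msupp b))).
rewrite (tmulw (fsubset_refl (msupp c)) (fsubsetUr (msupp a) (msupp b))).
rewrite -big_split; apply/eq_bigr => g _.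
rewrite -big_split; apply/eq_bigr => h _.
by rewrite mcoeffD mulrDr mulrDl monalgUD.
Qed.

Lemma tmul_suml (I : Type) (r : seq I) (F : I -> talg w) b :
  tmul (\sum_(i <- r) F i) b = \sum_(i <- r) tmul (F i) b.
Proof. exact: (big_morph (tmul^~ b) (fun x y => tmulDl x y b) (tmul0g b)). Qed.

Lemma tmul_sumr (I : Type) (r : seq I) (F : I -> talg w) b :
  tmul b (\sum_(i <- r) F i) = \sum_(i <- r) tmul b (F i).
Proof. exact: (big_morph (tmul b) (fun x y => tmulDr b x y) (tmulg0 b)). Qed.

Lemma talgE a : a = \sum_(g <- msupp a) (<< a@_g *g g >> : talg w).
Proof. exact: monalgE. Qed.

Lemma tmul1g : left_id tone tmul.
Proof.
move=> a; rewrite [in LHS](talgE a) tmul_sumr [RHS]talgE.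
by apply/eq_bigr => g _; rewrite tmulUU mul1r cocycle0l mulr1 add0r.
Qed.

Lemma tmulg1 : right_id tone tmul.
Proof.
move=> a; rewrite [in LHS](talgE a) tmul_suml [RHS]talgE.
by apply/eq_bigr => g _; rewrite tmulUU mulr1 cocycle0r mulr1 addr0.
Qed.

Lemma tmulA : associative tmul.
Proof.
move=> a b c.
rewrite [in LHS](talgE a) [in RHS](talgE a) !tmul_suml.
apply/eq_bigr => g _; set x := a@_g.
rewrite [in LHS](talgE b) [in RHS](talgE b) tmul_suml !tmul_sumr tmul_suml.
apply/eq_bigr => h _; set y := b@_h.
rewrite [in LHS](talgE c) [in RHS](talgE c) !tmul_sumr.
apply/eq_bigr => k _; rewrite !tmulUU addrA; congr << _ *g _ >>.
rewrite -!mulrA; congr (_ * _); congr (_ * _).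
by rewrite -cocycleA mulrCA.
Qed.

Lemma tone_neq0 : tone != 0.
Proof. by apply/eqP => /malgP/(_ 0)/eqP; rewrite mcoeffUU mcoeff0 oner_eq0. Qed.

HB.instance Definition _ := GRing.Zmodule_isNzRing.Build (talg w)
  tmulA tmul1g tmulg1 tmulDl tmulDr tone_neq0.

Lemma tscaleU (x y : R) g : x *: (<< y *g g >> : talg w) = << x * y *g g >>.
Proof. by apply/malgP => h; rewrite mcoeffZ !mcoeffU mulrnAr. Qed.

Lemma tscaleAl (x : R) a b : x *: (a * b) = (x *: a) * b.
Proof.
rewrite -![_ * b]/(tmul _ b) [in LHS](talgE a) [in RHS](talgE a).
rewrite [in RHS]scaler_sumr !tmul_suml [LHS]scaler_sumr.
apply/eq_bigr => g _; set y := a@_g.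
rewrite tscaleU [in LHS](talgE b) [in RHS](talgE b) !tmul_sumr scaler_sumr.
by apply/eq_bigr => h _; rewrite !tmulUU tscaleU !mulrA.
Qed.

Lemma tscaleAr (x : R) a b : x *: (a * b) = a * (x *: b).
Proof.
rewrite -![a * _]/(tmul a _) [in LHS](talgE b) [in RHS](talgE b).
rewrite [in RHS]scaler_sumr !tmul_sumr [LHS]scaler_sumr.
apply/eq_bigr => h _; set y := b@_h.
rewrite tscaleU [in LHS](talgE a) [in RHS](talgE a) !tmul_suml scaler_sumr.
apply/eq_bigr => g _; rewrite !tmulUU tscaleU !mulrA.
by rewrite [x * _]mulrC.
Qed.

HB.instance Definition _ := GRing.Lmodule_isLalgebra.Build R (talg w) tscaleAl.
HB.instance Definition _ := GRing.Lalgebra_isAlgebra.Build R (talg w) tscaleAr.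

End TwistedAlgebra.

Section GroupAlgebra.
Variables (R : comNzRingType) (G : zmodType).

Definition trivial_cocycle : cocycle R G.
Proof. by exists (fun _ _ => 1) => *; rewrite ?mulr1. Defined.

Definition galg : Type := talg trivial_cocycle.

HB.instance Definition _ := GRing.Algebra.on galg.

Lemma galg_mulC (a b : galg) : a * b = b * a.
Proof.
rewrite -[a * b]/(tmul (w := trivial_cocycle) a b).
rewrite -[b * a]/(tmul (w := trivial_cocycle) b a) /tmul exchange_big.
apply/eq_bigr => h _; apply/eq_bigr => g _.
by rewrite addrC [a@_g * _]mulrC.
Qed.

HB.instance Definition _ := GRing.PzRing_hasCommutativeMul.Build galg galg_mulC.

End GroupAlgebra.

(** * The base ring [Z[v, v^-1]], [v = q^(1/2)] *)

Definition kk : Type := galg int int.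
HB.instance Definition _ := GRing.ComNzRing.on kk.

Definition vpow (z : int) : kk := << z >>.

Lemma vpowD x y : vpow (x + y) = vpow x * vpow y.
Proof. by rewrite -[RHS]/(tmul (w := trivial_cocycle _ _) << x >> << y >>) tmulUU. Qed.

Definition kbar (a : kk) : kk := \sum_(z <- msupp a) << a@_z *g - z >>.

(* [v^-1 Z[v^-1]] *)
Definition in_mm (a : kk) : Prop := forall z, z \in msupp a -> z < 0.

Definition posp (x : int) : int := Num.max x 0.

(** * Quantum seeds

    The vertex set is ['I_(nu + nf)]; the first [nu] vertices are unfrozen. *)

Section QuantumSeed.
Variables nu nf : nat.

Local Notation lattice := 'cV[int]_(nu + nf).

Definition fvec (i : 'I_(nu + nf)) : lattice := delta_mx i 0.

Definition form (L : 'M[int]_(nu + nf)) (m m' : lattice) : int :=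
  (m^T *m L *m m') 0 0.

Definition skew_symmetrizable (B : 'M[int]_nu) : Prop :=
  exists d : 'I_nu -> int,
    (forall i, 0 < d i) /\ (forall i j, d i * B i j = - (d j * B j i)).

Definition is_seed (B : 'M[int]_(nu + nf, nu)) (L : 'M[int]_(nu + nf)) : Prop :=
  [/\ \rank (map_mx intr B : 'M[rat]_(nu + nf, nu)) = nu,
      skew_symmetrizable (usubmx B),
      L^T = - L
    & exists d : 'rV[int]_nu,
        (forall k, 0 < d 0 k) /\ B^T *m L = row_mx (diag_mx d) 0].

Record seed := Seed {
  sB : 'M[int]_(nu + nf, nu);
  sL : 'M[int]_(nu + nf);
  seedP : is_seed sB sL
}.

Definition mut_B (k : 'I_nu) (B : 'M[int]_(nu + nf, nu)) :
    'M[int]_(nu + nf, nu) :=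
  let k' := lshift nf k in
  \matrix_(i, j)
    if (i == k') || (j == k) then - B i j
    else B i j + B i k * posp (B k' j) + posp (- B i k) * B k' j.

Definition mut_fvec (k : 'I_nu) (B : 'M[int]_(nu + nf, nu)) (i : 'I_(nu + nf)) :
    lattice :=
  let k' := lshift nf k in
  if i == k' then - fvec k' + \sum_j posp (- B j k) *: fvec j else fvec i.

Definition mut_L (k : 'I_nu) (B : 'M[int]_(nu + nf, nu))
    (L : 'M[int]_(nu + nf)) : 'M[int]_(nu + nf) :=
  \matrix_(i, j) form L (mut_fvec k B i) (mut_fvec k B j).

Lemma compat_rank (B : 'M[int]_(nu + nf, nu)) (L : 'M[int]_(nu + nf))
    (d : 'rV[int]_nu) :
  (forall k, 0 < d 0 k) -> B^T *m L = row_mx (diag_mx d) 0 ->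
  \rank (map_mx intr B : 'M[rat]_(nu + nf, nu)) = nu.
Proof.
move=> d_gt0 BL; apply/eqP; rewrite eqn_leq rank_leq_col /=.
pose C : 'M[rat]_(nu + nf, nu) := map_mx intr (L *m col_mx 1%:M 0).
have E : map_mx intr B^T *m C = diag_mx (map_mx intr d).
  rewrite /C -map_mxM mulmxA BL mul_row_col mulmx1 mul0mx addr0.
  by rewrite map_diag_mx.
have rkD : \rank (diag_mx (map_mx intr d) : 'M[rat]_nu) = nu.
  apply: mxrank_unit; rewrite unitmxE det_diag unitfE; apply/prodf_neq0 => i _.
  by rewrite mxE intr_eq0 gt_eqF.
rewrite -mxrank_tr map_trmx -[X in (X <= _)%N]rkD -E.
exact: mxrankM_maxl.
Qed.

Lemma compat_skew (B : 'M[int]_(nu + nf, nu)) (L : 'M[int]_(nu + nf))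
    (d : 'rV[int]_nu) :
  L^T = - L -> B^T *m L = row_mx (diag_mx d) 0 ->
  forall i j, d 0 i * usubmx B i j = - (d 0 j * usubmx B j i).
Proof.
move=> Lskew BL i j.
have E : B^T *m L *m B = diag_mx d *m usubmx B.
  by rewrite BL -{1}[B]vsubmxK mul_row_col mul0mx addr0.
have /matrixP/(_ i j) : (B^T *m L *m B)^T = - (B^T *m L *m B).
  by rewrite !trmx_mul trmxK Lskew mulNmx mulmxN mulmxA.
by rewrite E mul_diag_mx !mxE => ->; rewrite opprK.
Qed.

(* The matrix of the vectors [mut_fvec]. *)
Definition mut_E (k : 'I_nu) (B : 'M[int]_(nu + nf, nu)) : 'M[int]_(nu + nf) :=
  \matrix_(i, j) mut_fvec k B j i 0.

Lemma mut_EE k (B : 'M[int]_(nu + nf, nu)) i j : B (lshift nf k) k = 0 ->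
  mut_E k B i j =
    if j == lshift nf k then
      (if i == lshift nf k then -1 else posp (- B i k))
    else (i == j)%:R.
Proof.
move=> Bkk; rewrite mxE /mut_fvec; case: (eqVneq j (lshift nf k)) => [_|jk]; last first.
  by rewrite mxE eqxx andbT.
rewrite mxE [in LHS]mxE !mxE summxE (bigD1 i) //= big1 => [|l li].
  rewrite !mxE !eqxx andbT addr0 mulr1; case: eqVneq => [->|_].
    by rewrite Bkk oppr0 /posp maxxx addr0.
  by rewrite oppr0 add0r.
by rewrite !mxE eq_sym (negbTE li) mulr0.
Qed.

Lemma mut_EX k (B : 'M[int]_(nu + nf, nu)) p (X : 'M[int]_(nu + nf, p)) i j :
  B (lshift nf k) k = 0 ->
  (mut_E k B *m X) i j =
    if i == lshift nf k then - X (lshift nf k) j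
    else X i j + posp (- B i k) * X (lshift nf k) j.
Proof.
set k' := lshift nf k => Bkk; rewrite mxE (bigD1 k') //= mut_EE // eqxx.
under eq_bigr => l lk do rewrite mut_EE // (negbTE lk).
case: eqVneq => [->|ik].
  rewrite big1 ?addr0 ?mulN1r // => l lk.
  by rewrite eq_sym (negbTE lk) mul0r.
rewrite addrC (bigD1 i) //= eqxx mul1r big1 ?addr0 // => l /andP[_ li].
by rewrite eq_sym (negbTE li) mul0r.
Qed.

Lemma mut_LE k B L : mut_L k B L = (mut_E k B)^T *m L *m mut_E k B.
Proof.
have Ecol j : col j (mut_E k B) = mut_fvec k B j.
  by apply/colP => i; rewrite !mxE.
apply/matrixP => i j; rewrite mxE -!Ecol /form tr_col -row_mul.
by rewrite [LHS]mxE [RHS]mxE; apply/eq_bigr => l _; congr (_ * _); rewrite mxE.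
Qed.

Lemma compat_diag0 (B : 'M[int]_(nu + nf, nu)) L (d : 'rV[int]_nu) k :
  (forall k, 0 < d 0 k) -> L^T = - L -> B^T *m L = row_mx (diag_mx d) 0 ->
  B (lshift nf k) k = 0.
Proof.
move=> d_gt0 Lskew BL; have := compat_skew Lskew BL k k; rewrite mxE => /eqP.
rewrite -addr_eq0 -mulr2n mulrn_eq0 /= mulf_eq0 gt_eqF ?d_gt0 //=.
by move=> /eqP.
Qed.

Lemma mut_is_seed k B L : is_seed B L -> is_seed (mut_B k B) (mut_L k B L).
Proof.
case=> _ _ Lskew [d [d_gt0 BL]].
have dB := compat_skew Lskew BL.
set k' := lshift nf k.
have Bkk : B k' k = 0 := compat_diag0 k d_gt0 Lskew BL.
pose E := mut_E k B; have EE i j := mut_EE i j Bkk.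
pose F : 'M[int]_nu := \matrix_(i, j)
  if i == k then (if j == k then -1 else posp (B k' j)) else (i == j)%:R.
have LE : mut_L k B L = E^T *m L *m E := mut_LE k B L.
have EX p (X : 'M[int]_(nu + nf, p)) i j := mut_EX X i j Bkk.
have XF p (X : 'M[int]_(p, nu)) i j : (X *m F) i j =
    if j == k then - X i k else X i j + X i k * posp (B k' j).
  rewrite mxE (bigD1 k) //= mxE eqxx.
  under eq_bigr => l lk do rewrite mxE (negbTE lk).
  case: eqVneq => [->|jk].
    rewrite big1 ?addr0 ?mulrN1 // => l lk.
    by rewrite (negbTE lk) mulr0.
  rewrite addrC (bigD1 j) //= eqxx mulr1 big1 ?addr0 // => l /andP[_ lj].
  by rewrite (negbTE lj) mulr0.
have BE : mut_B k B = E *m B *m F.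
  apply/matrixP => i j; rewrite XF !EX mxE.
  case: (eqVneq i k') => [->|ik]; case: (eqVneq j k) => [->|jk] //=.
  - by rewrite Bkk !oppr0.
  - by rewrite Bkk oppr0 mul0r addr0.
  - by rewrite Bkk mulr0 addr0.
  - by rewrite Bkk mulr0 addr0 addrAC.
have E2 : E *m E = 1%:M.
  apply/matrixP => i j; rewrite EX !EE mxE eqxx.
  case: (eqVneq j k') => [->|jk].
    rewrite ?eqxx; case: (eqVneq i k') => [_|ik]; first by rewrite ?eqxx opprK.
    by rewrite ?eqxx mulrN1 addrN.
  rewrite mulr0 addr0 oppr0.
  by case: (eqVneq i k') => [->|//]; rewrite eq_sym (negbTE jk).
have DE : F^T *m row_mx (diag_mx d) 0 = row_mx (diag_mx d) 0 *m E.
  set W := row_mx _ _.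
  have WE i l : W i l = (l == lshift nf i)%:R * d 0 i.
    rewrite /W mxE; case: splitP => l' ll'; rewrite mxE.
      have -> : l = lshift nf l' by apply: val_inj.
      rewrite (inj_eq (@lshift_inj _ _)) [l' == i]eq_sym.
      by case: eqVneq => [->|]; rewrite ?mulr1n ?mul1r ?mulr0n ?mul0r.
    have -> : l = rshift nu l' by apply: val_inj.
    by rewrite eq_rlshift mul0r.
  have pospM x y : 0 < x -> x * posp y = posp (x * y).
    by move=> x_gt0; rewrite /posp maxr_pMr ?mulr0 // ltW.
  apply: trmx_inj; rewrite !trmx_mul trmxK.
  apply/matrixP => j i; rewrite XF [RHS]mxE (bigD1 (lshift nf i)) //=.
  rewrite big1 => [|l li]; last by rewrite ![_^T _ _]mxE WE (negbTE li) mul0r mulr0.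
  rewrite ![_^T _ _]mxE !WE EE eqxx mul1r addr0 (inj_eq (@lshift_inj _ _)).
  case: (eqVneq j k') => [->|jk]; case: (eqVneq i k) => [->|ik] //.
  - by rewrite mul1r mulN1r.
  - rewrite (inj_eq (@lshift_inj _ _)) eq_sym (negbTE ik) mul0r add0r mul1r.
    rewrite pospM // [RHS]mulrC pospM // mulrN.
    by have := dB i k; rewrite !mxE => ->; rewrite opprK.
  - by rewrite eq_sym (negbTE jk) !mul0r oppr0.
  - by rewrite eq_sym !mul0r addr0.
have L'skew : (mut_L k B L)^T = - mut_L k B L.
  by rewrite LE !trmx_mul trmxK Lskew mulNmx mulmxN mulmxA.
have BL' : (mut_B k B)^T *m mut_L k B L = row_mx (diag_mx d) 0.
  rewrite LE BE !trmx_mul -!mulmxA [E^T *m (E^T *m _)]mulmxA -trmx_mul E2 trmx1.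
  by rewrite mul1mx [B^T *m _]mulmxA BL mulmxA DE -mulmxA E2 mulmx1.
split=> //.
- exact: compat_rank d_gt0 BL'.
- by exists (d 0); split=> //; apply: compat_skew L'skew BL'.
- by exists d.
Qed.

Definition mutate (k : 'I_nu) (t : seed) : seed :=
  Seed (mut_is_seed k (seedP t)).

(* [mpath t t'] is the type of mutation sequences from [t] to [t']; the head of
   the path is the mutation performed first. *)
Inductive mpath : seed -> seed -> Type :=
| mnil t : mpath t t
| mcons t k t' : mpath (mutate k t) t' -> mpath t t'.

(* The set of seeds obtained from [t0] by iterated mutations. *)
Definition Delta (t0 : seed) : set seed := [set t | inhabited (mpath t0 t)].

Lemma mutateK k t : mutate k (mutate k t) = t.
Proof.
case: t => B L BL; have [_ _ Lskew [d [d_gt0 BLd]]] := BL.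
have Bkk := compat_diag0 k d_gt0 Lskew BLd.
set k' := lshift nf k in Bkk.
have pospN x : posp x = x + posp (- x).
  rewrite /posp; case: (lerP 0 x) => x0.
    by rewrite max_r ?addr0 // oppr_le0.
  by rewrite max_l ?subrr // oppr_ge0 ltW.
have eqB : mut_B k (mut_B k B) = B.
  apply/matrixP => i j; rewrite !mxE -/k' !eqxx orbT /=.
  case: (boolP (_ || _)) => [_|_]; first by rewrite opprK.
  by rewrite opprK (pospN (B k' j)) (pospN (B i k)); ring.
have eqL : mut_L k (mut_B k B) (mut_L k B L) = L.
  have B'kk : mut_B k B k' k = 0 by rewrite mxE !eqxx Bkk oppr0.
  have EE' : mut_E k B *m mut_E k (mut_B k B) = 1%:M + B *m delta_mx k k'.
    apply/matrixP => i j; rewrite mut_EX // -/k' !mut_EE // -/k' eqxx.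
    have -> : (1%:M + B *m delta_mx k k') i j = (i == j)%:R + (j == k')%:R * B i k.
      rewrite !mxE (bigD1 k) //= big1 => [|l lk]; last first.
        by rewrite !mxE (negbTE lk) mulr0.
      by rewrite mxE eqxx addr0 mulrC.
    rewrite mxE eqxx orbT opprK.
    case: (eqVneq j k') => [->|jk]; case: (eqVneq i k') => [->|ik].
    - by rewrite Bkk opprK mulr0 addr0.
    - by rewrite (pospN (B i k)) mulrN1 addrK mul1r add0r.
    - by rewrite ?[k' == j]eq_sym ?(negbTE jk) mul0r oppr0 addr0.
    - by rewrite ?[k' == j]eq_sym ?(negbTE jk) mulr0 mul0r.
  rewrite !mut_LE -!mulmxA EE' mulmxA -trmx_mul EE'.
  set N := B *m delta_mx k k'.
  have NL : N^T *m L = d 0 k *: delta_mx k' k'.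
    rewrite /N trmx_mul -mulmxA BLd; apply/matrixP => i j.
    rewrite trmx_delta !mxE (bigD1 k) //= big1 => [|l lk]; last first.
      by rewrite mxE (negbTE lk) andbF mul0r.
    rewrite !mxE eqxx andbT addr0; case: splitP => l jl; rewrite mxE.
      have -> : j = lshift nf l by apply: val_inj.
      rewrite (inj_eq (@lshift_inj _ _)) [l == k]eq_sym.
      by case: (i == k'); case: (k == l); rewrite ?(mul1r, mul0r, mulr1, mulr0).
    have -> : j = rshift nu l by apply: val_inj.
    by rewrite eq_rlshift andbF !mulr0.
  have LN : L *m N = - (d 0 k *: delta_mx k' k').
    by rewrite -NL -[LHS]trmxK trmx_mul Lskew mulmxN linearN /= NL linearZ /= trmx_delta.
  rewrite linearD /= trmx1 mulmxDl mul1mx mulmxDr mulmx1 LN mulmxDr NL.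
  have -> : N^T *m - (d 0 k *: delta_mx k' k') = 0.
    suff ND : N^T *m delta_mx k' k' = 0 by rewrite mulmxN -scalemxAr ND scaler0 oppr0.
    apply/matrixP => i j; rewrite mxE [RHS]mxE big1 // => l _; rewrite mxE [delta_mx _ _ _ _]mxE.
    case: (eqVneq l k') => [->|_]; last by rewrite mulr0.
    rewrite mxE (bigD1 k) //= big1 => [|m mk]; first by rewrite Bkk !mul0r ?addr0 ?mul0r.
    by rewrite mxE (negbTE mk) mulr0.
  by rewrite addr0 subrK.
rewrite /mutate /=; move: (mut_is_seed _ _) => /=.
rewrite eqB eqL => BL'; congr Seed; exact: Prop_irrelevance.
Qed.

Fixpoint mcat t t' t'' (p : mpath t t') : mpath t' t'' -> mpath t t'' :=
  match p in mpath t t' return mpath t' t'' -> mpath t t'' with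
  | mnil _ => id
  | mcons t k _ p' => fun q => mcons (mcat p' q)
  end.

(* Every seed of [Delta t0] is reached from every other one, so that
   quantifying over the mutation sequences starting at [t] covers [Delta t0]. *)
Lemma Delta_path t0 t t' :
  Delta t0 t -> Delta t0 t' -> inhabited (mpath t t').
Proof.
have rev : forall t t', mpath t t' -> inhabited (mpath t' t).
  move=> s s'; elim=> [u|u k u' _ [q]]; first by split; exact: mnil.
  split; apply: (mcat q); apply: (@mcons _ k); rewrite mutateK; exact: mnil.
by move=> [p] [q]; case: (rev _ _ p) => p'; split; exact: mcat p' q.
Qed.

(** * Quantum tori *)

Lemma formDl L m1 m2 m : form L (m1 + m2) m = form L m1 m + form L m2 m.
Proof. by rewrite /form linearD !mulmxDl mxE. Qed.

Lemma formDr L m m1 m2 : form L m (m1 + m2) = form L m m1 + form L m m2.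
Proof. by rewrite /form mulmxDr mxE. Qed.

Definition torus_cocycle (L : 'M[int]_(nu + nf)) : cocycle kk lattice.
Proof.
exists (fun m m' => vpow (form L m m')).
- by move=> m; rewrite /form trmx0 !mul0mx mxE.
- by move=> m; rewrite /form mulmx0 mxE.
- by move=> a b c; rewrite -!vpowD formDl formDr addrA [in LHS]addrC.
Defined.

(* The product of [LP t] is the twisted one. *)
Definition LP (t : seed) : Type := talg (torus_cocycle (sL t)).
HB.instance Definition _ t := GRing.Algebra.on (LP t).

Definition Xm (t : seed) (m : lattice) : LP t := << m >>.

(* The commutative product. *)
Definition cmul (t : seed) (a b : LP t) : LP t :=
  (a : galg kk lattice) * (b : galg kk lattice).

Lemma XmM t m m' : Xm t m * Xm t m' = vpow (form (sL t) m m') *: Xm t (m + m').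
Proof. by rewrite -[LHS]/(tmul _ _) tmulUU tscaleU !mul1r mulr1. Qed.

Lemma cmul_Xm t m m' : cmul (Xm t m) (Xm t m') = Xm t (m + m').
Proof. by rewrite /cmul -[LHS]/(tmul (w := trivial_cocycle _ _) _ _) tmulUU !mulr1. Qed.

Definition natz (n : 'cV[nat]_nu) : 'cV[int]_nu := map_mx Posz n.

Definition Ym (t : seed) (n : 'cV[nat]_nu) : LP t := Xm t (sB t *m natz n).

(* As [X^m] is bar-invariant, the anti-automorphism acts on coefficients. *)
Definition bar (t : seed) (z : LP t) : LP t :=
  \sum_(m <- msupp z) << kbar z@_m *g m >>.

(** ** Degrees *)

Definition preceq (t : seed) (m' m : lattice) : Prop :=
  exists n : 'cV[nat]_nu, m' = m + sB t *m natz n.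

Definition prec (t : seed) (m' m : lattice) : Prop := preceq t m' m /\ m' <> m.

Definition pointed (t : seed) (g : lattice) (z : LP t) : Prop :=
  exists (s : seq 'cV[nat]_nu) (c : 'cV[nat]_nu -> kk),
    [/\ uniq s, 0 \notin s
      & z = cmul (Xm t g) (1 + \sum_(n <- s) c n *: Ym t n)].

Definition max_degree (t : seed) (z : LP t) (d : lattice) : Prop :=
  d \in msupp z /\ forall d', d' \in msupp z -> ~ prec t d d'.

(* [w] is the normalization [z]^t of [z]. *)
Definition normalization (t : seed) (z w : LP t) : Prop :=
  exists d, [/\ max_degree z d, forall d', max_degree z d' -> d' = d
              & z = z@_d *: w].

Definition trop_mut (k : 'I_nu) (t : seed) (g : lattice) : lattice :=
  let k' := lshift nf k in
  \col_i
    if i == k' then - g k' 0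
    else if 0 <= g k' 0 then g i 0 + posp (sB t i k) * g k' 0
    else g i 0 + posp (- sB t i k) * g k' 0.

Fixpoint trop (t t' : seed) (p : mpath t t') : lattice -> lattice :=
  match p with
  | mnil _ => id
  | mcons t k _ p' => fun g => trop p' (trop_mut k t g)
  end.

(** ** Skew-fields of fractions and mutation isomorphisms *)

(* A skew-field of fractions of the Ore domain [LP t]; it is unique up to a
   unique isomorphism over [LP t]. *)
Record frac_field (t : seed) := FracField {
  frac_sort :> unitAlgType kk;
  frac_emb : {lrmorphism LP t -> frac_sort};
  frac_emb_inj : injective frac_emb;
  frac_unit : forall z : frac_sort, z != 0 -> z \is a GRing.unit;
  fracP : forall z : frac_sort,
    exists a b : LP t, b != 0 /\ z = frac_emb a / frac_emb b
}.

(* The isomorphism mu_k^* from [F(mutate k t)] to [F(t)] together with its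
   inverse; the last two conditions determine it. *)
Record mut_iso (F : forall t, frac_field t) (k : 'I_nu) (t : seed) := MutIso {
  mu_fun : {lrmorphism F (mutate k t) -> F t};
  mu_inv : F t -> F (mutate k t);
  mu_funK : cancel mu_fun mu_inv;
  mu_invK : cancel mu_inv mu_fun;
  mu_fun_neq : forall i, i != lshift nf k ->
    mu_fun (frac_emb _ (Xm _ (fvec i))) = frac_emb (F t) (Xm t (fvec i));
  mu_fun_eq : let k' := lshift nf k in
    mu_fun (frac_emb _ (Xm _ (fvec k'))) =
    frac_emb (F t)
      (Xm t (- fvec k' + \sum_j posp (- sB t j k) *: fvec j) +
       Xm t (- fvec k' + \sum_j posp (sB t j k) *: fvec j))
}.

Section Ambient.
Variable F : forall t, frac_field t.
Variable mu : forall k t, mut_iso F k t.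

(* The composite [F(t') -> F(t)] of the mutation isomorphisms along a mutation
   sequence, and its inverse. *)
Fixpoint mus (t t' : seed) (p : mpath t t') : F t' -> F t :=
  match p in mpath t t' return F t' -> F t with
  | mnil _ => id
  | mcons t k _ p' => fun z => mu_fun (mu k t) (mus p' z)
  end.

Fixpoint mus_inv (t t' : seed) (p : mpath t t') : F t -> F t' :=
  match p in mpath t t' return F t -> F t' with
  | mnil _ => id
  | mcons t k _ p' => fun z => mus_inv p' (mu_inv (mu k t) z)
  end.

Definition emb (t : seed) : LP t -> F t := frac_emb (F t).

Definition LPset (t : seed) : set (F t) := range (@emb t).
Arguments LPset : clear implicits.

Definition pointedF (t : seed) (g : lattice) (Z : F t) : Prop :=
  exists2 z : LP t, Z = emb z & pointed g z.

Definition Uq (t0 t : seed) : set (F t) :=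
  [set Z | forall t', Delta t0 t' -> forall p : mpath t t',
             (mus p @` LPset t') Z].
Arguments Uq : clear implicits.

Definition natI (m : 'cV[nat]_(nu + nf)) : lattice := map_mx Posz m.

(* The quantum cluster monomials of the endpoint [t'] of [p], in [F(t)]. *)
Definition cluster_monomials (t t' : seed) (p : mpath t t') : set (F t) :=
  range (fun m => mus p (emb (Xm t' (natI m)))).

(* The endpoint [t1] of [p] is [t[1]]. *)
Definition is_shift (t t1 : seed) (p : mpath t t1) : Prop :=
  exists s : 'S_nu, forall k : 'I_nu, exists g : lattice,
    pointedF g (mus p (emb (Xm t1 (fvec (lshift nf (s k)))))) /\
    usubmx g = - delta_mx k 0.

Definition compatibly_pointed (t t' : seed) (p : mpath t t') (S : set (F t)) :
    Prop :=
  forall Z, S Z ->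
    [/\ LPset t Z, (mus p @` LPset t') Z
      & exists g, pointedF g Z /\ pointedF (trop p g) (mus_inv p Z)].

Definition pointed_family (t : seed) (S : set (F t)) (Sg : lattice -> F t) :
    Prop :=
  S = range Sg /\ forall g, pointedF g (Sg g).

Definition compatible (t t' : seed) (p : mpath t t')
    (S : set (F t)) (S' : set (F t')) : Prop :=
  exists Sg S'g, [/\ pointed_family S Sg, pointed_family S' S'g
    & forall g, mus_inv p (Sg g) = S'g (trop p g)].

Definition is_subalgebra (t : seed) (A : set (F t)) : Prop :=
  [/\ A 1, forall x y, A x -> A y -> A (x * y)
    & forall (c : kk) x y, A x -> A y -> A (c *: x + y)].

Definition is_basis (t : seed) (A L : set (F t)) : Prop :=
  (forall s : seq (F t), uniq s -> (forall x, x \in s -> L x) ->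
     forall c : F t -> kk,
       \sum_(x <- s) c x *: x = 0 -> forall x, x \in s -> c x = 0) /\
  (forall z, A z <-> exists (s : seq (F t)) (c : F t -> kk),
     (forall x, x \in s -> L x) /\ z = \sum_(x <- s) c x *: x).

Definition triangular_basis (t0 t : seed) (A L : set (F t)) : Prop :=
  [/\ is_subalgebra A, A `<=` Uq t0 t, is_basis A L,
      forall z : LP t, L (emb z) -> bar z = z
    & [/\ cluster_monomials (mnil t) `<=` L,
          exists (t1 : seed) (p : mpath t t1),
            is_shift p /\ cluster_monomials p `<=` L
        & exists Lg : lattice -> F t, pointed_family L Lg /\
          forall (i : 'I_(nu + nf)) (g : lattice),
          exists (z w : LP t) (s : seq lattice) (b : lattice -> kk),
            [/\ emb z = emb (Xm t (fvec i)) * Lg g, normalization z w, uniq s,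
                forall g', g' \in s -> prec t g' (g + fvec i) /\ in_mm (b g')
              & emb w = Lg (g + fvec i) + \sum_(g' <- s) b g' *: Lg g']]].

Definition common_triangular_basis (t0 t : seed) (A L : set (F t)) : Prop :=
  (forall t', Delta t0 t' -> forall p : mpath t t',
     triangular_basis t0 (mus_inv p @` A) (mus_inv p @` L)) /\
  (forall t' t'', Delta t0 t' -> Delta t0 t'' ->
   forall (p : mpath t t') (q : mpath t' t''),
     compatible q (mus_inv p @` L) (mus_inv q @` (mus_inv p @` L))).

End Ambient.
End QuantumSeed.

(* Main.v *)
(** The shift [t -> t[1]] determines a linear isometry [W] from the lattice of
    [t] onto that of [t[1]] which carries the columns of [sB t] to those of
    [sB t[1]], permuted by [sigma], and such that [trop p g = - W g] whenever the
    unfrozen part of [g] is nonpositive.  By Lusztig's uniqueness argument, the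
    triangular basis at [t[1]] is the image under [W] of the one at [t].

    Let [k] be an unfrozen vertex and [t' = mu_k t].  Crossing one wall only, the
    mutation of [t[1]] at [sigma k] adds cluster monomials whose expansions at [t]
    are explicit rank one elements, transported by [W].  Multiplying the basis
    elements at degrees of cluster monomials of [t[1]] and of this mutation by
    monomials of [t] yields, for each [g], an element which is unitriangular over
    the basis modulo [m] and whose degrees are controlled at both [t] and [t'].
    As coefficients in [m] fixed by the bar involution vanish, every basis
    element is itself compatibly pointed at [t] and [t'].  The mutated family is
    again a triangular basis, in the same relation to the mutation of [t[1]] at
    [sigma k], so that the argument propagates along all mutation sequences.

    Degrees are read off from leading exponents with respect to total orders on
    the lattice, which extend to the skew-fields of fractions; the sign coherence
    that makes them independent of the order follows from the quantum Laurent
    phenomenon. *)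

(* The triangularity axiom controls left multiplication by the variables of [t] only, and says
   nothing about the variable created by a mutation. Right multiplication by cluster monomials of
   the shift is the substitute: any degree is [a - v] with [a] and [v] nonnegative, [- v] is the
   degree of a cluster monomial of the shift, and two such monomials standing side by side merge
   into one. This controls products of combinations that are unitriangular modulo [mm]; [inv_tri]
   passes from these to single basis elements.

   The sign in [W] comes from the leads [G] of the cluster of [t[1]], whose unfrozen parts are
   opposites of unit vectors: [W] is the opposite of the inverse of [G]. It matches columns without
   rescaling because [G] and its inverse are both integral.

   The triangular basis at [t[1]] comes with a shift of [t[1]] that is only known to exist. Its
   cluster monomials have to be identified, through their leads, with those of the endpoint of a
   sequence starting at [t[1]], parallel to the one from [t] to [t[1]]. *)
From HB Require Import structures.
From mathcomp Require Import all_boot all_order all_algebra.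
From mathcomp Require Import perm finmap ring zify.
From mathcomp Require Import boolp classical_sets.
From mathcomp.multinomials Require Import monalg.
Require Import Defs.

Set Implicit Arguments.
Unset Strict Implicit.
Unset Printing Implicit Defensive.

Import Order.TTheory GRing.Theory Num.Theory.
Local Open Scope classical_set_scope.
Local Open Scope ring_scope.

(* Free modules with basis [mono], behind an interface: conversion tests on
   [{malg R[G]}] unfold sums and scalings, which makes them intractable. *)
Record freemod (R : comNzRingType) (G : zmodType) := FreeMod {
  fm_sort :> lmodType R;
  cf : fm_sort -> G -> R;
  supp : fm_sort -> {fset G};
  mono : G -> fm_sort;
  cfD : forall y z g, cf (y + z) g = cf y g + cf z g;
  cfZ : forall c y g, cf (c *: y) g = c * cf y g;
  cfX : forall h g, cf (mono h) g = (h == g)%:R;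
  suppE : forall y g, (g \in supp y) = (cf y g != 0);
  fmE : forall y, y = \sum_(g <- supp y) cf y g *: mono g
}.

(** * Supports and linear extension in a free module *)

Section FreeModule.
Variables (R : comNzRingType) (G : zmodType) (T : freemod R G).
Implicit Types (V W : lmodType R) (y z : T) (g h : G).

Lemma cf0 g : cf (0 : T) g = 0.
Proof. by rewrite -(scale0r 0) cfZ mul0r. Qed.

Lemma cfN y g : cf (- y) g = - cf y g.
Proof. by rewrite -scaleN1r cfZ mulN1r. Qed.

Lemma cfB y z g : cf (y - z) g = cf y g - cf z g.
Proof. by rewrite cfD cfN. Qed.

Lemma cf_sum (I : Type) (r : seq I) (f : I -> T) g :
  cf (\sum_(i <- r) f i) g = \sum_(i <- r) cf (f i) g.
Proof. exact: (big_morph (fun y => cf y g) (fun y z => cfD y z g) (cf0 g)). Qed.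

Lemma cf_out y g : g \notin supp y -> cf y g = 0.
Proof. by rewrite suppE negbK => /eqP. Qed.

Lemma cf_ext y z : (forall g, cf y g = cf z g) -> y = z.
Proof.
move=> yz; have S : supp y = supp z by apply/fsetP => g; rewrite !suppE yz.
by rewrite (fmE y) (fmE z) S; apply: eq_bigr => g _; rewrite yz.
Qed.

Lemma mono_neq0 g : mono T g != 0.
Proof. by apply/eqP => E; have /eqP := cfX T g g; rewrite E cf0 eqxx eq_sym oner_eq0. Qed.

Lemma supp_mono g h : (h \in supp (mono T g)) = (h == g).
Proof. by rewrite suppE cfX [g == h]eq_sym; case: (h == g); rewrite ?oner_neq0 ?eqxx. Qed.

Lemma suppD y z g : g \in supp (y + z) -> g \in supp y \/ g \in supp z.
Proof.
rewrite !suppE cfD; have [->|yg _] := eqVneq (cf y g) 0; last by left.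
by rewrite add0r; right.
Qed.

Lemma suppZ c y g : g \in supp (c *: y) -> g \in supp y.
Proof. by rewrite !suppE cfZ; apply: contraNneq => ->; rewrite mulr0. Qed.

Lemma suppN y g : (g \in supp (- y)) = (g \in supp y).
Proof. by rewrite !suppE cfN oppr_eq0. Qed.

Lemma supp_exists y : y != 0 -> exists g, g \in supp y.
Proof.
move=> y0; have [[g gy]|no] := pselect (exists g, g \in supp y); first by exists g.
case/eqP: y0; apply: cf_ext => g; rewrite cf0; apply: cf_out.
by apply/negP => gy; case: no; exists g.
Qed.

Definition lin V (f : G -> V) y : V := \sum_(g <- supp y) cf y g *: f g.

Lemma linw V (f : G -> V) (d : {fset G}) y :
  {subset supp y <= d} -> lin f y = \sum_(g <- d) cf y g *: f g.
Proof.
move=> /fsubsetP le; rewrite /lin (big_fset_incl _ le) //= => g _ /cf_out ->.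
by rewrite scale0r.
Qed.

Lemma linP V (f : G -> V) : linear (lin f).
Proof.
move=> c y z; pose d := (supp y `|` supp z)%fset.
rewrite (@linw _ _ d) ?(@linw _ _ d y) ?(@linw _ _ d z).
- rewrite scaler_sumr -big_split; apply: eq_bigr => g _ /=.
  by rewrite cfD cfZ scalerDl scalerA.
- by move=> g; rewrite in_fsetU => ->; rewrite orbT.
- by move=> g; rewrite in_fsetU => ->.
by move=> g /suppD[/suppZ|]; rewrite in_fsetU => ->; rewrite ?orbT.
Qed.

Lemma linD V (f : G -> V) y z : lin f (y + z) = lin f y + lin f z.
Proof. by have := linP f 1 y z; rewrite !scale1r. Qed.

Lemma lin0 V (f : G -> V) : lin f 0 = 0.
Proof. by apply: (addrI (lin f 0)); rewrite -linD !addr0. Qed.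

Lemma linZ V (f : G -> V) c y : lin f (c *: y) = c *: lin f y.
Proof. by have := linP f c y 0; rewrite lin0 !addr0. Qed.

Lemma linN V (f : G -> V) y : lin f (- y) = - lin f y.
Proof. by rewrite -scaleN1r linZ scaleN1r. Qed.

Lemma linB V (f : G -> V) y z : lin f (y - z) = lin f y - lin f z.
Proof. by rewrite linD linN. Qed.

Lemma lin1 V (f : G -> V) g : lin f (mono T g) = f g.
Proof.
rewrite (@linw _ _ [fset g]%fset) ?big_seq_fset1 ?cfX ?eqxx ?scale1r //.
by move=> h; rewrite supp_mono in_fset1.
Qed.

Lemma linX y : lin (mono T) y = y.
Proof. by rewrite [RHS]fmE. Qed.

Lemma lin_comp V W (f : G -> V) (h : V -> W) y :
  linear h -> h (lin f y) = lin (fun g => h (f g)) y.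
Proof.
move=> hl; have hD u v : h (u + v) = h u + h v by have := hl 1 u v; rewrite !scale1r.
have h0 : h 0 = 0 by apply: (addrI (h 0)); rewrite -hD !addr0.
have hZ c u : h (c *: u) = c *: h u by have := hl c u 0; rewrite h0 !addr0.
by rewrite /lin (big_morph h hD h0); apply: eq_bigr => g _; rewrite hZ.
Qed.

Lemma eq_lin V (f h : G -> V) y : {in supp y, f =1 h} -> lin f y = lin h y.
Proof. by move=> fh; apply: eq_big_seq => g gy; rewrite fh. Qed.

Lemma lin_scale_fun V (f : G -> V) c y : lin (fun g => c *: f g) y = c *: lin f y.
Proof.
by rewrite /lin scaler_sumr; apply: eq_bigr => g _; rewrite !scalerA mulrC.
Qed.

Lemma lin_add_fun V (f h : G -> V) y : lin (fun g => f g + h g) y = lin f y + lin h y.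
Proof.
by rewrite /lin -big_split; apply: eq_bigr => g _; rewrite scalerDr.
Qed.

Lemma cf_lin (f : G -> T) y m : cf (lin f y) m = \sum_(g <- supp y) cf y g * cf (f g) m.
Proof. by rewrite cf_sum; apply: eq_bigr => g _; rewrite cfZ. Qed.

Lemma supp_lin (f : G -> T) y m :
  m \in supp (lin f y) -> exists2 g, g \in supp y & m \in supp (f g).
Proof.
rewrite suppE cf_lin => nz.
have [[g gy mg]|no] := pselect (exists2 g, g \in supp y & m \in supp (f g)).
  by exists g.
case/eqP: nz; rewrite big_seq big1 // => g gy.
have [mg|/cf_out ->] := boolP (m \in supp (f g)); last by rewrite mulr0.
by case: no; exists g.
Qed.

Lemma fm_ind (P : T -> Prop) :
  P 0 -> (forall c g y, P y -> P (c *: mono T g + y)) -> forall y, P y.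
Proof.
move=> P0 PD y; rewrite (fmE y).
by elim/big_rec: _ => [|g x _ Px] //; apply: PD.
Qed.

Definition push (f : G -> G) y : T := lin (fun g => mono T (f g)) y.

Lemma cf_push (f : G -> G) y g : injective f -> cf (push f y) (f g) = cf y g.
Proof.
move=> inj_f; rewrite cf_lin.
under eq_bigr do rewrite cfX (inj_eq inj_f).
have [gy|Ng] := boolP (g \in supp y); last first.
  rewrite cf_out // big_seq big1 // => h hy.
  case: eqP => [E|]; last by rewrite mulr0.
  by move: Ng; rewrite -E hy.
rewrite (big_fsetD1 g) //= eqxx mulr1 big_seq big1 ?addr0 // => h.
by rewrite in_fsetD1 => /andP[/negbTE -> _]; rewrite mulr0.
Qed.

Lemma supp_push (f : G -> G) y m :
  m \in supp (push f y) -> exists2 g, g \in supp y & m = f g.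
Proof. by case/supp_lin => g gy; rewrite supp_mono => /eqP ->; exists g. Qed.

Lemma supp_pushE (f : G -> G) y g : injective f -> (f g \in supp (push f y)) = (g \in supp y).
Proof. by move=> fi; rewrite !suppE cf_push. Qed.

Lemma lin_push V (f : G -> G) (h : G -> V) y : lin h (push f y) = lin (fun g => h (f g)) y.
Proof.
rewrite (@lin_comp _ _ _ (lin h)); last exact: linP.
by apply: eq_lin => g _; rewrite lin1.
Qed.

Lemma push_push (f h : G -> G) y : push h (push f y) = push (fun g => h (f g)) y.
Proof. exact: lin_push. Qed.

Lemma push_id (f : G -> G) y : f =1 id -> push f y = y.
Proof. by move=> fE; rewrite -[RHS]linX; apply: eq_lin => g _; rewrite fE. Qed.

Lemma pushZ (f : G -> G) c y : push f (c *: y) = c *: push f y.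
Proof. exact: linZ. Qed.

Lemma push_lin (f : G -> G) (h : G -> T) y : push f (lin h y) = lin (fun g => push f (h g)) y.
Proof. by apply: lin_comp; apply: linP. Qed.

Lemma push_mono (f : G -> G) g : push f (mono T g) = mono T (f g).
Proof. exact: lin1. Qed.

End FreeModule.

(** * Seeds and tropical transformations *)

Lemma posp_ge0 x : 0 <= posp x.
Proof. by rewrite /posp le_max lexx orbT. Qed.

Lemma posp_pos x : 0 <= x -> posp x = x.
Proof. by move=> x0; rewrite /posp max_l. Qed.

Lemma posp_neg x : x <= 0 -> posp x = 0.
Proof. by move=> x0; rewrite /posp max_r. Qed.

Lemma pospB x : posp x - posp (- x) = x.
Proof.
case: (lerP 0 x) => x0; first by rewrite posp_pos // posp_neg ?oppr_le0 // subr0.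
by rewrite (posp_neg (ltW x0)) posp_pos ?oppr_ge0 ?ltW // sub0r opprK.
Qed.

Lemma sum_col_gt0 (r : nat) (n : 'cV[int]_r) :
  (forall k, 0 <= n k 0) -> n != 0 -> 0 < \sum_k n k 0.
Proof.
move=> n0 nn; rewrite lt_neqAle sumr_ge0 // andbT eq_sym psumr_eq0 //.
by apply: contraNN nn => /allP nn; apply/eqP/colP => k; rewrite mxE; apply/eqP/nn/mem_index_enum.
Qed.

Section Seeds.
Variables nu nf : nat.
Local Notation lattice := 'cV[int]_(nu + nf).
Local Notation ix := (lshift nf).
Implicit Types (t u : seed nu nf) (k l : 'I_nu) (m g h : lattice) (e : bool).

(* Sealed, like the powers of [v] and the products below: otherwise conversion
   tests between coefficients compute in matrices and in [int]. *)
Lemma lam_sig t : {f : lattice -> lattice -> int | f = form (sL t)}.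
Proof. by exists (form (sL t)). Qed.

Definition lam t : lattice -> lattice -> int := sval (lam_sig t).

Lemma lamE t : lam t = form (sL t).
Proof. exact: svalP (lam_sig t). Qed.

Lemma lamDl t m1 m2 m : lam t (m1 + m2) m = lam t m1 m + lam t m2 m.
Proof. by rewrite lamE formDl. Qed.

Lemma lamDr t m m1 m2 : lam t m (m1 + m2) = lam t m m1 + lam t m m2.
Proof. by rewrite lamE formDr. Qed.

Lemma lamZl t c m1 m : lam t (c *: m1) m = c * lam t m1 m.
Proof. by rewrite lamE /form linearZ -!scalemxAl mxE. Qed.

Lemma lamZr t c m m1 : lam t m (c *: m1) = c * lam t m m1.
Proof. by rewrite lamE /form -scalemxAr mxE. Qed.

Lemma lamNl t m1 m : lam t (- m1) m = - lam t m1 m.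
Proof. by rewrite -scaleN1r lamZl mulN1r. Qed.

Lemma lamNr t m m1 : lam t m (- m1) = - lam t m m1.
Proof. by rewrite -scaleN1r lamZr mulN1r. Qed.

Lemma lamBl t m1 m2 m : lam t (m1 - m2) m = lam t m1 m - lam t m2 m.
Proof. by rewrite lamDl lamNl. Qed.

Lemma lamBr t m m1 m2 : lam t m (m1 - m2) = lam t m m1 - lam t m m2.
Proof. by rewrite lamDr lamNr. Qed.

Lemma lam0l t m : lam t 0 m = 0.
Proof. by rewrite -(scale0r 0) lamZl mul0r. Qed.

Lemma lam0r t m : lam t m 0 = 0.
Proof. by rewrite -(scale0r 0) lamZr mul0r. Qed.

Lemma lamC t m m' : lam t m m' = - lam t m' m.
Proof.
have [_ _ sk _] := seedP t.
rewrite lamE /form -[in LHS](trmxK (m^T *m sL t *m m')) [in LHS]mxE !trmx_mul trmxK sk.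
by rewrite mulNmx mulmxN mulmxA [LHS]mxE.
Qed.

Lemma lammm t m : lam t m m = 0.
Proof. by have := lamC t m m; lia. Qed.

Definition bc t k : lattice := col k (sB t).

Lemma bcE t k i : bc t k i 0 = sB t i k.
Proof. by rewrite mxE. Qed.

(** The diagonal entry $d'_k$ of the compatibility condition, read off from the form so that no
    witness of [is_seed] has to be chosen. *)
Definition dk t k : int := lam t (bc t k) (fvec (ix k)).

Lemma lam_bc_ex t : exists d : 'rV[int]_nu, (forall k, 0 < d 0 k) /\
  forall k m, lam t (bc t k) m = d 0 k * m (ix k) 0.
Proof.
have [_ _ _ [d [d0 BL]]] := seedP t; exists d; split=> // k m.
rewrite lamE /form /bc tr_col -row_mul BL mxE (bigD1 (ix k)) //= big1 => [|l lk].
  by rewrite addr0 mxE row_mxEl mxE eqxx mulr1n.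
rewrite mxE mxE; case: splitP => l' ll'; rewrite mxE ?mul0r //.
have E : l = ix l' by apply: val_inj.
rewrite (_ : (k == l') = false) ?mulr0n ?mul0r //.
by apply/eqP => kl; move: lk; rewrite E kl eqxx.
Qed.

Lemma fvecE (i j : 'I_(nu + nf)) : (fvec i : lattice) j 0 = (j == i)%:R.
Proof. by rewrite mxE andbT. Qed.

Lemma lam_bc t k m : lam t (bc t k) m = dk t k * m (ix k) 0.
Proof.
have [d [_ dE]] := lam_bc_ex t.
by rewrite /dk !dE fvecE eqxx mulr1.
Qed.

Lemma lam_bcr t k m : lam t m (bc t k) = - (dk t k * m (ix k) 0).
Proof. by rewrite lamC lam_bc. Qed.

Lemma dk_gt0 t k : 0 < dk t k.
Proof.
have [d [d0 dE]] := lam_bc_ex t.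
by rewrite /dk dE fvecE eqxx mulr1.
Qed.

Lemma dk_neq0 t k : dk t k != 0.
Proof. by rewrite gt_eqF ?dk_gt0. Qed.

Lemma bc_diag t k : bc t k (ix k) 0 = 0.
Proof.
have := lammm t (bc t k); rewrite lam_bc => /eqP.
by rewrite mulf_eq0 (negbTE (dk_neq0 t k)) => /eqP.
Qed.

Lemma sB_diag t k : sB t (ix k) k = 0.
Proof. by rewrite -bcE bc_diag. Qed.

Lemma sB_skew t k l : dk t k * sB t (ix k) l = - (dk t l * sB t (ix l) k).
Proof. by rewrite -!bcE -!lam_bc lamC. Qed.

Lemma sB_sign t k l : (0 < sB t (ix k) l) = (sB t (ix l) k < 0).
Proof.
rewrite -(pmulr_rgt0 _ (dk_gt0 t k)) sB_skew oppr_gt0.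
by rewrite pmulr_rlt0 ?dk_gt0.
Qed.

Definition Bz t (n : 'cV[int]_nu) : lattice := sB t *m n.

Lemma Bz_bc t n : Bz t n = \sum_k n k 0 *: bc t k.
Proof.
apply/colP => i; rewrite mxE summxE; apply: eq_bigr => k _.
by rewrite !mxE mulrC.
Qed.

Lemma Bz_delta t k : Bz t (delta_mx k 0) = bc t k.
Proof. by rewrite /Bz /bc colE. Qed.

Lemma BzD t n n' : Bz t (n + n') = Bz t n + Bz t n'.
Proof. exact: mulmxDr. Qed.

Lemma BzN t n : Bz t (- n) = - Bz t n.
Proof. exact: mulmxN. Qed.

Lemma Bz0 t : Bz t 0 = 0.
Proof. exact: mulmx0. Qed.

Lemma BzZ t c n : Bz t (c *: n) = c *: Bz t n.
Proof. by rewrite /Bz scalemxAr. Qed.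

Lemma lam_Bz t n m : lam t (Bz t n) m = \sum_k n k 0 * (dk t k * m (ix k) 0).
Proof.
rewrite Bz_bc; elim/big_rec2: _ => [|k y x _ IH]; first by rewrite lam0l.
by rewrite lamDl lamZl lam_bc IH.
Qed.

Lemma lam_Bz_fvec t n k : lam t (Bz t n) (fvec (ix k)) = n k 0 * dk t k.
Proof.
rewrite lam_Bz (bigD1 k) //= fvecE eqxx mulr1 big1 ?addr0 // => l lk.
by rewrite fvecE (inj_eq (@lshift_inj _ _)) (negbTE lk) !mulr0.
Qed.

Lemma Bz_inj t : injective (Bz t).
Proof.
move=> n n' E; apply/colP => k; apply: (mulIf (dk_neq0 t k)).
by rewrite -!lam_Bz_fvec E.
Qed.

(* The two linear pieces of [trop_mut]; as coordinate maps they are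
   involutions, so that they also give the exponents of the images of
   monomials under the mutation. *)
Definition tau e t k m : lattice :=
  \col_i if i == ix k then - m (ix k) 0
         else m i 0 + posp (if e then - sB t i k else sB t i k) * m (ix k) 0.

Lemma tau_k e t k m : tau e t k m (ix k) 0 = - m (ix k) 0.
Proof. by rewrite mxE eqxx. Qed.

Lemma tauD e t k m m' : tau e t k (m + m') = tau e t k m + tau e t k m'.
Proof.
apply/colP => i; rewrite !mxE; case: eqP => _; first by rewrite opprD.
by rewrite mulrDr addrACA.
Qed.

Lemma tauZ e t k c m : tau e t k (c *: m) = c *: tau e t k m.
Proof.
apply/colP => i; rewrite !mxE; case: eqP => _; first by rewrite mulrN.
by rewrite mulrDr mulrCA.
Qed.

Lemma tauN e t k m : tau e t k (- m) = - tau e t k m.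
Proof. by rewrite -scaleN1r tauZ scaleN1r. Qed.

Lemma tauB e t k m m' : tau e t k (m - m') = tau e t k m - tau e t k m'.
Proof. by rewrite tauD tauN. Qed.

Lemma tau0 e t k : tau e t k 0 = 0.
Proof. by rewrite -(scale0r 0) tauZ !scale0r. Qed.

Lemma tauK e t k : involutive (tau e t k).
Proof.
move=> m; apply/colP => i; rewrite !mxE eqxx; case: eqP => [->|_].
  by rewrite opprK.
by rewrite mulrN addrK.
Qed.

Lemma tau_inj e t k : injective (tau e t k).
Proof. exact: inv_inj (tauK e t k). Qed.

Lemma tau_diff t k m : tau false t k m = tau true t k m + m (ix k) 0 *: bc t k.
Proof.
apply/colP => i; rewrite !mxE; case: eqP => [->|_].
  by rewrite sB_diag mulr0 addr0.
move: (pospB (sB t i k)); move: (posp (sB t i k)) (posp (- _)) => p q <-; ring.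
Qed.

Lemma tau_id e t k m : m (ix k) 0 = 0 -> tau e t k m = m.
Proof.
by move=> mk; apply/colP => i; rewrite mxE mk mulr0 addr0 oppr0; case: eqP => // ->.
Qed.

Lemma tau_fvec e t k i : i != ix k -> tau e t k (fvec i) = fvec i.
Proof. by move=> ik; apply: tau_id; rewrite fvecE eq_sym (negbTE ik). Qed.

Lemma mut_E_tau t k m : mut_E k (sB t) *m m = tau true t k m.
Proof.
apply/colP => i; rewrite mut_EX ?sB_diag // [RHS]mxE.
by case: eqP.
Qed.

Lemma lam_mut_true t k m m' :
  lam (mutate k t) m m' = lam t (tau true t k m) (tau true t k m').
Proof.
rewrite !lamE /form /= mut_LE -!mut_E_tau trmx_mul !mulmxA; congr (fun_of_matrix _ 0 0).
Qed.

(** The piece [true] is the definition of the mutated form. The piece [false] differs by a multiple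
    of [bc t k], which pairs with entries at [k] only, and the correction terms cancel. *)
Lemma lam_mut e t k m m' : lam (mutate k t) m m' = lam t (tau e t k m) (tau e t k m').
Proof.
case: e; first exact: lam_mut_true.
rewrite lam_mut_true !tau_diff !(lamDl, lamDr, lamZl, lamZr) lammm !lam_bc lam_bcr !tau_k.
by ring.
Qed.

Lemma tau_bc_k e t k : tau e t k (bc (mutate k t) k) = - bc t k.
Proof.
apply/colP => i; rewrite !mxE !eqxx orbT /= sB_diag !oppr0 mulr0 addr0.
by case: (i =P ix k) => [->|_]; rewrite ?sB_diag ?oppr0 //= mulr0 addr0.
Qed.

Lemma tau_bc e t k l : l != k -> tau e t k (bc (mutate k t) l) =
  bc t l + posp (if e then sB t (ix k) l else - sB t (ix k) l) *: bc t k.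
Proof.
move=> lk; have P : tau true t k (bc (mutate k t) l) =
    bc t l + posp (sB t (ix k) l) *: bc t k.
  apply/colP => i; rewrite !mxE !eqxx /= (negbTE lk) orbF.
  case: eqP => [->|_]; first by rewrite opprK sB_diag mulr0 addr0.
  by rewrite mulrN addrK [_ * posp _]mulrC.
case: e => //; rewrite tau_diff P bcE mxE eqxx /= -addrA -scalerDl; congr (_ + _ *: _).
by move: (pospB (sB t (ix k) l)); move: (posp (sB t (ix k) l)) (posp (- _)) => p q <-; ring.
Qed.

Lemma dk_mut t k l : dk (mutate k t) l = dk t l.
Proof.
rewrite /dk (lam_mut true); have [->|lk] := eqVneq l k.
  by rewrite tau_bc_k lamNl lam_bc tau_k fvecE eqxx mulrN1 opprK.
rewrite tau_bc // tau_fvec ?(inj_eq (@lshift_inj _ _)) // lamDl lamZl !lam_bc.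
by rewrite !fvecE eqxx !(inj_eq (@lshift_inj _ _)) [k == l]eq_sym (negbTE lk) !mulr0 addr0.
Qed.

Lemma trop_mutE t k g : trop_mut k t g = tau (g (ix k) 0 < 0) t k g.
Proof. by apply/colP => i; rewrite !mxE ltNge; case: eqP => // _; case: ltP. Qed.

Lemma trop_mut_ge t k g : 0 <= g (ix k) 0 -> trop_mut k t g = tau false t k g.
Proof. by move=> g0; rewrite trop_mutE ltNge g0. Qed.

(** On the wall both pieces are the identity, so either one covers the case of equality. *)
Lemma trop_mut_le t k g : g (ix k) 0 <= 0 -> trop_mut k t g = tau true t k g.
Proof.
move=> g0; rewrite trop_mutE; case: ltgtP g0 => // gk _.
by rewrite !tau_id ?gk.
Qed.

Lemma trop_mut_k t k g : trop_mut k t g (ix k) 0 = - g (ix k) 0.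
Proof. by rewrite trop_mutE tau_k. Qed.

Lemma trop_mutK t k g : trop_mut k (mutate k t) (trop_mut k t g) = g.
Proof.
have E e m : tau (~~ e) (mutate k t) k m = tau e t k m.
  apply/colP => i; rewrite !mxE eqxx orbT; case: eqP => // _; congr (_ + posp _ * _).
  by case: e; rewrite ?opprK.
rewrite [LHS]trop_mutE trop_mut_k oppr_lt0 trop_mutE.
case: (ltgtP (g (ix k) 0) 0) => g0.
- rewrite -[RHS](tauK true t k g); exact: (E true).
- rewrite -[RHS](tauK false t k g); exact: (E false).
by rewrite !tau_id // tau_k g0 oppr0.
Qed.

End Seeds.

(* The coefficients [Z[v, v^-1]] enter only through the following interface.
   It is kept abstract because conversion tests between products in the concrete
   ring unfold a tower of algebraic structures down to [int]. *)
Record qring := QRing {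
  qcarrier :> comNzRingType;
  vp : int -> qcarrier;
  vp0 : vp 0 = 1;
  vpD : forall x y, vp (x + y) = vp x * vp y;
  qbar : qcarrier -> qcarrier;
  qbarD : {morph qbar : a b / a + b};
  qbarM : {morph qbar : a b / a * b};
  qbar_vp : forall z, qbar (vp z) = vp (- z);
  mm : qcarrier -> Prop;
  mm0 : mm 0;
  mmD : forall a b, mm a -> mm b -> mm (a + b);
  mmN : forall a, mm a -> mm (- a);
  mmM : forall a b, mm a -> mm b -> mm (a * b);
  mm_vp : forall z, z < 0 -> mm (vp z);
  mm_bar : forall a, mm a -> qbar a = a -> a = 0
}.

Arguments vp {_} _.

(** * Scalars: powers of [v], bar involution and [mm] *)

Section QuantumScalars.
Variable K : qring.
Implicit Types a b : K.
Local Notation vp := (@vp K).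

Lemma vpN z : vp z * vp (- z) = 1.
Proof. by rewrite -vpD subrr vp0. Qed.

Lemma vpNK z a : vp (- z) * (vp z * a) = a.
Proof. by rewrite mulrA mulrC -vpD addNr vp0 mulr1. Qed.

Lemma vp_neq0 z : vp z != 0.
Proof. by apply/eqP => vz; have /eqP := vpN z; rewrite vz mul0r eq_sym oner_eq0. Qed.

Lemma vpZK (V : lmodType K) z (x : V) : vp (- z) *: (vp z *: x) = x.
Proof. by rewrite scalerA mulrC vpN scale1r. Qed.

Lemma vpM_eq0 z a : (vp z * a == 0) = (a == 0).
Proof.
apply/eqP/eqP => [E|->]; last by rewrite mulr0.
by rewrite -[a](vpNK z) E mulr0.
Qed.

Lemma qbar0 : qbar (0 : K) = 0.
Proof. by apply: (addrI (qbar 0)); rewrite -qbarD !addr0. Qed.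

Lemma qbar1 : qbar (1 : K) = 1.
Proof. by rewrite -(vp0 K) qbar_vp oppr0. Qed.

Lemma qbarN a : qbar (- a) = - qbar a.
Proof. by apply/eqP; rewrite -subr_eq0 opprK -qbarD addNr qbar0. Qed.

Lemma mm_vpM z a : z <= 0 -> mm a -> mm (vp z * a).
Proof.
rewrite le_eqVlt => /orP[/eqP ->|z0]; first by rewrite vp0 mul1r.
by move=> ma; apply: mmM => //; apply: mm_vp.
Qed.

Lemma mm_sum (I : eqType) (r : seq I) (f : I -> K) :
  (forall i, i \in r -> mm (f i)) -> mm (\sum_(i <- r) f i).
Proof.
move=> H; rewrite big_seq; elim/big_rec: _ => [|i x ir mx]; first exact: mm0.
by apply: mmD => //; apply: H.
Qed.

End QuantumScalars.

(** One free module [tor] serves all seeds; a seed enters only through the product that [em]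
    induces. Elements can thus be compared and moved between seeds by [push] along maps of
    exponents. *)
Record qfield (K : qring) (nu nf : nat) := QField {
  tor : freemod K 'cV[int]_(nu + nf);
  qF :> seed nu nf -> unitAlgType K;
  em : forall t, tor -> qF t;
  em_linear : forall t, linear (em t);
  em_inj : forall t, injective (em t);
  em1 : forall t, em t (mono tor 0) = 1;
  emXX : forall t m m', em t (mono tor m) * em t (mono tor m') =
    vp (lam t m m') *: em t (mono tor (m + m'));
  qF_unit : forall t (z : qF t), z != 0 -> z \is a GRing.unit;
  qF_frac : forall t (z : qF t), exists a b, b != 0 /\ z = em t a / em t b;
  qmu : forall k t, {lrmorphism qF (mutate k t) -> qF t};
  qmu_inv : forall k t, qF t -> qF (mutate k t);
  qmu_funK : forall k t, cancel (qmu k t) (@qmu_inv k t);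
  qmu_invK : forall k t, cancel (@qmu_inv k t) (qmu k t);
  qmu_neq : forall k t i, i != lshift nf k ->
    qmu k t (em (mutate k t) (mono tor (fvec i))) = em t (mono tor (fvec i));
  qmu_eq : forall k t (a := tau true t k (fvec (lshift nf k))),
    qmu k t (em (mutate k t) (mono tor (fvec (lshift nf k)))) =
    em t (mono tor a + mono tor (a + bc t k))
}.

Arguments em {_ _ _} _ _ _.
Arguments em_linear {_ _ _} _ _.
Arguments qmu {_ _ _} _ _ _.

(** * Twisted products, bar involution and mutation isomorphisms *)

Section TorusAlgebra.
Variables (K : qring) (nu nf : nat) (Q : qfield K nu nf).
Local Notation lattice := 'cV[int]_(nu + nf).
Local Notation tor := (tor Q).
Local Notation mono := (mono tor).
Local Notation vp := (@vp K).
Implicit Types (t u w : seed nu nf) (k l : 'I_nu) (m g h : lattice) (a b c y z : tor).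

Definition lmul t a b : tor :=
  lin (fun g => lin (fun h => vp (lam t g h) *: mono (g + h)) b) a.

Lemma lmul_linl t (f : lattice -> tor) y b : lmul t (lin f y) b = lin (fun g => lmul t (f g) b) y.
Proof. by apply: lin_comp; apply: linP. Qed.

Lemma lmulX t m m' : lmul t (mono m) (mono m') = vp (lam t m m') *: mono (m + m').
Proof. by rewrite /lmul !lin1. Qed.

Lemma lmulDl t a b c : lmul t (a + b) c = lmul t a c + lmul t b c.
Proof. by rewrite /lmul linD. Qed.

Lemma lmulZl t x a b : lmul t (x *: a) b = x *: lmul t a b.
Proof. by rewrite /lmul linZ. Qed.

Lemma lmulDr t a b c : lmul t c (a + b) = lmul t c a + lmul t c b.
Proof.
rewrite /lmul -lin_add_fun; apply: eq_lin => g _.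
by rewrite linD.
Qed.

Lemma lmulZr t x a b : lmul t a (x *: b) = x *: lmul t a b.
Proof.
rewrite /lmul -lin_scale_fun; apply: eq_lin => g _.
by rewrite linZ.
Qed.

Lemma lmul_linr t (f : lattice -> tor) y a : lmul t a (lin f y) = lin (fun g => lmul t a (f g)) y.
Proof. by apply: lin_comp => x u v; rewrite lmulDr lmulZr. Qed.

Lemma lmul0l t a : lmul t 0 a = 0.
Proof. by rewrite /lmul lin0. Qed.

Lemma lmul0r t a : lmul t a 0 = 0.
Proof. by rewrite -(scale0r 0) lmulZr !scale0r. Qed.

Lemma lmulNl t a b : lmul t (- a) b = - lmul t a b.
Proof. by rewrite -scaleN1r lmulZl scaleN1r. Qed.

Lemma lmulBl t a b c : lmul t (a - b) c = lmul t a c - lmul t b c.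
Proof. by rewrite lmulDl lmulNl. Qed.

Lemma cf_XmM t m z h :
  cf (lmul t (mono m) z) h = vp (lam t m (h - m)) * cf z (h - m).
Proof.
elim/fm_ind: z => [|x m' z IH]; first by rewrite lmul0r !cf0 mulr0.
rewrite lmulDr lmulZr lmulX !cfD IH !cfZ !cfX mulrDr.
congr (_ + _); have -> : (m + m' == h) = (m' == h - m).
  by rewrite [RHS]eq_sym subr_eq [RHS]eq_sym [m' + m]addrC.
case: (m' =P h - m) => [<-|_]; last by rewrite !mulr0.
exact: mulrCA.
Qed.

Lemma cf_MXm t m z h :
  cf (lmul t z (mono m)) h = vp (lam t (h - m) m) * cf z (h - m).
Proof.
elim/fm_ind: z => [|x m' z IH]; first by rewrite lmul0l !cf0 mulr0.
rewrite lmulDl lmulZl lmulX !cfD IH !cfZ !cfX mulrDr.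
congr (_ + _); have -> : (m' + m == h) = (m' == h - m).
  by rewrite [RHS]eq_sym subr_eq [RHS]eq_sym.
case: (m' =P h - m) => [<-|_]; last by rewrite !mulr0.
exact: mulrCA.
Qed.

Lemma cf_mul t a b h :
  cf (lmul t a b) h = \sum_(g <- supp a) cf a g * (vp (lam t g (h - g)) * cf b (h - g)).
Proof.
rewrite -[in LHS](linX a) lmul_linl cf_lin.
by under eq_bigr do rewrite cf_XmM.
Qed.

Lemma supp_mul t a b h : h \in supp (lmul t a b) ->
  exists g1 g2, [/\ g1 \in supp a, g2 \in supp b & h = g1 + g2].
Proof.
rewrite suppE cf_mul => nz.
have [[g ga gb]|no] := pselect (exists2 g, g \in supp a & h - g \in supp b).
  by exists g, (h - g); split=> //; rewrite addrCA subrr addr0.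
case/eqP: nz; rewrite big_seq big1 // => g ga.
have [gb|/cf_out ->] := boolP (h - g \in supp b); last by rewrite !mulr0.
by case: no; exists g.
Qed.

Lemma monoD t m m' : mono (m + m') = vp (- lam t m m') *: lmul t (mono m) (mono m').
Proof. by rewrite lmulX vpZK. Qed.

Definition lpow t a n : tor := iter n (lmul t a) (mono 0).

Lemma emD t a b : em Q t (a + b) = em Q t a + em Q t b.
Proof. by have := em_linear Q t 1 a b; rewrite !scale1r. Qed.

Lemma em0 t : em Q t 0 = 0.
Proof. by apply: (addrI (em Q t 0)); rewrite -emD !addr0. Qed.

Lemma emZ t x a : em Q t (x *: a) = x *: em Q t a.
Proof. by have := em_linear Q t x a 0; rewrite em0 !addr0. Qed.

Lemma emB t a b : em Q t (a - b) = em Q t a - em Q t b.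
Proof. by rewrite -[- b]scaleN1r emD emZ scaleN1r. Qed.

Lemma em_lin t (f : lattice -> tor) y : em Q t (lin f y) = lin (fun g => em Q t (f g)) y.
Proof. by apply: lin_comp; apply: em_linear. Qed.

Lemma emM t a b : em Q t (lmul t a b) = em Q t a * em Q t b.
Proof.
elim/fm_ind: a => [|x m a IH]; first by rewrite lmul0l em0 mul0r.
rewrite lmulDl lmulZl !emD !emZ IH mulrDl -scalerAl; congr (_ *: _ + _).
elim/fm_ind: b {IH} => [|y m' b IH]; first by rewrite lmul0r em0 mulr0.
by rewrite lmulDr lmulZr !emD !emZ IH mulrDr -scalerAr lmulX emZ emXX.
Qed.

Lemma em_mono0 t : em Q t (mono 0) = 1.
Proof. exact: em1. Qed.

Lemma lmulA t : associative (@lmul t).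
Proof. by move=> a b c; apply: (em_inj (t := t)); rewrite !emM mulrA. Qed.

Lemma lmul1l t a : lmul t (mono 0) a = a.
Proof. by apply: (em_inj (t := t)); rewrite emM em_mono0 mul1r. Qed.

Lemma lmul1r t a : lmul t a (mono 0) = a.
Proof. by apply: (em_inj (t := t)); rewrite emM em_mono0 mulr1. Qed.

Lemma lpowS t a n : lpow t a n.+1 = lmul t a (lpow t a n).
Proof. by []. Qed.

Lemma lpow1 t a : lpow t a 1 = a.
Proof. by rewrite lpowS lmul1r. Qed.

Lemma lpowD t a n n' : lpow t a (n + n') = lmul t (lpow t a n) (lpow t a n').
Proof. by elim: n => [|n IH]; rewrite ?lmul1l // addSn !lpowS IH lmulA. Qed.

Lemma lpowSr t a n : lpow t a n.+1 = lmul t (lpow t a n) a.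
Proof. by rewrite -[n.+1]addn1 lpowD lpow1. Qed.

Lemma lpow_mono t m n : lpow t (mono m) n = mono (m *+ n).
Proof.
elim: n => [//|n IH]; rewrite lpowS IH lmulX mulrS.
by rewrite pmulrn -scaler_int lamZr lammm mulr0 vp0 scale1r.
Qed.

Lemma emX t a n : em Q t (lpow t a n) = em Q t a ^+ n.
Proof. by elim: n => [|n IH]; rewrite ?em_mono0 // lpowS emM IH exprS. Qed.

Lemma em_eq0 t a : (em Q t a == 0) = (a == 0).
Proof. by rewrite -(em0 t) (inj_eq (@em_inj _ _ _ Q t)). Qed.

Lemma F_mul_eq0 t (x y : Q t) : x * y = 0 -> x = 0 \/ y = 0.
Proof.
move=> xy; have [->|x0] := eqVneq x 0; first by left.
by right; rewrite -(mulKr (qF_unit x0) y) xy mulr0.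
Qed.

Lemma lmul_eq0 t a b : lmul t a b = 0 -> a = 0 \/ b = 0.
Proof.
move/(congr1 (em Q t)); rewrite emM em0 => /F_mul_eq0[] /eqP; rewrite em_eq0 => /eqP.
  by left.
by right.
Qed.

Lemma lmul_neq0 t a b : a != 0 -> b != 0 -> lmul t a b != 0.
Proof. by move=> /eqP a0 /eqP b0; apply/eqP => /lmul_eq0[]. Qed.

Lemma lpow_neq0 t a n : a != 0 -> lpow t a n != 0.
Proof. by move=> a0; elim: n => [|n IH]; rewrite ?mono_neq0 // lpowS lmul_neq0. Qed.

(** The interface of scalars does not contain integrality; it is inherited from the skew-field, at
    any seed. *)
Lemma K_mul_neq0 t (x y : K) : x != 0 -> y != 0 -> x * y != 0.
Proof.
have P (e : K) : e != 0 -> e *: mono 0 != 0.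
  move=> e0; apply/eqP => /(congr1 (fun z => cf z 0)); rewrite cfZ cfX cf0 eqxx mulr1.
  by move/eqP; rewrite (negbTE e0).
move=> /P a0 /P b0; have := lmul_neq0 t a0 b0.
rewrite lmulZl lmulZr scalerA; apply: contraNneq => ->.
by rewrite scale0r.
Qed.

Definition barT z : tor := \sum_(m <- supp z) qbar (cf z m) *: mono m.

Lemma barT_coef z m : cf (barT z) m = qbar (cf z m).
Proof.
rewrite /barT cf_sum; under eq_bigr do rewrite cfZ cfX.
have [mz|Nm] := boolP (m \in supp z); last first.
  rewrite (cf_out Nm) qbar0 big_seq big1 // => h hz.
  case: eqP => [E|]; last by rewrite mulr0.
  by move: Nm; rewrite -E hz.
rewrite (big_fsetD1 m) //= eqxx mulr1 big_seq big1 ?addr0 // => h.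
by rewrite in_fsetD1 => /andP[/negbTE -> _]; rewrite mulr0.
Qed.

Lemma barTP z : barT z = z <-> forall m, qbar (cf z m) = cf z m.
Proof.
split=> [bz m|bz]; first by rewrite -barT_coef bz.
by apply: cf_ext => m; rewrite barT_coef.
Qed.

Lemma barTD a b : barT (a + b) = barT a + barT b.
Proof. by apply: cf_ext => m; rewrite barT_coef !cfD !barT_coef qbarD. Qed.

Lemma barT0 : barT 0 = 0.
Proof. by apply: cf_ext => m; rewrite barT_coef !cf0 qbar0. Qed.

Lemma barTZ x z : barT (x *: z) = qbar x *: barT z.
Proof. by apply: cf_ext => m; rewrite barT_coef !cfZ barT_coef qbarM. Qed.

Lemma barT_mono m : barT (mono m) = mono m.
Proof.
by apply/barTP => h; rewrite cfX; case: eqP => _; rewrite ?qbar0 ?qbar1.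
Qed.

Lemma barTM t a b : barT (lmul t a b) = lmul t (barT b) (barT a).
Proof.
elim/fm_ind: a => [|x m a IH]; first by rewrite lmul0l barT0 lmul0r.
rewrite lmulDl !barTD lmulDr IH barTZ barT_mono lmulZl barTZ lmulZr; congr (_ *: _ + _).
apply: cf_ext => h; rewrite barT_coef cf_XmM cf_MXm qbarM barT_coef qbar_vp.
by rewrite lamC opprK.
Qed.

Lemma barT_lpow t a n : barT a = a -> barT (lpow t a n) = lpow t a n.
Proof.
move=> ba; elim: n => [|n IH]; first exact: barT_mono.
by rewrite lpowS barTM IH ba -lpowSr.
Qed.

Lemma barT_lin (f : lattice -> tor) (y : tor) :
  (forall g, barT (f g) = f g) -> (forall g, qbar (cf y g) = cf y g) -> barT (lin f y) = lin f y.
Proof.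
move=> bf by'; rewrite /lin (big_morph _ barTD barT0); apply: eq_bigr => g _.
by rewrite barTZ bf by'.
Qed.

Fixpoint qmus t u (p : mpath t u) : Q u -> Q t :=
  match p in mpath t u return Q u -> Q t with
  | mnil _ => id
  | mcons t k _ p' => fun x => qmu Q k t (qmus p' x)
  end.

Fixpoint qmus_inv t u (p : mpath t u) : Q t -> Q u :=
  match p in mpath t u return Q t -> Q u with
  | mnil _ => id
  | mcons t k _ p' => fun x => qmus_inv p' (qmu_inv k x)
  end.

Lemma qmu_inj k t : injective (qmu Q k t).
Proof. exact: can_inj (@qmu_funK _ _ _ Q k t). Qed.

Lemma qmus_lr t u (p : mpath t u) :
  exists f : {lrmorphism Q u -> Q t}, forall x, qmus p x = f x.
Proof.
elim: p => [w|w k v p [f fE]]; first by exists idfun.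
by exists (qmu Q k w \o f) => x /=; rewrite fE.
Qed.

Lemma qmusM t u (p : mpath t u) x x' : qmus p (x * x') = qmus p x * qmus p x'.
Proof. by have [f fE] := qmus_lr p; rewrite !fE rmorphM. Qed.

Lemma qmusD t u (p : mpath t u) x x' : qmus p (x + x') = qmus p x + qmus p x'.
Proof. by have [f fE] := qmus_lr p; rewrite !fE rmorphD. Qed.

Lemma qmusZ t u (p : mpath t u) e x : qmus p (e *: x) = e *: qmus p x.
Proof. by have [f fE] := qmus_lr p; rewrite !fE linearZ. Qed.

Lemma qmus0 t u (p : mpath t u) : qmus p 0 = 0.
Proof. by have [f fE] := qmus_lr p; rewrite !fE rmorph0. Qed.

Lemma qmus1 t u (p : mpath t u) : qmus p 1 = 1.
Proof. by have [f fE] := qmus_lr p; rewrite !fE rmorph1. Qed.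

Lemma qmus_invK t u (p : mpath t u) x : qmus p (qmus_inv p x) = x.
Proof. by elim: p x => [//|w k v p IH] x /=; rewrite IH qmu_invK. Qed.

Lemma qmusK t u (p : mpath t u) x : qmus_inv p (qmus p x) = x.
Proof. by elim: p x => [//|w k v p IH] x /=; rewrite qmu_funK IH. Qed.

Lemma qmus_inj t u (p : mpath t u) : injective (qmus p).
Proof. exact: can_inj (qmusK p). Qed.

Lemma qmus_neq0 t u (p : mpath t u) x : x != 0 -> qmus p x != 0.
Proof. by move=> z0; rewrite -(qmus0 p) (inj_eq (@qmus_inj _ _ p)). Qed.

Lemma qmus_cat t u w (p : mpath t u) (q : mpath u w) x :
  qmus (mcat p q) x = qmus p (qmus q x).
Proof. by elim: p q x => [v|v k v' p IH] q x //=; rewrite IH. Qed.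

End TorusAlgebra.

(** * Mutation sequences *)

Section Paths.
Variables nu nf : nat.
Implicit Types (t u w : seed nu nf) (k : 'I_nu).

Lemma trop_cat t u w (p : mpath t u) (q : mpath u w) g :
  trop (mcat p q) g = trop q (trop p g).
Proof. by elim: p q g => [v|v k v' p IH] q g //=; rewrite IH. Qed.

Definition mstep k t : mpath t (mutate k t) := mcons (mnil (mutate k t)).

Lemma mcat_nil t u (p : mpath t u) : mcat p (mnil u) = p.
Proof. by elim: p => [//|w k v p IH] /=; rewrite IH. Qed.

(** Paths are built from their first mutation, whereas leads are followed from a fixed initial seed
    while the last mutation is added. *)
Lemma mpath_snoc_ind t (P : forall u, mpath t u -> Prop) :
  P t (mnil t) ->
  (forall u (q : mpath t u) k, P u q -> P (mutate k u) (mcat q (mstep k u))) ->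
  forall u (p : mpath t u), P u p.
Proof.
move=> P0 PS; suff H u (q : mpath t u) : P u q -> forall w (p : mpath u w), P w (mcat q p).
  by move=> u p; exact: (H t (mnil t) P0).
move=> Pq w p; elim: p q Pq => [v|v k v' p IH] q Pq; first by rewrite mcat_nil.
have := IH _ (PS _ _ k Pq).
suff -> : mcat (mcat q (mstep k v)) p = mcat q (mcons p) by [].
elim: q {Pq} p {IH} => [v''|v'' l w'' q IH] p //=.
by rewrite IH.
Qed.

Lemma trop_mut_bij k t : bijective (@trop_mut nu nf k t).
Proof.
exists (trop_mut k (mutate k t)) => g; first exact: trop_mutK.
by have := trop_mutK (mutate k t) k g; rewrite mutateK.
Qed.

Lemma trop_bij t u (p : mpath t u) : bijective (trop p).
Proof.
elim: p => [v|v k v' p IH] /=; first by exists id.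
exact: (bij_comp IH (trop_mut_bij k v)).
Qed.

End Paths.

Section Entries.
Variable n : nat.
Implicit Types m : 'cV[int]_n.

Lemma vD m m' i : (m + m') i 0 = m i 0 + m' i 0.
Proof. exact: mxE. Qed.

Lemma vN m i : (- m) i 0 = - m i 0.
Proof. exact: mxE. Qed.

Lemma vZ (c : int) m i : (c *: m) i 0 = c * m i 0.
Proof. exact: mxE. Qed.

Lemma v0 i : (0 : 'cV[int]_n) i 0 = 0.
Proof. exact: mxE. Qed.

Definition vE := (vD, vN, vZ, v0).

Lemma fset_bound (T : choiceType) (s : {fset T}) (f : T -> int) :
  exists R : nat, forall x, x \in s -> - R%:Z <= f x <= R%:Z.
Proof.
suff [R RP] : exists R : nat, forall x, x \in enum_fset s -> - R%:Z <= f x <= R%:Z by exists R.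
elim: (enum_fset s) => [|y r [R RP]]; first by exists 0%N.
exists (R + `|f y|)%N => x; rewrite inE => /orP[/eqP ->|/RP]; lia.
Qed.

End Entries.

Ltac lat := by apply/colP => ?; rewrite ?vE; ring.

(** * Elements that are Laurent at two adjacent seeds *)

Section RankOne.
Variables (K : qring) (nu nf : nat) (Q : qfield K nu nf).
Local Notation lattice := 'cV[int]_(nu + nf).
Local Notation ix := (lshift nf).
Local Notation tor := (tor Q).
Local Notation mono := (mono tor).
Local Notation vp := (@vp K).
Implicit Types (t u w : seed nu nf) (k l : 'I_nu) (m g h e : lattice) (a b c y z : tor).

(** Restricting the generators to nonzero entries of [m] allows the induction to stay among
    exponents with vanishing entries at given vertices. *)
Lemma lat_ind (P : lattice -> Prop) m :
  P 0 -> (forall m1 m2, P m1 -> P m2 -> P (m1 + m2)) -> (forall m1, P m1 -> P (- m1)) ->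
  (forall i, m i 0 != 0 -> P (fvec i)) -> P m.
Proof.
move=> P0 PD PN Pf; have -> : m = \sum_i m i 0 *: fvec i.
  apply/colP => i; rewrite summxE (bigD1 i) //= big1 => [|j ji].
    by rewrite mxE fvecE eqxx mulr1 addr0.
  by rewrite mxE fvecE eq_sym (negbTE ji) mulr0.
apply: (big_ind P) => // i _.
have [->|mi] := eqVneq (m i 0) 0; first by rewrite scale0r.
have Pn n : P (n%:Z *: fvec i).
  elim: n => [|n IH]; first by rewrite scale0r.
  by rewrite intS scalerDl scale1r; apply: PD => //; apply: Pf.
case: (m i 0) => n //; rewrite NegzE scaleNr; exact/PN/Pn.
Qed.

Lemma mulrz_lat m (r : nat) : m *+ r = r%:Z *: m.
Proof. by rewrite -[r%:Z]intz scaler_int. Qed.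

Definition part (P : pred lattice) z : tor :=
  lin (fun m => if P m then mono m else 0) z.

Lemma cf_part (P : pred lattice) z m : cf (part P z) m = if P m then cf z m else 0.
Proof.
rewrite cf_lin; under eq_bigr do rewrite (fun_if (fun y => cf y m)) cfX cf0.
have [mz|Nm] := boolP (m \in supp z); last first.
  rewrite (cf_out Nm) if_same big_seq big1 // => g gz.
  case: ifP => _; last by rewrite mulr0.
  by case: eqP => [E|]; rewrite ?mulr0 //; move: Nm; rewrite -E gz.
rewrite (big_fsetD1 m) //= eqxx big_seq big1 ?addr0 => [|g].
  by case: ifP; rewrite ?mulr1 ?mulr0.
by rewrite in_fsetD1 => /andP[/negbTE -> _]; rewrite if_same mulr0.
Qed.

Lemma supp_part (P : pred lattice) z m : (m \in supp (part P z)) = P m && (m \in supp z).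
Proof. by rewrite !suppE cf_part; case: (P m); rewrite ?eqxx. Qed.

Lemma part_split (P : pred lattice) z : z = part P z + part (predC P) z.
Proof. by apply: cf_ext => m; rewrite cfD !cf_part /=; case: (P m); rewrite ?addr0 ?add0r. Qed.

Lemma part_id (P : pred lattice) z : (forall m, m \in supp z -> P m) -> part P z = z.
Proof.
move=> Pz; apply: cf_ext => m; rewrite cf_part; case: ifP => // PF.
by rewrite cf_out //; apply/negP => /Pz; rewrite PF.
Qed.

(** For the grading defined by [f], right multiplication by a homogeneous element commutes with
    taking components. *)
Lemma part_mul t (f : lattice -> int) s d a b :
  (forall m m', f (m + m') = f m + f m') -> (forall h, h \in supp b -> f h = s) ->
  part [pred h | f h == d + s] (lmul t a b) = lmul t (part [pred m | f m == d] a) b.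
Proof.
move=> fD fb; apply: cf_ext => h; rewrite cf_part /=.
case: eqP => [fh|fh]; last first.
  rewrite cf_out //; apply/negP => /supp_mul[g1 [g2 [+ /fb g2b E]]].
  rewrite supp_part /= => /andP[/eqP g1d _]; case: fh.
  by rewrite E fD g1d g2b.
rewrite {1}(part_split [pred m | f m == d] a) lmulDl cfD [X in _ + X]cf_out ?addr0 //.
apply/negP => /supp_mul[g1 [g2 [+ /fb g2b E]]].
rewrite supp_part /= => /andP[/eqP g1d _]; case: g1d.
by apply: (addIr s); rewrite -fh E fD g2b.
Qed.

Definition xa t k : lattice := tau true t k (fvec (ix k)).
Definition xp t k : tor := mono (xa t k) + mono (xa t k + bc t k).

Lemma xa_k t k : xa t k (ix k) 0 = - 1.
Proof. by rewrite tau_k fvecE eqxx. Qed.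

Lemma tau_xa t k : tau true t k (xa t k) = fvec (ix k).
Proof. exact: tauK. Qed.

Lemma bc_neq0 t k : bc t k != 0.
Proof. by apply/eqP => B0; have := dk_gt0 t k; rewrite /dk B0 lam0l. Qed.

Lemma bc_mulz_inj t k (i j : int) : i *: bc t k = j *: bc t k -> i = j.
Proof.
move=> /(congr1 (fun m => lam t m (fvec (ix k)))); rewrite !lamZl -/(dk t k).
exact/mulIf/dk_neq0.
Qed.

Definition strand t k e (r : nat) m := exists2 i : nat, (i <= r)%N & m = e + i%:Z *: bc t k.

(** A segment in direction [bc t k] with both end coefficients equal to 1; the mutation at [k]
    reverses this direction, so both ends are needed. *)
Definition strandP t k e r z :=
  [/\ forall m, m \in supp z -> strand t k e r m, cf z e = 1 & cf z (e + r%:Z *: bc t k) = 1].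

Lemma strand_mono t k e : strandP t k e 0 (mono e).
Proof.
rewrite /strandP scale0r addr0 !cfX eqxx; split=> // m.
by rewrite supp_mono => /eqP ->; exists 0%N => //; rewrite scale0r addr0.
Qed.

(** The two conditions on [e] are what makes the powers of [v] at both ends of the longer strand
    trivial. *)
Lemma strand_xp t k e r z :
  lam t (xa t k) e = 0 -> e (ix k) 0 = - r%:Z ->
  strandP t k e r z -> strandP t k (xa t k + e) r.+1 (lmul t (xp t k) z).
Proof.
set a := xa t k; set B := bc t k => lae ek [zs z0 z1].
have NS i : (i < 0) || (r%:Z < i) -> cf z (e + i *: B) = 0.
  move=> ir; apply: cf_out; apply/negP => /zs[j jr /addrI/bc_mulz_inj ij].
  by move: ir; rewrite ij; lia.
have CF h : cf (lmul t (xp t k) z) h =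
    vp (lam t a (h - a)) * cf z (h - a) + vp (lam t (a + B) (h - (a + B))) * cf z (h - (a + B)).
  by rewrite lmulDl cfD !cf_XmM.
split.
- move=> m /supp_mul[g1 [g2 [/suppD[] + /zs[i ir ->] ->]]].
    rewrite supp_mono => /eqP ->; exists i; first exact: leqW.
    by rewrite addrA.
  rewrite supp_mono => /eqP ->; exists i.+1 => //.
  by rewrite intS scalerDl scale1r !addrA; congr (_ + _); rewrite -!addrA; congr (_ + _); rewrite addrC.
- rewrite CF addrAC subrr add0r lae vp0 mul1r z0.
  have -> : a + e - (a + B) = e + (- 1) *: B.
    by rewrite scaleN1r opprD addrACA subrr add0r.
  by rewrite NS // mulr0 addr0.
have E1 : a + e + r.+1%:Z *: B - a = e + r.+1%:Z *: B by lat.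
have E2 : a + e + r.+1%:Z *: B - (a + B) = e + r%:Z *: B.
  by rewrite intS; lat.
rewrite CF E1 E2 z1 NS ?mulr0 ?add0r; last by lia.
rewrite mulr1 -(vp0 K); congr vp.
rewrite !(lamDl, lamDr, lamZr) lae lammm lam_bcr lam_bc xa_k ek.
by ring.
Qed.

(* For varying [e], a basis of the intersection of [LP t] with the image of
   [LP (mutate k t)] under the mutation isomorphism, compatible with
   [trop_mut k t] (see [qmu_Kel] and [span_Kel]); [xp t k] is the image of the
   mutated variable. *)
Definition Kel t k e : tor :=
  if 0 <= e (ix k) 0 then mono e else
  let r := `|(e (ix k) 0)%R|%N in let a := xa t k *+ r in
  vp (- lam t a (e - a)) *: lmul t (lpow t (xp t k) r) (mono (e - a)).

Definition krank k e : nat := if (0 <= e (ix k) 0)%R then 0%N else `|(e (ix k) 0)%R|%N.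

Lemma Kel_ge0 t k e : 0 <= e (ix k) 0 -> Kel t k e = mono e.
Proof. by rewrite /Kel => ->. Qed.

Lemma Kel_le0 t k e (r : nat) : e (ix k) 0 = - r%:Z ->
  Kel t k e = vp (- lam t (xa t k *+ r) (e - xa t k *+ r)) *:
    lmul t (lpow t (xp t k) r) (mono (e - xa t k *+ r)).
Proof.
move=> er; rewrite /Kel er; case: lerP => [r0|_]; last by rewrite abszN.
have -> : r = 0%N by lia.
by rewrite mulr0n subr0 lam0l oppr0 vp0 scale1r lmul1l.
Qed.

Lemma lpow_xp_strand t k r : strandP t k (xa t k *+ r) r (lpow t (xp t k) r).
Proof.
elim: r => [|r IH]; first exact: strand_mono.
rewrite mulrS lpowS; apply: strand_xp => //.
  by rewrite mulrz_lat lamZr lammm mulr0.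
by rewrite mulrz_lat mxE xa_k mulrN1.
Qed.

Lemma Kel_strand t k e : strandP t k e (krank k e) (Kel t k e).
Proof.
rewrite /krank /Kel; case: lerP => e0; first exact: strand_mono.
set r := `|_|%N; set a := xa t k *+ r; have [ps p0 p1] := lpow_xp_strand t k r.
have ek : (e - a) (ix k) 0 = 0.
  by rewrite /a mulrz_lat !vE xa_k /r; lia.
have L i : lam t (a + i *: bc t k) (e - a) = lam t a (e - a).
  by rewrite lamDl lamZl lam_bc ek !mulr0 addr0.
have E i : e + i *: bc t k - (e - a) = a + i *: bc t k.
  by rewrite opprB addrC addrA subrK.
split.
- move=> m /suppZ/supp_mul[g1 [g2 [/ps[i ir ->] + ->]]].
  rewrite supp_mono => /eqP ->; exists i => //.
  by rewrite -/a; lat.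
- rewrite cfZ cf_MXm; have := E 0; rewrite scale0r !addr0 => ->.
  by rewrite p0 mulr1 -vpD addNr vp0.
by rewrite cfZ cf_MXm E L p1 mulr1 -vpD addNr vp0.
Qed.

(** The monomial factor has entry 0 at [k], hence commutes with the whole strand up to one power of
    [v], which the normalization splits evenly. *)
Lemma barT_Kel t k e : barT (Kel t k e) = Kel t k e.
Proof.
rewrite /Kel; case: lerP => e0; first exact: barT_mono.
set r := `|_|%N; set a := xa t k *+ r; set z := lpow _ _ _.
have [ps _ _] := lpow_xp_strand t k r.
have ek : (e - a) (ix k) 0 = 0.
  by rewrite /a mulrz_lat !vE xa_k /r; lia.
have bz : barT z = z by apply: barT_lpow; rewrite barTD !barT_mono.
rewrite barTZ barTM bz barT_mono qbar_vp opprK.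
apply: cf_ext => h; rewrite !cfZ cf_MXm cf_XmM.
have [/ps[i _ ->]|Nh] := boolP (h - (e - a) \in supp z); last by rewrite cf_out // !mulr0.
rewrite !mulrA -!vpD; congr (vp _ * _).
by rewrite -/a [lam t (e - a) _]lamC lamDl lamZl lam_bc ek; ring.
Qed.

Lemma qmu_mono0 t k m : m (ix k) 0 = 0 -> qmu Q k t (em Q _ (mono m)) = em Q t (mono m).
Proof.
pose P m := qmu Q k t (em Q _ (mono m)) = em Q t (mono (tau true t k m)).
move=> mk; suff : P m by rewrite /P tau_id.
have PD m1 m2 : P m1 -> P m2 -> P (m1 + m2).
  rewrite /P => P1 P2; rewrite (monoD _ (mutate k t)) tauD (monoD _ t) !emZ !emM.
  by rewrite linearZ rmorphM /= P1 P2 (lam_mut true).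
have P0 : P 0 by rewrite /P tau0 !em1 rmorph1.
apply: lat_ind => // [m1 P1|i mi].
  have := PD; move=> _; rewrite /P tauN.
  have N0 : em Q t (mono (tau true t k m1)) != 0 by rewrite em_eq0 mono_neq0.
  apply: (mulrI (qF_unit N0)); rewrite -{1}P1 -rmorphM -!emM !lmulX !emZ !subrr lamNr lammm.
  by rewrite oppr0 vp0 !lamNr lammm oppr0 vp0 !scale1r !em1 rmorph1.
have ik : i != ix k by apply: contraNneq mi => ->; rewrite mk.
by rewrite /P tau_fvec // qmu_neq.
Qed.

Lemma qmu_mono t k m : 0 <= m (ix k) 0 ->
  em Q t (Kel t k (tau true t k m)) = qmu Q k t (em Q _ (mono m)).
Proof.
move=> m0; pose r := `|(m (ix k) 0)%R|%N; have mr : m (ix k) 0 = r%:Z by rewrite /r; lia.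
rewrite (@Kel_le0 _ _ _ r) ?tau_k ?mr //; set a := xa t k.
pose f := fvec (ix k) *+ r : lattice.
have Ea : a *+ r = tau true t k f.
  by rewrite /f !mulrz_lat tauZ.
have Em : tau true t k m - a *+ r = tau true t k (m - f) by rewrite Ea tauB.
have mf0 : (m - f) (ix k) 0 = 0.
  by rewrite /f mulrz_lat !mxE mr !eqxx /= mulr1 subrr.
rewrite Em Ea -lam_mut -[in RHS](subrK f m) [_ + f in RHS]addrC.
rewrite (monoD _ (mutate k t)) tau_id // !emZ !emM emX linearZ rmorphM /= (qmu_mono0 _ mf0).
by rewrite /f -(lpow_mono _ (mutate k t)) emX rmorphXn /= qmu_eq.
Qed.

Lemma tau_mutate (b : bool) t k m : tau (~~ b) (mutate k t) k m = tau b t k m.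
Proof.
apply/colP => i; rewrite !mxE eqxx orbT; case: eqP => // _; congr (_ + posp _ * _).
by case: b; rewrite ?opprK.
Qed.

Lemma bc_mutate t k : bc (mutate k t) k = - bc t k.
Proof. by rewrite -(tau_bc_k true) tau_id // bcE sB_diag. Qed.

Lemma xa_mutate t k : xa (mutate k t) k = xa t k + bc t k.
Proof. by rewrite /xa (tau_mutate false) tau_diff fvecE eqxx scale1r. Qed.

(** Multiplied by the invertible element [xp t k], both sides become sums of two monomials with
    entry 0 at [k], which the mutation fixes. *)
Lemma qmu_xp t k : qmu Q k t (em Q _ (xp (mutate k t) k)) = em Q t (mono (fvec (ix k))).
Proof.
set f : lattice := fvec (ix k); set t' := mutate k t.
have x0 : em Q t (xp t k) != 0.
  rewrite em_eq0; have [_ + _] := lpow_xp_strand t k 1; rewrite lpow1 => c1.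
  by apply/eqP => x0; move: c1; rewrite x0 cf0 => /eqP; rewrite eq_sym oner_eq0.
apply: (mulrI (qF_unit x0)); rewrite -{1}qmu_eq -rmorphM -!emM.
rewrite {1}/xp -/f xa_mutate bc_mutate addrK lmulDr !lmulX emD !emZ raddfD /= !linearZ /=.
have fk : f (ix k) 0 = 1 by rewrite fvecE eqxx.
have tf : tau false t k f = xa t k + bc t k by rewrite tau_diff fk scale1r.
have fa : (f + xa t k) (ix k) 0 = 0 by rewrite mxE fk xa_k subrr.
have faB : (f + (xa t k + bc t k)) (ix k) 0 = 0 by rewrite addrA mxE fa bc_diag.
rewrite !qmu_mono0 // lmulDl !lmulX emD !emZ [RHS]addrC; congr (_ *: _ + _ *: _).
- by congr vp; rewrite (lam_mut false) tf -tf tauK.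
- by rewrite addrC.
- by congr vp; rewrite (lam_mut true) tau_xa.
by rewrite addrC.
Qed.

(** On one side of the wall a power of the mutated variable at [t] is a monomial at [mutate k t]; on
    the other side the roles of the two seeds are exchanged. *)
Lemma qmu_Kel t k e :
  qmu Q k t (em Q _ (Kel (mutate k t) k (trop_mut k t e))) = em Q t (Kel t k e).
Proof.
case: (lerP (e (ix k) 0) 0) => [e0|/ltW e0].
  have m0 : 0 <= tau true t k e (ix k) 0 by rewrite tau_k oppr_ge0.
  by rewrite trop_mut_le // Kel_ge0 // -qmu_mono // tauK.
pose r := `|(e (ix k) 0)%R|%N; have er : e (ix k) 0 = r%:Z by rewrite /r; lia.
rewrite trop_mut_ge // (Kel_ge0 _ e0) (@Kel_le0 _ _ _ r) ?tau_k ?er //.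
set f : lattice := fvec (ix k); have fk : f (ix k) 0 = 1 by rewrite fvecE eqxx.
have tf : xa (mutate k t) k = tau false t k f by rewrite xa_mutate tau_diff fk scale1r.
have efk : (e - f *+ r) (ix k) 0 = 0 by rewrite mulrz_lat !vE er fk mulr1 subrr.
have ef : tau false t k e - xa (mutate k t) k *+ r = e - f *+ r.
  by rewrite tf mulrz_lat -tauZ -tauB -mulrz_lat tau_id.
rewrite ef emZ linearZ /= emM rmorphM /= emX rmorphXn /= qmu_xp qmu_mono0 // -/f.
rewrite -emX -emM -emZ lpow_mono lmulX scalerA -vpD [f *+ r + _]addrC subrK.
by rewrite (lam_mut false) tf mulrz_lat tauZ tauK -mulrz_lat tau_id // addNr vp0 scale1r.
Qed.

Lemma span_Kel t k z z' : em Q t z = qmu Q k t (em Q _ z') -> exists y, z = lin (Kel t k) y.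
Proof.
pose P := [pred m : lattice | 0 <= m (ix k) 0] => E.
have sum_mono (w : tor) : (forall m, m \in supp w -> 0 <= m (ix k) 0) ->
    qmu Q k t (em Q _ w) = em Q t (lin (fun m => Kel t k (tau true t k m)) w).
  move=> w0; rewrite -[in LHS](linX w) em_lin em_lin.
  rewrite (@lin_comp _ _ _ _ _ _ (qmu Q k t)); last by move=> ? ? ?; rewrite linearP.
  by apply: eq_lin => m /w0 m0; rewrite -qmu_mono.
(* The exponents of [z'] that are nonnegative at [k] give elements [Kel] directly; it remains to see
   that the rest [z1] is positive at [k]. *)
pose y0 := push (tau true t k) (part P z').
pose z1 := z - lin (Kel t k) y0; pose z1' := part (predC P) z'.
have E1 : em Q t z1 = qmu Q k t (em Q _ z1').
  rewrite /z1 emB E [in LHS](part_split P z') emD linearD /= sum_mono.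
    by rewrite /y0 lin_push addrC addKr.
  by move=> m; rewrite supp_part => /andP[].
have z1'N m : m \in supp z1' -> m (ix k) 0 < 0 by rewrite supp_part ltNge => /andP[].
have [R RP] : exists R : nat, forall m, m \in supp z1' -> - R%:Z <= m (ix k) 0.
  by have [R RP] := fset_bound (supp z1') (fun m => m (ix k) 0); exists R => m /RP/andP[].
set f : lattice := fvec (ix k); have fk : f (ix k) 0 = 1 by rewrite fvecE eqxx.
(* At [mutate k t] the factor is the [R]-th power of a variable, and brings the entries at [k] of
   the exponents of [z1'] between 0 and [R - 1]. *)
have XR h : h \in supp (lmul t z1 (lpow t (xp t k) R)) -> - R%:Z < h (ix k) 0.
  pose w := lmul (mutate k t) z1' (mono (f *+ R)).
  have wb m : m \in supp w -> 0 <= m (ix k) 0 < R%:Z.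
    case/supp_mul => g1 [g2 [g1z +->]]; rewrite supp_mono => /eqP ->.
    by move: (RP _ g1z) (z1'N _ g1z); rewrite mulrz_lat !vE fk; lia.
  have -> : lmul t z1 (lpow t (xp t k) R) = lin (fun m => Kel t k (tau true t k m)) w.
    apply: (em_inj (t := t)); rewrite -sum_mono => [|m /wb/andP[]//].
    by rewrite emM emX E1 emM -(lpow_mono _ (mutate k t)) emX rmorphM rmorphXn /= qmu_eq.
  case/supp_lin => m /wb mb; have [Ks _ _] := Kel_strand t k (tau true t k m).
  case/Ks => i _ ->; rewrite !vE bc_diag tau_k; lia.
suff S1 m : m \in supp z1 -> 0 < m (ix k) 0.
  exists (y0 + z1); rewrite linD [X in _ + X](@eq_lin _ _ _ _ _ mono) ?linX.
    by rewrite /z1 addrC subrK.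
  by move=> m /S1/ltW/Kel_ge0.
(* The factor is homogeneous of degree [- R] at [k], so a component of [z1] of degree at most 0
   would produce exponents excluded by [XR]. *)
move=> mz; rewrite ltNge; apply/negP => m0.
have xpR h : h \in supp (lpow t (xp t k) R) -> h (ix k) 0 = - R%:Z.
  by have [xs _ _] := lpow_xp_strand t k R; case/xs => i _ ->; rewrite mulrz_lat !vE bc_diag xa_k; lia.
have := @part_mul t (fun h => h (ix k) 0) (- R%:Z) (m (ix k) 0) z1 (lpow t (xp t k) R) (fun _ _ => vD _ _ _) xpR.
have -> : part [pred h : lattice | h (ix k) 0 == m (ix k) 0 + - R%:Z] (lmul t z1 (lpow t (xp t k) R)) = 0.
  by apply: cf_ext => h; rewrite cf_part cf0 /=; case: eqP => // hE; rewrite cf_out //; apply/negP => /XR; lia.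
move/esym/lmul_eq0 => [E0|/eqP E0].
  have : m \in supp (part [pred m0 : lattice | m0 (ix k) 0 == m (ix k) 0] z1) by rewrite supp_part /= eqxx.
  by rewrite E0 suppE cf0 eqxx.
move: E0; rewrite (negbTE (lpow_neq0 _ _ _)) //.
by apply/eqP => x0; have [_ + _] := lpow_xp_strand t k 1; rewrite lpow1 x0 cf0 => /esym/eqP; rewrite oner_eq0.
Qed.

End RankOne.

(** * The quantum Laurent phenomenon *)

Section Laurent.
Variables (K : qring) (nu nf : nat) (Q : qfield K nu nf).
Local Notation lattice := 'cV[int]_(nu + nf).
Local Notation ix := (lshift nf).
Local Notation tor := (tor Q).
Local Notation mono := (mono tor).
Local Notation Kel := (Kel Q).
Local Notation xp := (xp Q).
Implicit Types (t u w : seed nu nf) (k l : 'I_nu) (m g h e : lattice) (a b c y z : tor).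

Lemma ix_neq k l : k != l -> ix k != ix l.
Proof. by rewrite (inj_eq (@lshift_inj _ _)). Qed.

Lemma Kel_m1 t k e : e (ix k) 0 = - 1 -> Kel t k e = mono e + mono (e + bc t k) :> tor.
Proof.
move=> ek; have [Ks K0 K1] := Kel_strand Q t k e; have rk : krank k e = 1%N by rewrite /krank ek.
rewrite rk scale1r in Ks K1; apply: cf_ext => h; rewrite cfD !cfX.
have Be : e == e + bc t k = false by rewrite -subr_eq0 opprD addNKr oppr_eq0 (negbTE (bc_neq0 t k)).
have [<-|Nh] := eqVneq e h; first by rewrite K0 eq_sym Be addr0.
have [<-|Nh'] := eqVneq (e + bc t k) h; first by rewrite K1 add0r.
rewrite addr0 cf_out //; apply/negP => /Ks[[|[|i]] // _ E].
  by move: Nh; rewrite E scale0r addr0 eqxx.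
by move: Nh'; rewrite E scale1r eqxx.
Qed.

Definition inV t k y := exists w : tor, em Q t y = qmu Q k t (em Q _ w).

Lemma inV0 t k : inV t k 0.
Proof. by exists 0; rewrite !em0 rmorph0. Qed.

Lemma inVD t k y z : inV t k y -> inV t k z -> inV t k (y + z).
Proof. by case=> w wE [w' w'E]; exists (w + w'); rewrite !emD rmorphD /= wE w'E. Qed.

Lemma inVZ t k (x : K) y : inV t k y -> inV t k (x *: y).
Proof. by case=> w wE; exists (x *: w); rewrite !emZ linearZ /= wE. Qed.

Lemma inVB t k y z : inV t k y -> inV t k z -> inV t k (y - z).
Proof. by move=> Vy Vz; apply: inVD => //; rewrite -scaleN1r; apply: inVZ. Qed.

Lemma inVM t k y z : inV t k y -> inV t k z -> inV t k (lmul t y z).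
Proof. by case=> w wE [w' w'E]; exists (lmul (mutate k t) w w'); rewrite !emM rmorphM /= wE w'E. Qed.

Lemma inV_Kel t k e : inV t k (Kel t k e).
Proof. by exists (Kel (mutate k t) k (trop_mut k t e)); rewrite qmu_Kel. Qed.

Lemma inV_mono t k e : 0 <= e (ix k) 0 -> inV t k (mono e).
Proof. by move=> e0; rewrite -(Kel_ge0 Q t e0); apply: inV_Kel. Qed.

Lemma inV_lin t k (f : lattice -> tor) y :
  (forall g, g \in supp y -> inV t k (f g)) -> inV t k (lin f y).
Proof.
move=> Vf; rewrite /lin big_seq; apply: (big_ind (inV t k)) => [|? ?|g /Vf Vg].
- exact: inV0.
- exact: inVD.
exact: inVZ.
Qed.

Lemma inV_supp t k y : (forall h, h \in supp y -> 0 <= h (ix k) 0) -> inV t k y.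
Proof. by move=> P; rewrite -(linX y); apply: inV_lin => g /P; apply: inV_mono. Qed.

(** Each [Kel t k e] is homogeneous for such a grading, as its strand runs along [bc t k]. *)
Lemma inV_part t k (f : lattice -> int) d y :
  (forall (e : lattice) (i : int), f (e + i *: bc t k) = f e) -> inV t k y ->
  inV t k (part [pred h : lattice | f h == d] y).
Proof.
move=> fB [w /span_Kel[kap ->]].
have -> : part [pred h : lattice | f h == d] (lin (Kel t k) kap) =
    lin (fun e => part [pred h : lattice | f h == d] (Kel t k e)) kap.
  by apply: lin_comp; apply: linP.
apply: inV_lin => e _; have [Ks _ _] := Kel_strand Q t k e.
have [fe|fe] := eqVneq (f e) d.
  rewrite part_id; first exact: inV_Kel.
  by move=> m /Ks[i _ ->]; rewrite /= fB fe.
suff -> : part [pred h : lattice | f h == d] (Kel t k e) = 0 by apply: inV0.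
apply: cf_ext => h; rewrite cf_part cf0 /=; case: eqP => // fh.
rewrite cf_out //; apply/negP => /Ks[i _ hE].
by move: fe; rewrite -fh hE fB eqxx.
Qed.

(** The lowest component of the product for [f] is the lowest component of [y] times the monomial at
    [u1], which is invertible at both seeds because its entry at [k] is 0. Peel it off and induct on
    the width of the range of [f]. *)
Lemma inV_cancel2 t k (f : lattice -> int) (u1 u2 : lattice) y :
  (forall m m', f (m + m') = f m + f m') ->
  (forall (e : lattice) (i : int), f (e + i *: bc t k) = f e) ->
  f u1 < f u2 -> u1 (ix k) 0 = 0 -> 0 <= u2 (ix k) 0 ->
  inV t k (lmul t y (mono u1 + mono u2)) -> inV t k y.
Proof.
move=> fD fB u12 u1k u2k.
suff H (N : nat) (c : int) y' : (forall h, h \in supp y' -> c <= f h < c + N%:Z) ->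
    inV t k (lmul t y' (mono u1 + mono u2)) -> inV t k y'.
  have [R RP] := fset_bound (supp y) f.
  by apply: (H (R + R).+1 (- R%:Z)) => h /RP; lia.
elim: N c y' => [|N IH] c y' yb Vy.
  by rewrite -(linX y'); apply: inV_lin => g /yb; lia.
pose P d := [pred h : lattice | f h == d].
have f1 h : h \in supp (mono u1) -> f h = f u1 by rewrite supp_mono => /eqP ->.
have f2 h : h \in supp (mono u2) -> f h = f u2 by rewrite supp_mono => /eqP ->.
have Vlow : inV t k (part (P c) y').
  have partD d a b : part (P d) (a + b) = part (P d) a + part (P d) b by apply: linD.
  have := inV_part (c + f u1) fB Vy; rewrite lmulDr -/(P _) partD (part_mul t c y' fD f1).
  have -> : c + f u1 = (c + f u1 - f u2) + f u2 by lia.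
  rewrite (part_mul t _ y' fD f2).
  have -> : part (P (c + f u1 - f u2)) y' = 0.
    apply: cf_ext => h; rewrite cf_part cf0 /=; case: eqP => // fh.
    by rewrite cf_out //; apply/negP => /yb; lia.
  rewrite lmul0l addr0 => V1.
  have Vu : inV t k (mono (- u1)) by apply: inV_mono; rewrite vN u1k oppr0.
  have := inVM V1 Vu; rewrite -lmulA lmulX lamNr lammm oppr0 vp0 scale1r subrr.
  by rewrite lmul1r.
have -> : y' = part (P c) y' + (y' - part (P c) y') by rewrite addrC subrK.
apply: inVD => //; apply: (IH (c + 1)).
  move=> h; rewrite suppE cfB cf_part /=; case: (f h =P c) => fh; first by rewrite subrr eqxx.
  by rewrite subr0 -suppE => /yb; lia.
rewrite lmulBl; apply: inVB => //; apply: inVM => //.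
by apply: inVD; apply: inV_mono; rewrite ?u1k.
Qed.

Lemma xa_neq t k i : i != ix k -> xa t k i 0 = posp (- sB t i k).
Proof. by move=> ik; rewrite mxE (negbTE ik) !fvecE (negbTE ik) eqxx mulr1 mulr0n add0r. Qed.

Lemma xaB_neq t k i : i != ix k -> (xa t k + bc t k) i 0 = posp (sB t i k).
Proof.
by move=> ik; rewrite vD xa_neq // bcE -[X in _ + X](pospB (sB t i k)); ring.
Qed.

(** Pairing with the unit vector at [k] separates the two monomials of [xp t k] and ignores
    [bc t l]. One of the two has entry 0 at [l], according to the sign of [sB t (ix l) k]. *)
Lemma inV_cancel t k l y : l != k -> inV t l (lmul t y (xp t k)) -> inV t l y.
Proof.
move=> lk; have lk' := ix_neq lk; have fl : (fvec (ix k) : lattice) (ix l) 0 = 0.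
  by rewrite fvecE (negbTE lk').
case: (lerP 0 (sB t (ix l) k)) => b0.
  apply: (@inV_cancel2 t l (fun h => lam t h (fvec (ix k)))).
  - by move=> m m'; rewrite lamDl.
  - by move=> e i; rewrite lamDl lamZl lam_bc fl !mulr0 addr0.
  - by rewrite lamDl -/(dk t k) ltrDl dk_gt0.
  - by rewrite xa_neq // posp_neg // oppr_le0.
  by rewrite xaB_neq // posp_ge0.
rewrite /xp addrC.
apply: (@inV_cancel2 t l (fun h => - lam t h (fvec (ix k)))).
- by move=> m m'; rewrite lamDl opprD.
- by move=> e i; rewrite lamDl lamZl lam_bc fl !mulr0 addr0.
- by rewrite lamDl -/(dk t k) opprD gtrDl oppr_lt0 dk_gt0.
- by rewrite xaB_neq // posp_neg // ltW.
by rewrite xa_neq // posp_ge0.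
Qed.

Definition inVV t k l x := exists2 y, em Q t x = qmu Q k t (em Q _ y) & inV (mutate k t) l y.

Lemma inVVM t k l x z : inVV t k l x -> inVV t k l z -> inVV t k l (lmul t x z).
Proof.
case=> y yE Vy [y' y'E Vy']; exists (lmul (mutate k t) y y'); last exact: inVM.
by rewrite !emM rmorphM /= yE y'E.
Qed.

Lemma inVVD t k l x z : inVV t k l x -> inVV t k l z -> inVV t k l (x + z).
Proof.
case=> y yE Vy [y' y'E Vy']; exists (y + y'); last exact: inVD.
by rewrite !emD rmorphD /= yE y'E.
Qed.

Lemma inVVZ t k l (c : K) x : inVV t k l x -> inVV t k l (c *: x).
Proof.
case=> y yE Vy; exists (c *: y); last exact: inVZ.
by rewrite !emZ linearZ /= yE.
Qed.

Lemma inVV0 t k l : inVV t k l 0.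
Proof. by exists 0; [rewrite !em0 rmorph0|apply: inV0]. Qed.

Lemma inVV_lpow t k l x n : inVV t k l x -> inVV t k l (lpow t x n).
Proof.
move=> Vx; elim: n => [|n IH]; last exact: inVVM.
exists (mono 0); first by rewrite !em1 rmorph1.
by apply: inV_mono; rewrite v0.
Qed.

(** The piece [false] adds [posp (sB t (ix l) k)] times the entry at [k], and each step of the
    strand takes back at most one such amount. *)
Lemma strand_mut_entry t k l e (i : nat) : l != k -> 0 <= e (ix k) 0 -> i%:Z <= e (ix k) 0 ->
  e (ix l) 0 <= (tau false t k e + i%:Z *: bc (mutate k t) k) (ix l) 0.
Proof.
move=> lk e0 ie; rewrite bc_mutate vD vZ vN bcE mxE (negbTE (ix_neq lk)) -addrA lerDl.
rewrite mulrN subr_ge0; case: (lerP 0 (sB t (ix l) k)) => b0.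
  by rewrite posp_pos // mulrC ler_wpM2l.
by rewrite (posp_neg (ltW b0)) mul0r mulr_ge0_le0 // ltW.
Qed.

Lemma Kel_mut_strand t k e h : 0 <= e (ix k) 0 -> h \in supp (Kel (mutate k t) k (trop_mut k t e) : tor) ->
  exists2 i : nat, i%:Z <= e (ix k) 0 & h = tau false t k e + i%:Z *: bc (mutate k t) k.
Proof.
move=> e0; rewrite trop_mut_ge //; set e' := tau false t k e.
have [Ks _ _] := Kel_strand Q (mutate k t) k e'; case/Ks => i ir ->; exists i => //.
by move: ir; rewrite /krank tau_k; case: ifP; lia.
Qed.

Lemma inVV_mono t k l e : l != k -> 0 <= e (ix k) 0 -> 0 <= e (ix l) 0 -> inVV t k l (mono e).
Proof.
move=> lk ek el; exists (Kel (mutate k t) k (trop_mut k t e)); first by rewrite qmu_Kel Kel_ge0.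
apply: inV_supp => h /(Kel_mut_strand ek)[i ie ->].
exact: le_trans el (strand_mut_entry _ _ ek ie).
Qed.

(** At [mutate k t] the sum of the two monomials splits as an element [Kel] in direction [l] plus
    terms with nonnegative entry at [l]. *)
Lemma inVV_xp t k l : l != k -> inVV t k l (xp t l).
Proof.
move=> lk; set a := xa t l; have al : a (ix l) 0 = - 1 := xa_k t l.
have kl' : ix k != ix l by rewrite ix_neq // eq_sym.
have ak : a (ix k) 0 = posp (- sB t (ix k) l) by rewrite xa_neq.
have aBk : (a + bc t l) (ix k) 0 = posp (sB t (ix k) l) by rewrite xaB_neq.
have ak0 : 0 <= a (ix k) 0 by rewrite ak posp_ge0.
have aBk0 : 0 <= (a + bc t l) (ix k) 0 by rewrite aBk posp_ge0.
pose t' := mutate k t.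
exists (Kel t' k (trop_mut k t a) + Kel t' k (trop_mut k t (a + bc t l))).
  by rewrite !emD rmorphD /= !qmu_Kel !Kel_ge0.
have [_ Ka Ka1] := Kel_strand Q t' k (trop_mut k t a).
have [_ Kb _] := Kel_strand Q t' k (trop_mut k t (a + bc t l)).
case: (lerP 0 (sB t (ix k) l)) => b0.
  (* The monomial at [a] is untouched; the other one becomes a strand whose first exponent completes
     [Kel t' l a]. *)
  have a0 : a (ix k) 0 = 0 by rewrite ak posp_neg // oppr_le0.
  have ta : trop_mut k t a = a by rewrite trop_mut_ge // tau_id.
  have tB : tau false t k (bc t l) = bc t' l.
    by rewrite -[RHS](tauK false t k) tau_bc // posp_neg ?oppr_le0 // scale0r addr0.
  rewrite ta [X in inV _ _ (X + _)]Kel_ge0 ?a0 //.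
  set e := trop_mut k t (a + bc t l).
  have eE : e = a + bc t' l by rewrite /e trop_mut_ge // tauD tB tau_id.
  have -> : mono a + Kel t' k e = Kel t' l a + (Kel t' k e - mono e).
    by rewrite (Kel_m1 t' al) eE -addrA; congr (_ + _); rewrite addrC subrK.
  apply: inVD; first exact: inV_Kel.
  apply: inV_supp => h; rewrite suppE cfB cfX => nz.
  have he : h != e by apply: contraNneq nz => ->; rewrite eqxx Kb subrr.
  rewrite [_ == h]eq_sym (negbTE he) subr0 -suppE in nz.
  have [i ie hE] := Kel_mut_strand aBk0 nz.
  have i0 : i != 0%N by apply: contraNneq he => i0; rewrite hE i0 scale0r addr0 /e trop_mut_ge.
  have Bk : 0 < sB t (ix k) l by move: ie; rewrite aBk; case: ltgtP b0 => // <- _; rewrite /posp maxxx; lia.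
  have Bl : sB t (ix l) k < 0 by rewrite -sB_sign.
  rewrite hE vD -trop_mut_ge // -/e eE vD al bcE vZ bc_mutate vN bcE.
  have -> : sB t' (ix l) l = 0 by rewrite sB_diag.
  by move: (sB t (ix l) k) Bl => x; nia.
have b0' := ltW b0.
have aB0 : (a + bc t l) (ix k) 0 = 0 by rewrite aBk posp_neg.
have r : a (ix k) 0 = - sB t (ix k) l by rewrite ak posp_pos // oppr_ge0.
have tB : tau true t k (bc t l) = bc t' l.
  by rewrite -[RHS](tauK true t k) tau_bc // posp_neg // scale0r addr0.
have tb : trop_mut k t (a + bc t l) = a + bc t l by rewrite trop_mut_ge // tau_id.
rewrite tb [X in inV _ _ (_ + X)]Kel_ge0 ?aB0 //.
(* Here the strand comes from the monomial at [a], and its last exponent [e1] is the one that pairs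
   with the untouched monomial. *)
set e := trop_mut k t a; set e1 := tau true t k a.
have rk : (krank k e)%:Z = a (ix k) 0 by rewrite /krank trop_mut_k; case: ifP; lia.
have eE : e + (krank k e)%:Z *: bc t' k = e1.
  by rewrite rk /e trop_mut_ge // tau_diff bc_mutate scalerN addrK.
have e1B : a + bc t l = e1 + bc t' l by rewrite -tB -tauD tau_id.
have Bl : 0 < sB t (ix l) k by rewrite sB_sign.
have e1l : e1 (ix l) 0 = - 1.
  by rewrite mxE (negbTE (ix_neq lk)) al posp_neg ?mul0r ?addr0 // oppr_le0 ltW.
have -> : Kel t' k e + mono (a + bc t l) = Kel t' l e1 + (Kel t' k e - mono e1).
  by rewrite (Kel_m1 t' e1l) -e1B [RHS]addrC addrA subrK.
apply: inVD; first exact: inV_Kel.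
apply: inV_supp => h; rewrite suppE cfB cfX => nz.
have he : h != e1 by apply: contraNneq nz => ->; rewrite eqxx -eE Ka1 subrr.
rewrite [_ == h]eq_sym (negbTE he) subr0 -suppE in nz.
have [i ie hE] := Kel_mut_strand ak0 nz.
have ir : i%:Z < a (ix k) 0.
  rewrite lt_neqAle ie andbT; apply: contraNneq he => iE.
  by rewrite hE iE -rk -trop_mut_ge // eE.
rewrite hE mxE vZ bc_mutate vN bcE mxE (negbTE (ix_neq lk)) al posp_pos ?(ltW Bl) //.
by move: (sB t (ix l) k) (a (ix k) 0) Bl ir => x x'; nia.
Qed.

(** A large power of the variable at [k] clears negative entries there. The bound holds for all
    larger powers, so finitely many [e] can share one. *)
Lemma inVV_Kel t k l e : l != k ->
  exists R0 : nat, forall R, (R0 <= R)%N -> inVV t k l (lmul t (Kel t l e) (mono (fvec (ix k) *+ R))).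
Proof.
move=> lk; have kl' : ix l != ix k by rewrite ix_neq.
have main e' : 0 <= e' (ix l) 0 -> exists R0 : nat, forall R, (R0 <= R)%N ->
    inVV t k l (lmul t (mono e') (mono (fvec (ix k) *+ R))).
  move=> el; exists `|(e' (ix k) 0)%R|%N => R RR; rewrite lmulX; apply: inVVZ; apply: inVV_mono => //.
    by rewrite mulrz_lat !vE fvecE eqxx; lia.
  by rewrite mulrz_lat !vE fvecE (negbTE kl') mulr0 addr0.
case: (lerP 0 (e (ix l) 0)) => e0; first by rewrite Kel_ge0 //; apply: main.
pose r := `|(e (ix l) 0)%R|%N; have er : e (ix l) 0 = - r%:Z by rewrite /r; lia.
rewrite (Kel_le0 Q t er); set e' := e - _.
have [|R0 RP] := main e'; first by rewrite /e' mulrz_lat !vE xa_k er; lia.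
exists R0 => R /RP VR; rewrite lmulZl -lmulA; apply: inVVZ; apply: inVVM => //.
exact: inVV_lpow (inVV_xp t lk).
Qed.

(* [mutate k (mutate k t)] is only propositionally equal to [t]. *)
Lemma step_back t k : exists r : mpath (mutate k t) t,
  (forall x : Q t, qmu Q k t (qmus r x) = x) /\
  (forall z, qmus r (em Q t z) = qmu Q k (mutate k t) (em Q _ z)) /\
  (forall g, trop r g = trop_mut k (mutate k t) g).
Proof.
suff H v : v = mutate k (mutate k t) -> exists r : mpath (mutate k t) v,
    [/\ forall z, qmu Q k t (qmus r (em Q v z)) = em Q t z,
        forall z, qmus r (em Q v z) = qmu Q k (mutate k t) (em Q _ z) &
        forall g, trop r g = trop_mut k (mutate k t) g].
  have [r [rE rE2 rT]] := H t (esym (mutateK k t)); exists r; split=> // x.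
  have [a [b [b0 ->]]] := qF_frac x; have bu := qF_unit (z := em Q t b).
  have [f fE] := qmus_lr Q r; rewrite fE rmorphM rmorphV ?bu ?em_eq0 //=.
  rewrite rmorphM rmorphV /=; last first.
    by apply: qF_unit; rewrite -fE -(qmus0 Q r) (inj_eq (@qmus_inj _ _ _ Q _ _ r)) em_eq0.
  by rewrite -!fE !rE.
move=> ->; exists (mstep k (mutate k t)); split=> // z /=.
have mu_k i : qmu Q k t (qmu Q k (mutate k t) (em Q _ (mono (fvec i)))) = em Q t (mono (fvec i)).
  have [->|ik] := eqVneq i (ix k); last by rewrite !qmu_neq.
  by rewrite qmu_eq qmu_xp.
have mu_m m : qmu Q k t (qmu Q k (mutate k t) (em Q _ (mono m))) = em Q t (mono m).
  have L : lam (mutate k (mutate k t)) = lam t by rewrite mutateK.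
  apply: (@lat_ind _ _ (fun m => qmu Q k t (qmu Q k (mutate k t) (em Q _ (mono m))) = em Q t (mono m))).
  - by rewrite !em1 !rmorph1.
  - move=> m1 m2 P1 P2; rewrite [in LHS](monoD _ (mutate k (mutate k t))) L [in RHS](monoD _ t).
    by rewrite !emZ !emM !linearZ !rmorphM /= P1 P2.
  - move=> m1 P1; have N0 : em Q t (mono m1) != 0 by rewrite em_eq0 mono_neq0.
    apply: (mulrI (qF_unit N0)); rewrite -{1}P1 -!rmorphM -!emM !lmulX !emZ !subrr L.
    by rewrite lamNr lammm oppr0 vp0 !scale1r !em1 !rmorph1.
  by move=> i _.
rewrite -(linX z) !em_lin (@lin_comp _ _ _ _ _ _ (qmu Q k (mutate k t))); last by move=> ? ? ?; rewrite linearP.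
rewrite (@lin_comp _ _ _ _ _ _ (qmu Q k t)); last by move=> ? ? ?; rewrite linearP.
by apply: eq_lin => g _; rewrite mu_m.
Qed.

(** The upper bound of a seed. It is stable under mutation, which reduces the Laurent phenomenon to
    computations two mutations away. *)
Definition upper t (x : Q t) := (exists y, x = em Q t y) /\ forall l, exists y, x = qmu Q l t (em Q _ y).

(* The product of [y1] by a power of [xp (mutate k t) k] is Laurent at
   [mutate l (mutate k t)], where this factor can be cancelled. *)
Lemma upper_mut t k x : upper x -> upper (qmu_inv k x : Q (mutate k t)).
Proof.
move=> [[y yE] ux]; have [y1 y1E] := ux k.
have E1 : qmu_inv k x = em Q (mutate k t) y1 by rewrite y1E qmu_funK.
split=> [|l]; first by exists y1.
have [->|lk] := eqVneq l k.
  exists y; have [r [rK [rE _]]] := step_back t k.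
  by apply: (can_inj (@qmu_funK _ _ _ Q k t)); rewrite qmu_invK -rE rK.
suff [w wE] : inV (mutate k t) l y1 by exists w; rewrite E1.
have [w wE] := ux l; rewrite yE in wE; have [kap kE] := span_Kel wE.
have [R RP] : exists R, inVV t k l (lmul t y (mono (fvec (ix k) *+ R))).
  rewrite kE.
  have [R RP] : exists R : nat, forall e, e \in enum_fset (supp kap) ->
      inVV t k l (lmul t (Kel t l e) (mono (fvec (ix k) *+ R))).
    suff [R RP] : exists R0 : nat, forall R, (R0 <= R)%N -> forall e, e \in enum_fset (supp kap) ->
      inVV t k l (lmul t (Kel t l e) (mono (fvec (ix k) *+ R))) by exists R; apply: RP.
    elim: (enum_fset (supp kap)) => [|e s [R RP]]; first by exists 0%N.
    have [R1 R1P] := inVV_Kel t e lk; exists (R + R1)%N => R2 R2P e'.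
    rewrite inE => /orP[/eqP ->|e's].
      by apply: R1P; apply: leq_trans R2P; apply: leq_addl.
    by apply: RP e's; apply: leq_trans R2P; apply: leq_addr.
  exists R; rewrite lmul_linl {1}/lin big_seq; apply: (big_ind (inVV t k l)) => [|? ?|g /RP Vg].
  - exact: inVV0.
  - exact: inVVD.
  exact: inVVZ.
have {RP} : inV (mutate k t) l (lmul (mutate k t) y1 (lpow (mutate k t) (xp (mutate k t) k) R)).
  case: RP => y2 y2E V2; rewrite (_ : lmul _ _ _ = y2) //.
  apply: (em_inj (t := mutate k t)); apply: (@qmu_inj _ _ _ Q k t).
  by rewrite -y2E !emM emX rmorphM rmorphXn /= qmu_xp -y1E yE -(lpow_mono Q t) emX.
elim: R => [|R IH]; first by rewrite lmul1r.
by rewrite lpowSr lmulA => /(inV_cancel lk).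
Qed.

Lemma upper_laurent t u (q : mpath t u) (x : Q t) : upper x -> exists y, x = qmus q (em Q u y).
Proof.
elim: q x => [v|v k v' q IH] x ux; first by case: ux.
by have [y yE] := IH _ (upper_mut k ux); exists y; rewrite /= -yE qmu_invK.
Qed.

Lemma laurent_phenomenon t u (q : mpath t u) i : exists y, em Q t (mono (fvec i)) = qmus q (em Q u y).
Proof.
apply: upper_laurent; split=> [|l]; first by exists (mono (fvec i)).
have [->|il] := eqVneq i (ix l); last by exists (mono (fvec i)); rewrite qmu_neq.
by exists (xp (mutate l t) l); rewrite qmu_xp.
Qed.

End Laurent.

(** * Leading exponents *)

Section Orders.
Variable n : nat.
Local Notation lattice := 'cV[int]_n.
Implicit Types x y : lattice.

(** A total order compatible with addition, given by its positive cone. *)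
Record lorder := LOrder {
  lpos :> lattice -> bool;
  lpos0 : lpos 0 = false;
  lposD : forall x y, lpos x -> lpos y -> lpos (x + y);
  lposT : forall x, x != 0 -> lpos x || lpos (- x)
}.

Lemma lpos_asym (o : lorder) x : o x -> o (- x) = false.
Proof. by move=> ox; apply/negP => /(lposD ox); rewrite subrr lpos0. Qed.

Section Lexicographic.
Variables (I : eqType) (F : I -> lattice -> int).
Hypothesis FD : forall i x y, F i (x + y) = F i x + F i y.
Implicit Type s : seq I.

Fixpoint lexpos s x : bool :=
  if s is i :: s' then if F i x == 0 then lexpos s' x else 0 < F i x else false.

Lemma lex0 i : F i 0 = 0.
Proof. by apply: (addrI (F i 0)); rewrite -FD !addr0. Qed.

Lemma lexpos0 s : lexpos s 0 = false.
Proof. by elim: s => //= i s IH; rewrite lex0 eqxx. Qed.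

Lemma lexposD s x y : lexpos s x -> lexpos s y -> lexpos s (x + y).
Proof.
elim: s => [|i s IH] //=; rewrite FD.
case: (F i x =P 0) => [->|fx]; case: (F i y =P 0) => [->|fy] //.
- by rewrite add0r; move/eqP/negbTE: fy => ->.
- by rewrite addr0; move/eqP/negbTE: fx => ->.
by move=> px py; rewrite gt_eqF ?addr_gt0.
Qed.

Lemma lexposT s x : (exists2 i, i \in s & F i x != 0) -> lexpos s x || lexpos s (- x).
Proof.
elim: s => [|i s IH] [j js nj] //=.
have -> : F i (- x) = - F i x by apply/eqP; rewrite -addr_eq0 -FD addNr lex0.
rewrite oppr_eq0; case: (F i x =P 0) => [ix|/eqP ix].
  by apply: IH; exists j => //; move: js; rewrite inE => /orP[/eqP ji|//]; rewrite ji ix eqxx in nj.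
by rewrite oppr_gt0 -neq_lt eq_sym.
Qed.

End Lexicographic.

Lemma pull_order_ex (o : lorder) (f : lattice -> lattice) :
  (forall x y, f (x + y) = f x + f y) -> injective f ->
  exists o' : lorder, forall x, o' x = o (f x).
Proof.
move=> fD fi; have f0 : f 0 = 0 by apply: (addrI (f 0)); rewrite -fD !addr0.
have P0 : o (f 0) = false by rewrite f0 lpos0.
have PD x y : o (f x) -> o (f y) -> o (f (x + y)) by rewrite fD; apply: lposD.
have PT x : x != 0 -> o (f x) || o (f (- x)).
  move=> x0; have -> : f (- x) = - f x by apply/eqP; rewrite -addr_eq0 -fD addNr f0.
  by apply: lposT; rewrite -f0 (inj_eq fi).
by exists (LOrder P0 PD PT).
Qed.

End Orders.

Section Leads.
Variables (K : qring) (nu nf : nat) (Q : qfield K nu nf).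
Local Notation lattice := 'cV[int]_(nu + nf).
Local Notation ix := (lshift nf).
Local Notation tor := (tor Q).
Local Notation mono := (mono tor).
Implicit Types (t u w : seed nu nf) (k l : 'I_nu) (m g h e : lattice) (a b c y z : tor).
Implicit Types (o : lorder (nu + nf)).

Definition isLO o y g := g \in supp y /\ forall h, h \in supp y -> h != g -> o (g - h).

Lemma LO_ex o y : y != 0 -> exists g, isLO o y g.
Proof.
move=> /supp_exists[g0 g0y].
suff H (s : seq lattice) : s != [::] -> exists2 g, g \in s & forall h, h \in s -> h != g -> o (g - h).
  have [|g gy gP] := H (enum_fset (supp y)); last by exists g.
  by apply: contraTneq g0y => E; rewrite -[_ \in supp y]/(g0 \in enum_fset (supp y)) E.
elim: s => [//|x s IH _]; have [->|s0] := eqVneq s [::].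
  by exists x; rewrite ?mem_head // => h; rewrite inE => /eqP ->; rewrite eqxx.
have [g gs gP] := IH s0; have [xg|xg] := eqVneq x g.
  exists g; first by rewrite inE gs orbT.
  by move=> h; rewrite inE => /orP[/eqP ->|]; [rewrite xg eqxx|apply: gP].
have gx : g - x != 0 by rewrite subr_eq0 eq_sym.
have /orP[p|p] := lposT o gx.
  exists g; first by rewrite inE gs orbT.
  by move=> h; rewrite inE => /orP[/eqP -> _ //|]; apply: gP.
rewrite opprB in p; exists x; first exact: mem_head.
move=> h; rewrite inE => /orP[/eqP ->|hs hx]; first by rewrite eqxx.
have [->//|hg] := eqVneq h g.
by rewrite -(subrKA g x (- h)) lposD // gP.
Qed.

Lemma LO_uniq o y g h : isLO o y g -> isLO o y h -> g = h.
Proof.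
case=> gy gP [hy hP]; apply/eqP; apply/negPn/negP => gh.
have := gP _ hy; rewrite eq_sym gh => /(_ isT)/lpos_asym.
by rewrite opprB hP.
Qed.

Lemma LO_neq0 o y g : isLO o y g -> y != 0.
Proof. by case=> gy _; apply: contraTneq gy => ->; rewrite suppE cf0 eqxx. Qed.

Lemma LO_mono o g : isLO o (mono g) g.
Proof. by split=> [|h]; rewrite supp_mono // => /eqP ->; rewrite eqxx. Qed.

Lemma LO_mul o t y z g h : isLO o y g -> isLO o z h -> isLO o (lmul t y z) (g + h).
Proof.
case=> gy gP [hz hP]; split; last first.
  move=> x /supp_mul[g1 [g2 [g1y g2z ->]]] ne.
  have -> : g + h - (g1 + g2) = (g - g1) + (h - g2) by lat.
  have [g1E|g1g] := eqVneq g1 g.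
    rewrite g1E subrr add0r hP //; apply: contraNneq ne => ->; by rewrite g1E.
  have [->|g2h] := eqVneq g2 h; first by rewrite subrr addr0 gP.
  by rewrite lposD ?gP ?hP.
rewrite suppE cf_mul (big_fsetD1 g) //= big_seq big1 => [|g1].
  rewrite addr0 addrC addKr; apply: (K_mul_neq0 Q t); first by rewrite -suppE.
  by rewrite vpM_eq0 -suppE.
rewrite in_fsetD1 => /andP[g1g g1y].
rewrite (@cf_out _ _ _ z) ?mulr0 //; apply/negP => hz'.
have [E|ne] := eqVneq (g + h - g1) h.
  case/negP: g1g; apply/eqP; have -> : g1 = g + h - (g + h - g1) by lat.
  by rewrite E addrK.
have := lposD (gP _ g1y g1g) (hP _ hz' ne).
have -> : g - g1 + (h - (g + h - g1)) = 0 by lat.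
by rewrite lpos0.
Qed.

Lemma LO_add o y z g h : isLO o y g -> isLO o z h -> o (g - h) -> isLO o (y + z) g.
Proof.
case=> gy gP [hz hP] gh.
have zg : g \notin supp z.
  apply/negP => gz; have [E|ne] := eqVneq g h; first by rewrite E subrr lpos0 in gh.
  by have := hP _ gz ne; rewrite -opprB lpos_asym.
split; first by rewrite suppE cfD (cf_out zg) addr0 -suppE.
move=> x /suppD[xy|xz] xg; first exact: gP.
have [->//|xh] := eqVneq x h.
by rewrite -(subrKA h g (- x)) lposD // hP.
Qed.

Lemma LO_scale o t (x : K) y g : x != 0 -> isLO o y g -> isLO o (x *: y) g.
Proof.
move=> x0 [gy gP]; split=> [|h /suppZ]; last exact: gP.
by rewrite suppE cfZ (K_mul_neq0 Q t) // -?suppE.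
Qed.

(* The greatest exponent extends to fractions, as a valuation. *)
Definition isv o t (x : Q t) g := exists a b ga gb,
  [/\ isLO o a ga, isLO o b gb, x * em Q t b = em Q t a & g = ga - gb].

Lemma em_neq0 t y : y != 0 -> em Q t y != 0.
Proof. by rewrite em_eq0. Qed.

(** Writing [b^-1 c] as a right fraction yields the common right multiple. *)
Lemma ore t b c : b != 0 -> c != 0 ->
  exists b' c', [/\ b' != 0, c' != 0 & lmul t b c' = lmul t c b'].
Proof.
move=> b0 c0; have bu := qF_unit (em_neq0 t b0).
have [c' [b' [b'0 E]]] := qF_frac ((em Q t b)^-1 * em Q t c).
have b'u := qF_unit (em_neq0 t b'0).
have E' : em Q t (lmul t b c') = em Q t (lmul t c b').
  by rewrite !emM -[em Q t c'](divrK b'u) -E mulrA mulVKr.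
exists b', c'; split=> //; last exact: em_inj E'.
apply: contraTneq (lmul_neq0 t c0 b'0) => c'0.
by rewrite -(em_inj E') c'0 lmul0r eqxx.
Qed.

Lemma ore_LO o t b c gb gc : isLO o b gb -> isLO o c gc ->
  exists b' c' gb' gc', [/\ isLO o b' gb', isLO o c' gc', lmul t b c' = lmul t c b' & gb + gc' = gc + gb'].
Proof.
move=> bg cg; have [b' [c' [b'0 c'0 E]]] := ore t (LO_neq0 bg) (LO_neq0 cg).
have [gb' b'g] := LO_ex o b'0; have [gc' c'g] := LO_ex o c'0.
exists b', c', gb', gc'; split=> //.
by apply: LO_uniq (LO_mul t bg c'g) _; rewrite E; apply: LO_mul.
Qed.

Lemma isv_em o t y g : isLO o y g -> isv o (em Q t y) g.
Proof.
move=> yg; exists y, (mono 0), g, 0; split=> //; first exact: LO_mono.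
  by rewrite em_mono0 mulr1.
by rewrite subr0.
Qed.

Lemma isv_uniq o t (x : Q t) g h : isv o x g -> isv o x h -> g = h.
Proof.
case=> a [b [ga [gb [aL bL E ->]]]] [a' [b' [ga' [gb' [aL' bL' E' ->]]]]].
have [c' [c [gc' [gc [cL' cL D]]]]] := ore_LO t bL bL'.
have : isLO o (lmul t a c) (ga' + gc').
  have -> : lmul t a c = lmul t a' c'; last exact: LO_mul.
  by apply: (em_inj (t := t)); rewrite !emM -E -E' -!mulrA -!emM D.
move/(LO_uniq (LO_mul t aL cL)) => Ea Eb.
by apply: (addIr (gb + gc)); rewrite {2}Eb; move: Ea => /eqP; rewrite -subr_eq0 => /eqP Ea; apply/eqP; rewrite -subr_eq0 -Ea; apply/eqP; lat.
Qed.

Lemma isv_mul o t (x x' : Q t) g g' : isv o x g -> isv o x' g' -> isv o (x * x') (g + g').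
Proof.
case=> a [b [ga [gb [aL bL E ->]]]] [a' [b' [ga' [gb' [aL' bL' E' ->]]]]].
have [d [c [gd [gc [dL cL D Eg]]]]] := ore_LO t bL aL'.
exists (lmul t a c), (lmul t b' d), (ga + gc), (gb' + gd); split; rewrite ?LO_mul //.
- exact: LO_mul.
- exact: LO_mul.
- by rewrite !emM -mulrA [x' * _]mulrA E' -emM -D emM mulrA E.
by move: Eg => /eqP; rewrite -subr_eq0 => /eqP Eg; apply/eqP; rewrite -subr_eq0 -oppr_eq0 -Eg; apply/eqP; lat.
Qed.

Lemma isv_inv o t (x : Q t) g : isv o x g -> isv o x^-1 (- g).
Proof.
case=> a [b [ga [gb [aL bL E ->]]]]; exists b, a, gb, ga; split=> //; last by rewrite opprB.
have x0 : x != 0.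
  by apply: contraTneq (em_neq0 t (LO_neq0 aL)) => x0; rewrite -E x0 mul0r eqxx.
by rewrite -E mulKr // qF_unit.
Qed.

Lemma isv_add o t (x x' : Q t) g g' : isv o x g -> isv o x' g' -> o (g - g') -> isv o (x + x') g.
Proof.
case=> a [b [ga [gb [aL bL E ->]]]] [a' [b' [ga' [gb' [aL' bL' E' ->]]]]] lt.
have [c' [c [gc' [gc [cL' cL D Eg]]]]] := ore_LO t bL bL'.
exists (lmul t a c + lmul t a' c'), (lmul t b c), (ga + gc), (gb + gc); split.
- apply: LO_add (LO_mul t aL cL) (LO_mul t aL' cL') _.
  have -> : ga + gc - (ga' + gc') = ga - gb - (ga' - gb') + (gb + gc - (gb' + gc')) by lat.
  by rewrite Eg subrr addr0.
- exact: LO_mul.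
- by rewrite mulrDl {2}D !emM !mulrA E E' -!emM emD.
by lat.
Qed.

Lemma isv_scale o t (x : K) (z : Q t) g : x != 0 -> isv o z g -> isv o (x *: z) g.
Proof.
move=> x0 [a [b [ga [gb [aL bL E ->]]]]]; exists (x *: a), b, ga, gb; split=> //; first exact: (LO_scale t).
by rewrite -scalerAl E emZ.
Qed.

Lemma isv_pow1 o t : isv o (1 : Q t) 0.
Proof. by rewrite -(em_mono0 Q t); apply/isv_em/LO_mono. Qed.

Definition isv_monos o t u (q : mpath t u) (G : lattice -> lattice) :=
  forall m, isv o (qmus q (em Q u (mono m))) (G m).

(** As [G] is injective, the terms have distinct leads and the greatest one cannot cancel. *)
Lemma isv_lin o t u (q : mpath t u) (G : lattice -> lattice) y :
  (forall m m', G (m + m') = G m + G m') -> injective G -> isv_monos o q G -> y != 0 ->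
  exists m0, [/\ m0 \in supp y, isv o (qmus q (em Q u y)) (G m0)
    & forall m, m \in supp y -> m != m0 -> o (G m0 - G m)].
Proof.
move=> GD Gi Gv y0; have [o' o'E] := pull_order_ex o GD Gi; have [m0 [m0y m0P]] := LO_ex o' y0.
have GN m : G (- m) = - G m.
  have G0 : G 0 = 0 by apply: (addrI (G 0)); rewrite -GD !addr0.
  by apply/eqP; rewrite -addr_eq0 -GD addNr G0.
have lt m : m \in supp y -> m != m0 -> o (G m0 - G m).
  by move=> my mm0; rewrite -GN -GD -o'E; apply: m0P.
exists m0; split=> //; have [f fE] := qmus_lr Q q.
rewrite -(linX y) em_lin fE (@lin_comp _ _ _ _ _ _ f); last by move=> ? ? ?; rewrite linearP.
have v m : m \in supp y -> isv o (cf y m *: f (em Q u (mono m))) (G m).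
  by move=> my; apply: isv_scale; rewrite -?suppE // -fE.
have H (s : seq lattice) : (forall m, m \in s -> m \in supp y /\ m != m0) ->
    isv o (cf y m0 *: f (em Q u (mono m0)) + \sum_(m <- s) cf y m *: f (em Q u (mono m))) (G m0).
  elim: s => [|m s IH] sP; first by rewrite big_nil addr0; apply: v.
  rewrite big_cons addrCA addrC; have [my mm0] := sP m (mem_head _ _).
  apply: isv_add (v _ my) _; last exact: lt.
  by apply: IH => x xs; apply: sP; rewrite inE xs orbT.
rewrite /lin (big_fsetD1 m0) //=; apply: H => m.
by rewrite -[_ \in _]/(m \in (supp y `\ m0)%fset) in_fsetD1 => /andP[].
Qed.

(** Properties of the map sending an exponent at [u] to the lead at [t] of its monomial. Individual
    columns may go to combinations of columns, but the lattices they span correspond. *)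
Record isom t u (G : lattice -> lattice) : Prop := Isom {
  isomD : forall m m', G (m + m') = G m + G m';
  isom_lam : forall m m', lam t (G m) (G m') = lam u m m';
  isom_bij : bijective G;
  isom_B : forall n, exists n', G (Bz u n) = Bz t n';
  isom_B' : forall n, exists n', Bz t n = G (Bz u n')
}.

Lemma isom_id t : isom t t id.
Proof. by split=> // [|n|n]; [exists id|exists n|exists n]. Qed.

Lemma addN (G : lattice -> lattice) : (forall m m', G (m + m') = G m + G m') -> forall m, G (- m) = - G m.
Proof.
move=> GD m; have G0 : G 0 = 0 by apply: (addrI (G 0)); rewrite -GD !addr0.
by apply/eqP; rewrite -addr_eq0 -GD addNr G0.
Qed.

Lemma addZ (G : lattice -> lattice) : (forall m m', G (m + m') = G m + G m') ->
  forall (x : int) m, G (x *: m) = x *: G m.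
Proof.
move=> GD x m; have G0 : G 0 = 0 by apply: (addrI (G 0)); rewrite -GD !addr0.
have Gn (r : nat) : G (r%:Z *: m) = r%:Z *: G m.
  elim: r => [|r IH]; first by rewrite !scale0r.
  by rewrite intS !scalerDl !scale1r GD IH.
by case: x => r //; rewrite NegzE !scaleNr addN // Gn.
Qed.

Lemma add_sum (G : lattice -> lattice) (I : Type) (r : seq I) (f : I -> lattice) :
  (forall m m', G (m + m') = G m + G m') -> G (\sum_(i <- r) f i) = \sum_(i <- r) G (f i).
Proof.
move=> GD; have G0 : G 0 = 0 by apply: (addrI (G 0)); rewrite -GD !addr0.
exact: (big_morph G GD G0).
Qed.

Lemma tau_Bz (b : bool) t k n : exists n', tau b t k (Bz (mutate k t) n) = Bz t n'.
Proof.
pose f (m : lattice) := exists n', m = Bz t n'.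
suff : f (tau b t k (Bz (mutate k t) n)) by [].
have fD m m' : f m -> f m' -> f (m + m') by case=> x -> [x' ->]; exists (x + x'); rewrite BzD.
have fZ (r : int) m : f m -> f (r *: m) by case=> x ->; exists (r *: x); rewrite BzZ.
have fB l : f (bc t l) by exists (delta_mx l 0); rewrite Bz_delta.
rewrite Bz_bc add_sum => [|m m']; last exact: tauD.
apply: (big_ind f) => // [|l _]; first by exists 0; rewrite Bz0.
rewrite tauZ; apply/fZ; have [->|lk] := eqVneq l k.
  by rewrite tau_bc_k -scaleN1r; apply/fZ.
by rewrite tau_bc //; apply: fD => //; apply: fZ.
Qed.

Lemma tau_Bz' (b : bool) t k n : exists n', Bz t n = tau b t k (Bz (mutate k t) n').
Proof.
have [n'] := tau_Bz (~~ b) (mutate k t) k n; rewrite mutateK => E; exists n'.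
by rewrite -E tau_mutate tauK.
Qed.

Lemma isom_tau (b : bool) t k : isom t (mutate k t) (tau b t k).
Proof.
split=> [m m'|m m'||n|n]; rewrite ?tauD -?lam_mut //.
- by exists (tau b t k); apply: tauK.
- exact: tau_Bz.
exact: tau_Bz'.
Qed.

Lemma isom_comp t u w G H : isom t u G -> isom u w H -> isom t w (fun m => G (H m)).
Proof.
move=> [GD Gl Gb GB GB'] [HD Hl Hb HB HB']; split=> [m m'|m m'||n|n].
- by rewrite HD GD.
- by rewrite Gl Hl.
- exact: bij_comp Gb Hb.
- by have [n' ->] := HB n; apply: GB.
by have [n' ->] := GB' n; have [n'' ->] := HB' n'; exists n''.
Qed.

Lemma isom_B_neq0 t u G l : isom t u G -> G (bc u l) != 0.
Proof.
move=> iG; apply: contraTneq (dk_gt0 u l) => G0.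
by rewrite /dk -(isom_lam iG) G0 lam0l.
Qed.

(** Of the two monomials in the exchange relation, the order retains one according to the sign of
    [G (bc u l)]; this decides the piece of [tau]. *)
Lemma isv_step o t u (q : mpath t u) l G : isom t u G -> isv_monos o q G ->
  isv_monos o (mcat q (mstep l u)) (fun m => G (tau (~~ o (G (bc u l))) u l m)).
Proof.
move=> iG Gv m; set eps := ~~ _; have GD := isomD iG.
have fD m1 m2 : G (tau eps u l (m1 + m2)) = G (tau eps u l m1) + G (tau eps u l m2) by rewrite tauD GD.
rewrite qmus_cat /=.
pose P m := isv o (qmus q (qmu Q l u (em Q (mutate l u) (mono m)))) (G (tau eps u l m)).
have [f fE] := qmus_lr Q q; apply: (@lat_ind _ _ P).
- by rewrite /P em1 rmorph1 qmus1 tau0 -(scale0r 0) addZ // scale0r; apply: isv_pow1.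
- rewrite /P => m1 m2 P1 P2; rewrite (monoD _ (mutate l u)) emZ emM linearZ rmorphM /= qmusZ qmusM fD.
  by apply: isv_scale; [apply: vp_neq0|apply: isv_mul].
- rewrite /P => m1 /isv_inv; rewrite tauN addN //; set x := qmus q _ => vx.
  suff -> : qmus q (qmu Q l u (em Q (mutate l u) (mono (- m1)))) = x^-1 by [].
  have x0 : x != 0.
    by rewrite /x qmus_neq0 // -(rmorph0 (qmu Q l u)) (inj_eq (@qmu_inj _ _ _ Q l u)) em_eq0 mono_neq0.
  apply: (mulrI (qF_unit x0)); rewrite divrr ?qF_unit // /x -qmusM -rmorphM -emM lmulX lamNr lammm.
  by rewrite oppr0 vp0 scale1r subrr em1 rmorph1 qmus1.
move=> i _; rewrite /P; have [->|il] := eqVneq i (ix l); last by rewrite tau_fvec // qmu_neq.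
rewrite qmu_eq -/(xa u l) emD qmusD /eps; have := Gv (xa u l); have := Gv (xa u l + bc u l).
rewrite GD; have := lposT o (isom_B_neq0 l iG); case: (boolP (o (G (bc u l)))) => /= [oB _|_ oB] vB v.
  rewrite tau_diff fvecE eqxx scale1r -/(xa u l) GD addrC; apply: isv_add vB v _.
  by rewrite addrC addKr.
rewrite -/(xa u l); apply: isv_add v vB _.
by rewrite opprD addNKr.
Qed.

(** On [Bz t n] the first kind of functional is [- n k 0] up to a positive factor; the coordinates
    serve as tie-breaks that make the lexicographic order total. *)
Definition ordfun t (i : 'I_nu + 'I_(nu + nf)) m : int :=
  match i with inl k => - lam t m (fvec (ix k)) | inr j => m j 0 end.

Definition ordlist (r : seq 'I_nu) : seq ('I_nu + 'I_(nu + nf)) :=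
  map inl r ++ map inr (enum 'I_(nu + nf)).

Lemma ordfunD t i m m' : ordfun t i (m + m') = ordfun t i m + ordfun t i m'.
Proof. by case: i => i /=; rewrite ?lamDl ?opprD ?vD. Qed.

Definition ord t (r : seq 'I_nu) : lorder (nu + nf).
Proof.
exists (lexpos (ordfun t) (ordlist r)).
- exact/lexpos0/ordfunD.
- exact/lexposD/ordfunD.
move=> m m0; apply: lexposT; first exact: ordfunD.
have [[j mj]|no] := pselect (exists j, m j 0 != 0).
  by exists (inr j) => //; rewrite mem_cat map_f ?orbT ?mem_enum.
case/eqP: m0; apply/colP => j; rewrite v0; apply/eqP/negPn/negP => mj.
by case: no; exists j.
Defined.

Lemma ord_head t k r (n : 'cV[int]_nu) : ord t (k :: r) (Bz t n) = if n k 0 == 0 then ord t r (Bz t n) else n k 0 < 0.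
Proof.
rewrite /= lam_Bz_fvec oppr_eq0 mulf_eq0 (negbTE (dk_neq0 t k)) orbF.
by case: ifP => // _; rewrite oppr_gt0 pmulr_llt0 ?dk_gt0.
Qed.

Lemma ord_Bz t r (n : 'cV[int]_nu) : (forall k, k \in r) -> (forall k, 0 <= n k 0) -> n != 0 -> ord t r (- Bz t n).
Proof.
move=> rF n0 nn0; have [k nk] : exists k, n k 0 != 0.
  have [//|no] := pselect (exists k, n k 0 != 0); case/eqP: nn0; apply/colP => k.
  by rewrite mxE; apply/eqP/negPn/negP => nk; case: no; exists k.
have := rF k; elim: r {rF} => [|i r IH] //.
rewrite -BzN ord_head mxE oppr_eq0 inE BzN; case: (eqVneq (n i 0) 0) => [E|E].
  by case/orP => [/eqP ki|/IH //]; rewrite ki E eqxx in nk.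
by move=> _; rewrite oppr_lt0 lt_neqAle eq_sym E n0.
Qed.

(* For these orders, the degree of a pointed element is its greatest exponent. *)
Definition npos t o := forall k, o (- bc t k).

Lemma ord_npos t r : (forall k, k \in r) -> npos t (ord t r).
Proof.
move=> rF k; rewrite -Bz_delta; apply: ord_Bz => // [l|]; first by rewrite mxE; case: (_ && _).
by apply/eqP => /colP/(_ k)/eqP; rewrite !mxE !eqxx.
Qed.

Lemma ord_enum t : npos t (ord t (enum 'I_nu)).
Proof. by apply: ord_npos => k; rewrite mem_enum. Qed.

Lemma npos_Bz t o (n : 'cV[int]_nu) : npos t o -> (forall k, 0 <= n k 0) -> n != 0 -> o (- Bz t n).
Proof.
move=> oN n0; have oZ (r : nat) k : o (- (r.+1%:Z *: bc t k)).
  elim: r => [|r IH]; first by rewrite scale1r.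
  by rewrite intS scalerDl scale1r opprD; apply: lposD.
have step (s : seq 'I_nu) : o (- (\sum_(k <- s) n k 0 *: bc t k)) \/ forall k, k \in s -> n k 0 = 0.
  elim: s => [|k s IH]; first by right.
  rewrite big_cons; have [nk|nk] := eqVneq (n k 0) 0.
    rewrite nk scale0r add0r; case: IH => [|IH]; [by left|right=> l].
    by rewrite inE => /orP[/eqP ->|/IH].
  have nkS : n k 0 = (`|(n k 0)%R|%N.-1.+1)%:Z by move: (n0 k) nk; lia.
  left; rewrite opprD nkS; case: IH => [|IH]; first exact: lposD.
  rewrite [X in o (_ - X)]big_seq big1 ?subr0 // => l /IH ->; exact: scale0r.
rewrite Bz_bc; case: (step (index_enum _)) => [//|H].
by case/eqP; apply/colP => k; rewrite mxE H // mem_index_enum.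
Qed.

(** An order that inspects the coordinate [k] first detects a negative [n k 0]. *)
Lemma ord_supp t y g h (n : 'cV[int]_nu) : (forall r, (forall k, k \in r) -> isLO (ord t r) y g) ->
  h \in supp y -> h = g + Bz t n -> forall k, 0 <= n k 0.
Proof.
move=> yL hy hE k; rewrite leNgt; apply/negP => nk.
have rF i : i \in k :: enum 'I_nu by rewrite inE mem_enum orbT.
have [_ gP] := yL _ rF; have := gP h hy; rewrite hE.
have -> : g - (g + Bz t n) = Bz t (- n) by rewrite BzN; lat.
rewrite ord_head mxE oppr_eq0 lt_eqF // oppr_lt0 ltNge (ltW nk) => H.
suff : false by []; apply: H; rewrite -subr_eq0 addrAC subrr add0r -(Bz0 t) (inj_eq (@Bz_inj _ _ t)).
by apply: contraTneq nk => ->; rewrite mxE ltxx.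
Qed.

(* Sign coherence of the columns [c] below, hence the independence of the
   leads from the order, comes from the Laurent phenomenon: were the two signs
   both possible, the two candidate leads of [X_i(t)] in the cluster of [u]
   would both be exponents of its Laurent expansion there. *)
Theorem leads t u (q : mpath t u) : exists G : lattice -> lattice,
  [/\ isom t u G,
      forall o, npos t o -> isv_monos o q G
    & forall m, (forall k, G m (ix k) 0 <= 0) -> trop q (G m) = m].
Proof.
elim/mpath_snoc_ind: u / q => [|u q l [G [iG Gv Gt]]].
  exists id; split=> // [|o oN m]; first exact: isom_id.
  exact/isv_em/LO_mono.
have [c cE] := isom_B iG (delta_mx l 0); rewrite Bz_delta in cE.
have lamc m : dk u l * m (ix l) 0 = \sum_k c k 0 * (dk t k * G m (ix k) 0).
  by rewrite -lam_bc -(isom_lam iG) cE lam_Bz.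
have c0 : c != 0.
  by have := isom_B_neq0 l iG; rewrite cE; apply: contraNneq => ->; rewrite Bz0.
have coh : (forall k, 0 <= c k 0) \/ (forall k, c k 0 <= 0).
  have [[a ca]|Na] := pselect (exists a : 'I_nu, 0 < c a 0); last first.
    by right=> k; rewrite leNgt; apply/negP => ck; case: Na; exists k.
  left=> b; rewrite leNgt; apply/negP => cb.
  have rF k i : i \in k :: enum 'I_nu by rewrite inE mem_enum orbT.
  have va := isv_step l iG (Gv _ (ord_npos t (rF a))).
  have vb := isv_step l iG (Gv _ (ord_npos t (rF b))).
  have oa : ord t (a :: enum 'I_nu) (G (bc u l)) = false by rewrite cE ord_head gt_eqF // ltNge ltW.
  have ob : ord t (b :: enum 'I_nu) (G (bc u l)) = true by rewrite cE ord_head lt_eqF // cb.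
  rewrite oa /= in va; rewrite ob /= in vb.
  (* The variable at [b] is chosen because pairing its lead with the column gives the sign of
     [c b 0]. *)
  have [y yE] := laurent_phenomenon Q (mcat q (mstep l u)) (ix b).
  have y0 : y != 0.
    apply: contraTneq (mono_neq0 tor (fvec (ix b))) => y0; rewrite negbK.
    by rewrite -(em_eq0 t) yE y0 em0 qmus0.
  have GI := isom_comp iG (isom_tau true u l); have GI' := isom_comp iG (isom_tau false u l).
  have [m0 [m0y m0v m0P]] := isv_lin (isomD GI) (bij_inj (isom_bij GI)) va y0.
  have [m1 [m1y m1v m1P]] := isv_lin (isomD GI') (bij_inj (isom_bij GI')) vb y0.
  rewrite -yE in m0v m1v.
  have E0 := isv_uniq m0v (isv_em t (LO_mono _ _)).
  have E1 := isv_uniq m1v (isv_em t (LO_mono _ _)).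
  have E01 : tau false u l m1 = tau true u l m0 by apply: (bij_inj (isom_bij iG)); rewrite E0 E1.
  set x := tau true u l m0 in E0 E01.
  (* The exponents differ by [x (ix l) 0] times the column; were this negative, [m1] would have a
     greater lead than [m0] for the order inspecting [a] first, as [c a 0 > 0]. The sign obtained
     contradicts [c b 0 < 0] through [lamc]. *)
  have xl : 0 <= x (ix l) 0.
    rewrite leNgt; apply/negP => xl.
    have m10 : m1 = m0 + (x (ix l) 0) *: bc u l.
      by rewrite -(tauK false u l m1) E01 tau_diff /x tauK.
    have := m0P _ m1y; rewrite m10 tauD tauZ (tau_id true u (bc_diag u l)).
    rewrite (isomD iG) (addZ (isomD iG)) opprD addNKr -scaleNr.
    have -> : m0 + x (ix l) 0 *: bc u l != m0.
      apply: contraTneq xl => /eqP; rewrite -subr_eq0 addrAC subrr add0r => /eqP E.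
      have -> : x (ix l) 0 = 0 by apply: (@bc_mulz_inj _ _ u l); rewrite E scale0r.
      by rewrite ltxx.
    move=> /(_ isT); rewrite cE -BzZ ord_head mxE mulf_eq0 oppr_eq0 lt_eqF //= gt_eqF //.
    by rewrite pmulr_rlt0 ?oppr_gt0 // ltNge ltW.
  have := lamc x; rewrite E0 (bigD1 b) //= fvecE eqxx big1 => [|k kb].
    rewrite mulr1 addr0 => E.
    have : 0 <= dk u l * x (ix l) 0 by rewrite mulr_ge0 // ltW // dk_gt0.
    by rewrite E pmulr_lge0 ?dk_gt0 // leNgt cb.
  by rewrite fvecE (negbTE (ix_neq nf kb)) !mulr0.
have ordB o : npos t o -> o (G (bc u l)) = ~~ `[<forall k, 0 <= c k 0>].
  move=> oN; rewrite cE; case: asboolP => [cp|cp].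
    by rewrite -[Bz t c]opprK (lpos_asym (npos_Bz oN cp c0)).
  have cn : forall k, c k 0 <= 0 by case: coh.
  have := @npos_Bz t o (- c) oN; rewrite BzN opprK oppr_eq0 => -> // k.
  by rewrite mxE oppr_ge0.
set eps := `[<_>] in ordB.
exists (fun m => G (tau eps u l m)); split.
- exact: isom_comp iG (isom_tau eps u l).
- by move=> o oN; have := isv_step l iG (Gv _ oN); rewrite ordB // negbK.
(* By [lamc], the nonpositive entries of [G x] and the common sign of [c] put [x] on the side of the
   wall where [trop_mut] is the piece [eps]. *)
move=> m Gm; rewrite trop_cat Gt //=; set x := tau eps u l m in Gm *.
have S : dk u l * x (ix l) 0 = _ := lamc x.
rewrite -[RHS](tauK eps u l) -/x /eps; case: asboolP => [cp|cp].
  apply: trop_mut_le; rewrite -(pmulr_rle0 _ (dk_gt0 u l)) S; apply: sumr_le0 => k _.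
  by rewrite mulr_ge0_le0 // pmulr_rle0 // dk_gt0.
have cn : forall k, c k 0 <= 0 by case: coh.
apply: trop_mut_ge; rewrite -(pmulr_rge0 _ (dk_gt0 u l)) S; apply: sumr_ge0 => k _.
by rewrite mulr_le0 // pmulr_rle0 // dk_gt0.
Qed.

End Leads.

(** * Triangular bases *)

Section Bases.
Variables (K : qring) (nu nf : nat) (Q : qfield K nu nf).
Local Notation lattice := 'cV[int]_(nu + nf).
Local Notation ix := (lshift nf).
Local Notation tor := (tor Q).
Local Notation mono := (mono tor).
Local Notation vp := (@vp K).
Implicit Types (t u w : seed nu nf) (k l : 'I_nu) (m g h e : lattice) (a b c y z : tor).
Implicit Types (o : lorder (nu + nf)) (f : lattice -> tor) (n : 'cV[int]_nu).

Definition le t m g := exists2 n : 'cV[int]_nu, (forall k, 0 <= n k 0) & m = g + Bz t n.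

Lemma le_refl t g : le t g g.
Proof. by exists 0 => [k|]; rewrite ?mxE // Bz0 addr0. Qed.

Lemma le_trans t g m h : le t m g -> le t h m -> le t h g.
Proof.
case=> n n0 -> [n' n'0 ->]; exists (n + n') => [k|]; first by rewrite mxE addr_ge0.
by rewrite BzD addrA.
Qed.

Lemma le_add t g m h : le t m g -> le t (m + h) (g + h).
Proof. by case=> n n0 ->; exists n => //; rewrite addrAC. Qed.

Lemma le_lt t o g m : npos t o -> le t m g -> m != g -> o (g - m).
Proof.
move=> oN [n n0 ->] ne; rewrite opprD addNKr; apply: npos_Bz => //.
by apply: contraNneq ne => ->; rewrite Bz0 addr0.
Qed.

Lemma le_anti t g m : le t m g -> le t g m -> m = g.
Proof.
move=> L L'; apply/eqP/negPn/negP => ne; have N := ord_enum t.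
have := le_lt N L ne; have ne' : g != m by rewrite eq_sym.
by have := le_lt N L' ne'; rewrite -opprB => /lpos_asym; rewrite opprK => ->.
Qed.

Definition ptd o f := forall g, cf (f g) g = 1 /\ forall m, m \in supp (f g) -> m != g -> o (g - m).

Lemma LO_lin o f y g : ptd o f -> isLO o y g -> cf (lin f y) g = cf y g /\ isLO o (lin f y) g.
Proof.
move=> fP [gy gP]; have E : cf (lin f y) g = cf y g.
  rewrite cf_lin (big_fsetD1 g) //= (fP g).1 mulr1 big_seq big1 ?addr0 // => h.
  rewrite in_fsetD1 => /andP[hg hy]; rewrite (@cf_out _ _ _ (f h)) ?mulr0 //.
  apply/negP => gf; have := (fP h).2 _ gf; rewrite eq_sym => /(_ hg) p.
  by have := lpos_asym p; rewrite opprB gP.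
split=> //; split=> [|m /supp_lin[h hy mh] mg]; first by rewrite suppE E -suppE.
have [mh'|mh'] := eqVneq m h; first by rewrite mh' gP // -mh'.
have p := (fP h).2 _ mh mh'; have [<-//|hg] := eqVneq h g.
by rewrite -(subrKA h g (- m)) lposD // gP.
Qed.

Lemma lin_inj o f y z : ptd o f -> lin f y = lin f z -> y = z.
Proof.
move=> fP E; apply/eqP; rewrite -subr_eq0; apply/negPn/negP => yz.
have [g gL] := LO_ex o yz; have [E0 _] := LO_lin fP gL.
move: gL.1; rewrite suppE -E0 linB E subrr cf0 eqxx //.
Qed.

(** The greatest index violating [P] would survive in the combination, since neither the other
    violating indices nor those satisfying [P] can reach it. *)
Lemma coord_supp o f (P : lattice -> Prop) y : ptd o f ->
  (forall g m, P g -> m \in supp (f g) -> P m) ->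
  (forall m, m \in supp (lin f y) -> P m) -> forall m, m \in supp y -> P m.
Proof.
move=> fP Pf Py; pose N := [pred m : lattice | ~~ `[<P m>]].
have [y0|y0] := eqVneq (part N y) 0.
  move=> m my; apply: contrapT => Pm; have : m \in supp (part N y).
    by rewrite supp_part my andbT; apply/asboolPn.
  by rewrite y0 suppE cf0 eqxx.
have [e eL] := LO_ex o y0; have [+ _] := eL; rewrite supp_part => /andP[/asboolPn Pe ey].
case: Pe; apply: Py; rewrite suppE (part_split N y) linD cfD (LO_lin fP eL).1.
rewrite [X in _ + X]cf_out ?addr0; first by rewrite -suppE; case: eL.
apply/negP => /supp_lin[h]; rewrite supp_part /= negbK => /andP[/asboolP Ph _] eh.
by move: eL.1; rewrite supp_part => /andP[/asboolPn []]; apply: Pf eh.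
Qed.

Lemma em_lin_top t f y g : cf y g = 1 ->
  em Q t (lin f y) = em Q t (f g) + \sum_(h <- (supp y `\ g)%fset) cf y h *: em Q t (f h).
Proof.
move=> y1; have gy : g \in supp y by rewrite suppE y1 oner_neq0.
by rewrite em_lin /lin (big_fsetD1 g gy) /= y1 scale1r.
Qed.

Definition mtri y g := forall h, h != g -> mm (cf y h).

Record pbasis t f : Prop := PBasis {
  tb_one : forall g, cf (f g) g = 1;
  tb_le : forall g m, m \in supp (f g) -> le t m g
}.

(** The triangular basis in coordinates, with the normalizing power of [v] explicit. The subalgebra
    is kept only as closure under products, and the shift is left to [state]. *)
Record tbasis t f : Prop := TBasis {
  tb_pb :> pbasis t f;
  tb_bar : forall g, barT (f g) = f g;
  tb_mul : forall g h, exists y, lmul t (f g) (f h) = lin f y;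
  tb_tri : forall i g, exists y,
    lmul t (mono (fvec i)) (f g) = vp (lam t (fvec i) g) *: lin f y /\ mtri y (fvec i + g);
  tb_mono : forall m, (forall i, 0 <= m i 0) -> f m = mono m;
  tb_U : forall u (q : mpath t u) g, exists y, em Q t (f g) = qmus q (em Q u y)
}.

Section PreBasis.
Variables (t : seed nu nf) (f : lattice -> tor).
Hypothesis fB : pbasis t f.

Lemma tb_ptd o : npos t o -> ptd o f.
Proof.
move=> oN g; split=> [|m mg ne]; first exact: tb_one fB g.
exact: le_lt oN (tb_le fB mg) ne.
Qed.

Lemma tb_inj y z : lin f y = lin f z -> y = z.
Proof. exact: lin_inj (tb_ptd (ord_enum t)). Qed.

Lemma tb_coord y g : cf (lin f y) g = 1 -> (forall m, m \in supp (lin f y) -> le t m g) ->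
  cf y g = 1 /\ forall m, m \in supp y -> le t m g.
Proof.
move=> y1 yle; have fP := tb_ptd (ord_enum t).
have S : forall m, m \in supp y -> le t m g.
  by apply: (coord_supp fP) => // h m hg /(tb_le fB); apply: le_trans.
split=> //; have y0 : y != 0.
  by apply: contraTneq (oner_neq0 K) => E; rewrite -y1 E lin0 cf0 eqxx.
have [g' gL] := LO_ex (ord t (enum 'I_nu)) y0.
have [E L] := LO_lin fP gL.
have gg : g = g'.
  apply: LO_uniq L; split; first by rewrite suppE y1 oner_neq0.
  by move=> h /yle hg ne; exact: le_lt (ord_enum t) hg ne.
by move: E; rewrite -gg y1.
Qed.

Lemma top_Xmul (a g : lattice) :
  cf (lmul t (mono a) (f g)) (a + g) = vp (lam t a g) /\
  forall m, m \in supp (lmul t (mono a) (f g)) -> le t m (a + g).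
Proof.
split; first by rewrite cf_XmM addrC addKr (tb_one fB) mulr1.
move=> m /supp_mul[g1 [g2 []]]; rewrite supp_mono => /eqP -> /(tb_le fB) l ->.
by rewrite ![a + _]addrC; apply: le_add.
Qed.

Lemma tb_tri_top (a g : lattice) y : lmul t (mono a) (f g) = vp (lam t a g) *: lin f y ->
  cf y (a + g) = 1 /\ forall m, m \in supp y -> le t m (a + g).
Proof.
move=> E; have E' : lin f y = vp (- lam t a g) *: lmul t (mono a) (f g) by rewrite E vpZK.
have [z1 zle] := top_Xmul a g; apply: tb_coord; rewrite E'; first by rewrite cfZ z1 -vpD addNr vp0.
by move=> m /suppZ/zle.
Qed.

End PreBasis.

Section OneBasis.
Variables (t : seed nu nf) (f : lattice -> tor).
Hypothesis fB : tbasis t f.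

Lemma tb_barlin y : barT (lin f y) = lin f (barT y).
Proof.
elim/fm_ind: y => [|x g y IH]; first by rewrite lin0 !barT0 lin0.
by rewrite linD linZ lin1 !barTD !barTZ IH (tb_bar fB) barT_mono linD linZ lin1.
Qed.

Lemma tb_barcoef y : barT (lin f y) = lin f y -> forall g, qbar (cf y g) = cf y g.
Proof. by rewrite tb_barlin => /(tb_inj fB) E g; rewrite -barT_coef E. Qed.

Definition frozen m := forall k, m (ix k) 0 = 0.

Lemma lam_frozen_le m g h : frozen m -> le t h g -> lam t m h = lam t m g.
Proof.
move=> mF [n _ ->]; rewrite lamDr [lam t m (Bz _ _)]lamC lam_Bz big1 ?oppr0 ?addr0 // => k _.
by rewrite mF !mulr0.
Qed.

Lemma mul_frozen m g : frozen m -> lmul t (mono m) (f g) = vp (lam t m g) *: push (fun h => h + m) (f g).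
Proof.
move=> mF; apply: cf_ext => h; rewrite cf_XmM cfZ.
have -> : cf (push (fun h => h + m) (f g)) h = cf (f g) (h - m).
  by rewrite -{1}(subrK m h) cf_push //; apply: addIr.
have [L|Nh] := boolP (h - m \in supp (f g)); last by rewrite cf_out // !mulr0.
by rewrite (lam_frozen_le mF (tb_le fB L)).
Qed.

Lemma barT_push (r : lattice -> lattice) y : injective r -> bijective r -> barT y = y -> barT (push r y) = push r y.
Proof.
move=> ri [r' rK r'K] /barTP by'; apply/barTP => h.
by rewrite -(r'K h) cf_push.
Qed.

Lemma shift_bij m : bijective (fun h : lattice => h + m).
Proof. by exists (fun h => h - m) => h; rewrite ?addrK ?subrK. Qed.

(** The normalized product by a frozen variable is bar-invariant, hence so are its coordinates;
    those in [mm] vanish and one basis element is left. *)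
Lemma tb_frozen m g : frozen m -> f (g + m) = push (fun h => h + m) (f g).
Proof.
pose P m := forall g, f (g + m) = push (fun h => h + m) (f g).
move=> mF; suff : P m by apply.
apply: lat_ind => [h|m1 m2 P1 P2 h|m1 P1 h|i mi h].
- by rewrite addr0 push_id // => x; rewrite addr0.
- by rewrite addrA P2 P1 push_push; apply: eq_lin => x _; rewrite addrA.
- rewrite -{2}(subrK m1 h) P1 push_push push_id // => x; by rewrite addrK.
have iF : frozen (fvec i).
  by move=> k; rewrite fvecE; case: eqP => // ki; rewrite -ki mF in mi.
have [y [yE ytri]] := tb_tri fB i h; have [y1 yle] := tb_tri_top fB yE.
move: yE; rewrite mul_frozen // => /(congr1 (fun z => vp (- lam t (fvec i) h) *: z)).
rewrite !vpZK => E; have by' : forall g', qbar (cf y g') = cf y g'.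
  by apply: tb_barcoef; rewrite -E barT_push //; [apply: addIr|apply: shift_bij|apply: tb_bar fB h].
have yE : y = mono (fvec i + h).
  apply: cf_ext => g'; rewrite cfX; have [<-|ne] := eqVneq; first by rewrite y1.
  by apply: mm_bar (by' g'); apply: ytri; rewrite eq_sym.
by rewrite E yE lin1 addrC.
Qed.

(** Frozen entries are arbitrary: by [tb_frozen] they only translate the basis. *)
Definition ppos m := forall k, 0 <= m (ix k) 0.

Lemma tb_ppos m : ppos m -> f m = mono m.
Proof.
move=> m0; pose x : lattice := \col_i posp (m i 0).
have mx : m = x + (m - x) by rewrite addrC subrK.
have xF : frozen (m - x) by move=> k; rewrite vD vN mxE posp_pos ?m0 // subrr.
rewrite mx tb_frozen // (tb_mono fB) => [|i]; first by rewrite push_mono.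
by rewrite mxE posp_ge0.
Qed.

Lemma ppos_ind (P : lattice -> Prop) m : (forall x, frozen x -> P x) ->
  (forall x k, ppos x -> P x -> P (fvec (ix k) + x)) -> ppos m -> P m.
Proof.
move=> PF PS; suff H (s : seq 'I_nu) : forall x, ppos x -> (forall k, k \notin s -> x (ix k) 0 = 0) -> P x.
  by move=> m0; apply: (H (enum 'I_nu)) => // k; rewrite mem_enum.
elim: s => [|k s IH] x x0 xs; first by apply: PF => k; apply: xs.
have [r xr] : exists r : nat, x (ix k) 0 = r%:Z by exists `|(x (ix k) 0)%R|%N; rewrite gez0_abs.
elim: r x x0 xs xr => [|r IHr] x x0 xs xr.
  by apply: IH => // l ls; have [->|lk] := eqVneq l k; rewrite // xs // inE negb_or lk.
have E l : (x - fvec (ix k)) (ix l) 0 = x (ix l) 0 - (l == k)%:R.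
  by rewrite vD vN fvecE (inj_eq (@lshift_inj _ _)).
have -> : x = fvec (ix k) + (x - fvec (ix k)) by lat.
have x'0 : ppos (x - fvec (ix k)).
  by move=> l; rewrite E; have [->|_] := eqVneq l k; [rewrite xr; lia|rewrite subr0].
apply: PS => //; apply: IHr => //.
  move=> l ls; rewrite E xs //; have [lk|//] := eqVneq l k.
  by rewrite inE lk eqxx in ls.
by rewrite E eqxx xr; lia.
Qed.

(** Variables are multiplied one at a time. Renormalizing at the new top degree multiplies the
    coefficient at a lower degree by a nonpositive power of [v], so it stays in [mm]. *)
Lemma tb_iter (a g : lattice) : ppos a -> exists y,
  [/\ lmul t (mono a) (f g) = vp (lam t a g) *: lin f y, mtri y (a + g),
      cf y (a + g) = 1 & forall m, m \in supp y -> le t m (a + g)].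
Proof.
move=> a0; suff [y [yE yt]] : exists y, lmul t (mono a) (f g) = vp (lam t a g) *: lin f y /\ mtri y (a + g).
  by have [y1 yle] := tb_tri_top fB yE; exists y.
pose P (a : lattice) := exists y, lmul t (mono a) (f g) = vp (lam t a g) *: lin f y /\ mtri y (a + g).
rewrite -/(P a); apply: ppos_ind a0 => [m mF|{}a k a0 [y [yE yt]]]; rewrite /P.
  exists (mono (m + g)); rewrite lin1 mul_frozen // addrC tb_frozen //; split=> // h hg.
  by rewrite cfX eq_sym (negbTE hg); apply: mm0.
have [y1 yle] := tb_tri_top fB yE; set x : lattice := fvec (ix k).
have [w wP] : exists w : lattice -> tor, forall h, lmul t (mono x) (f h) = vp (lam t x h) *: lin f (w h) /\ mtri (w h) (x + h).
  by have /choice[w wP] := tb_tri fB (ix k); exists w.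
pose y' := lin (fun h => vp (lam t x (h - (a + g))) *: w h) y.
exists y'; split.
  rewrite (monoD _ t) lmulZl -lmulA yE lmulZr lmul_linr.
  rewrite (@lin_comp _ _ _ _ _ (fun h => vp (lam t x (h - (a + g))) *: w h) (lin f)); last exact: linP.
  rewrite !scalerA -!vpD -lin_scale_fun -[RHS]lin_scale_fun; apply: eq_lin => h _.
  rewrite (wP h).1 linZ !scalerA -!vpD; congr (vp _ *: _).
  by rewrite lamBr lamDr lamDl; ring.
move=> h hg; rewrite cf_lin; apply: mm_sum => h' h'y; rewrite cfZ.
have [n n0 h'E] := yle _ h'y.
have ex : lam t x (h' - (a + g)) = - (n k 0 * dk t k).
  by rewrite h'E addrC addKr lamC lam_Bz_fvec.
have [h'0|h'0] := eqVneq h' (a + g).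
  rewrite h'0 y1 mul1r subrr lam0r vp0 mul1r; have := (wP (a + g)).2 h.
  by rewrite addrA; apply.
have [hh|hh] := eqVneq h (x + h').
  rewrite hh (tb_tri_top fB (wP h').1).1 mulr1 mulrC; apply: mm_vpM; last exact: yt.
  by rewrite ex oppr_le0 mulr_ge0 // ltW // dk_gt0.
apply: mmM; first exact: yt.
by apply: mm_vpM; [rewrite ex oppr_le0 mulr_ge0 // ltW // dk_gt0|apply: (wP h').2].
Qed.

End OneBasis.

Lemma iter_lin t f (a g : lattice) (y : tor) : tbasis t f -> ppos a -> mtri y g -> cf y g = 1 ->
  (forall h, h \in supp y -> le t h g) ->
  exists y', lmul t (mono a) (lin f y) = vp (lam t a g) *: lin f y' /\ mtri y' (a + g).
Proof.
move=> fB a0 yt y1 yle.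
have [w wP] : exists w : lattice -> tor, forall h, [/\ lmul t (mono a) (f h) = vp (lam t a h) *: lin f (w h),
    mtri (w h) (a + h), cf (w h) (a + h) = 1 & forall m, m \in supp (w h) -> le t m (a + h)].
  by have /choice[w wP] := fun h => tb_iter fB h a0; exists w.
pose y' := lin (fun h => vp (lam t a (h - g)) *: w h) y.
exists y'; split.
  rewrite lmul_linr (@lin_comp _ _ _ _ _ (fun h => vp (lam t a (h - g)) *: w h) (lin f)); last exact: linP.
  rewrite -[RHS]lin_scale_fun; apply: eq_lin => h _; have [-> _ _ _] := wP h.
  by rewrite linZ !scalerA -!vpD lamBr addrC subrK.
move=> h hg; rewrite cf_lin; apply: mm_sum => h' h'y; rewrite cfZ.
have ex : lam t a (h' - g) <= 0.
  have [n n0 ->] := yle _ h'y; rewrite addrC addKr lamC lam_Bz oppr_le0 sumr_ge0 // => k _.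
  by rewrite mulr_ge0 // mulr_ge0 // ltW // dk_gt0.
have [_ wt w1 _] := wP h'; have [h'0|h'0] := eqVneq h' g.
  by rewrite h'0 y1 mul1r subrr lam0r vp0 mul1r; apply: (let: And4 _ P _ _ := wP g in P).
have [hh|hh] := eqVneq h (a + h').
  by rewrite hh w1 mulr1 mulrC; apply: mm_vpM => //; apply: yt.
apply: mmM; first exact: yt.
by apply: mm_vpM => //; apply: wt.
Qed.

Lemma top_mul t f (g h : lattice) : pbasis t f ->
  cf (lmul t (f g) (f h)) (g + h) = vp (lam t g h) /\
  forall m, m \in supp (lmul t (f g) (f h)) -> le t m (g + h).
Proof.
move=> fB; split; last first.
  move=> m /supp_mul[g1 [g2 [/(tb_le fB) L1 /(tb_le fB) L2 ->]]].
  apply: (le_trans (m := g1 + h)); first exact: le_add.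
  by rewrite ![g1 + _]addrC; apply: le_add.
have E : g + h - g = h by lat.
have gg : g \in supp (f g) by rewrite suppE (tb_one fB) oner_neq0.
rewrite cf_mul (big_fsetD1 g gg) /= E !(tb_one fB) mul1r mulr1 big_seq big1 ?addr0 // => g1.
rewrite -[_ \in _]/(g1 \in (supp (f g) `\ g)%fset) in_fsetD1 => /andP[ne g1g].
rewrite (@cf_out _ _ _ (f h)) ?mulr0 //; apply/negP => /(tb_le fB) L.
case/eqP: ne; apply: le_anti (tb_le fB g1g) _.
have := le_add (g1 - h) L; rewrite [h + (_ - _)]addrC subrK.
by have -> : g + h - g1 + (g1 - h) = g by lat.
Qed.

(* In the applications, [z g] holds the coordinates of the product of the basis
   element at [g] by a fixed element on the right, whereas the combinations [w]
   are multiplied by it without leaving [mm]. *)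
Lemma inv_tri t (s : lattice) (z : lattice -> tor) (ex : lattice -> lattice -> int) :
  (forall g h, le t h g -> ex g h <= 0) -> (forall g, ex g g = 0) ->
  (forall g h, h \in supp (z g) -> le t h (g + s)) -> (forall g, cf (z g) (g + s) = 1) ->
  (forall g, exists w : tor, [/\ cf w g = 1, mtri w g, forall h, h \in supp w -> le t h g
    & mtri (lin (fun h => vp (ex g h) *: z h) w) (g + s)]) ->
  forall g, mtri (z g) (g + s).
Proof.
move=> exN ex0 zle z1 H; suff main (N : nat) g n : (forall k, 0 <= n k 0) -> n != 0 ->
    \sum_k n k 0 <= N%:Z -> mm (cf (z g) (g + s + Bz t n)).
  move=> g h hg; have [/zle[n n0 hE]|Nh] := boolP (h \in supp (z g)); last by rewrite cf_out //; apply: mm0.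
  rewrite hE; apply: (main (absz (\sum_k n k 0))) => //; last by rewrite ler_norm.
  by apply: contraNneq hg => n00; rewrite hE n00 Bz0 addr0.
elim: N g n => [|N IH] g n n0 nn nN.
  by have := sum_col_gt0 n0 nn; rewrite ltNge nN.
have [w [w1 wt wle /(_ (g + s + Bz t n))]] := H g.
have gw : g \in supp w by rewrite suppE w1 oner_neq0.
have ne : g + s + Bz t n != g + s.
  rewrite -subr_eq0 addrAC subrr add0r -(Bz0 t) (inj_eq (@Bz_inj _ _ t)) //.
move=> /(_ ne); rewrite cf_lin (big_fsetD1 g) //= w1 mul1r ex0 vp0 scale1r.
(* The term at [g] is isolated. In the others the coefficient of [w] lies in [mm], and [z h] enters
   either at its top or at smaller height. *)
set S := \sum_(h <- _) _ => mS; rewrite -(addrK S (cf _ _)); apply: mmD => //; apply: mmN.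
apply: mm_sum => h; rewrite -[_ \in _]/(h \in (supp w `\ g)%fset) in_fsetD1 => /andP[hg hw].
have [n1 n10 hE] := wle _ hw; have hle : le t h g by exists n1.
rewrite cfZ; have [/zle[n2 n20 E]|Nh] := boolP (g + s + Bz t n \in supp (z h)); last first.
  by rewrite (cf_out Nh) !mulr0; apply: mm0.
have En : n = n1 + n2.
  apply: (@Bz_inj _ _ t); rewrite BzD; apply: (addrI (g + s)); rewrite E hE; lat.
rewrite E; have [n2E|n2E] := eqVneq n2 0.
  rewrite n2E Bz0 addr0 z1 mulr1 mulrC; apply: mm_vpM; [exact: exN|exact: wt].
apply: mmM; first exact: wt.
apply: mm_vpM; first exact: exN.
apply: IH => //; have n1n : n1 != 0 by apply: contraNneq hg => n1n; rewrite hE n1n Bz0 addr0.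
have := sum_col_gt0 n10 n1n; move: nN; rewrite En.
have -> : \sum_k (n1 + n2) k 0 = \sum_k n1 k 0 + \sum_k n2 k 0.
  by rewrite -big_split; apply: eq_bigr => k _; rewrite mxE.
by move: (\sum_k n1 k 0) (\sum_k n2 k 0) => x1 x2; lia.
Qed.

End Bases.

(** * Seeds related by an isometry matching their columns *)

Section Similarity.
Variables (K : qring) (nu nf : nat) (Q : qfield K nu nf).
Local Notation lattice := 'cV[int]_(nu + nf).
Local Notation ix := (lshift nf).
Local Notation tor := (tor Q).
Local Notation mono := (mono tor).
Local Notation vp := (@vp K).
Local Notation Kel := (Kel Q).
Local Notation xp := (xp Q).
Implicit Types (t u s : seed nu nf) (k l j : 'I_nu) (m g h e : lattice) (a b c y z : tor).

Lemma scale_bc_eq0 t k (i : int) : (i *: bc t k == 0) = (i == 0).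
Proof.
apply/eqP/eqP => [E|->]; last by rewrite scale0r.
by apply: (@bc_mulz_inj _ _ t k); rewrite E scale0r.
Qed.

(* Quantum binomial coefficients, up to powers of [v]. *)
Fixpoint qb (d : int) (r : nat) (i : int) : K :=
  if r is r'.+1 then vp (i * d) * qb d r' i + vp ((i - 1 - r'%:Z) * d) * qb d r' (i - 1)
  else (i == 0)%:R.

Lemma cf_lpow_xp t k r (i : int) :
  cf (lpow t (xp t k) r) (xa t k *+ r + i *: bc t k) = qb (dk t k) r i.
Proof.
elim: r i => [|r IH] i.
  by rewrite mulr0n add0r cfX /= eq_sym scale_bc_eq0.
rewrite lpowS lmulDl cfD !cf_XmM mulrS /=.
have -> : xa t k + xa t k *+ r + i *: bc t k - xa t k = xa t k *+ r + i *: bc t k by lat.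
have -> : xa t k + xa t k *+ r + i *: bc t k - (xa t k + bc t k) = xa t k *+ r + (i - 1) *: bc t k by lat.
rewrite !IH; congr (vp _ * _ + vp _ * _).
  by rewrite mulrz_lat lamDr !lamZr lammm lam_bcr xa_k; ring.
by rewrite mulrz_lat !lamDr !lamDl !lamZr !lammm lam_bcr lam_bc xa_k; ring.
Qed.

Lemma cf_Kel t k e (i : int) : cf (Kel t k e) (e + i *: bc t k) = qb (dk t k) (krank k e) i.
Proof.
rewrite /krank; case: (lerP 0 (e (ix k) 0)) => e0.
  by rewrite Kel_ge0 // cfX /= -{1}(addr0 e) (inj_eq (addrI e)) eq_sym scale_bc_eq0.
set r := `|_|%N; rewrite (@Kel_le0 _ _ _ _ _ _ _ r); last by rewrite /r; lia.
set x := xa t k *+ r; have ek : (e - x) (ix k) 0 = 0.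
  by rewrite /x mulrz_lat !vE xa_k /r; lia.
rewrite cfZ cf_MXm; have -> : e + i *: bc t k - (e - x) = x + i *: bc t k by lat.
rewrite cf_lpow_xp lamDl lamZl lam_bc ek !mulr0 addr0.
exact: vpNK.
Qed.

Lemma cf_Kel_out t k e h : (forall i : int, h <> e + i *: bc t k) -> cf (Kel t k e) h = 0.
Proof.
move=> Nh; apply: cf_out; apply/negP; have [Ks _ _] := Kel_strand Q t k e.
by move=> /Ks[i _ hE]; apply: (Nh i).
Qed.

(** The coefficients along a strand depend only on [dk] and on the entry at the vertex, so matching
    strands suffices. *)
Lemma push_Kel t s k j e (f : lattice -> lattice) : bijective f ->
  (forall i : int, f (e + i *: bc t k) = f e + i *: bc s j) -> dk s j = dk t k ->
  f e (ix j) 0 = e (ix k) 0 -> push f (Kel t k e) = Kel s j (f e).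
Proof.
move=> fb fB dE fe; have [f' fK f'K] := fb; apply: cf_ext => h; rewrite -(f'K h).
move: (f' h) => {}h; rewrite cf_push; last exact: can_inj fK.
have [[i ->]|Nh] := pselect (exists i : int, h = e + i *: bc t k).
  by rewrite cf_Kel fB cf_Kel dE /krank fe.
rewrite !cf_Kel_out // => i; last by move=> hE; case: Nh; exists i.
by rewrite -fB => /(can_inj fK) hE; case: Nh; exists i.
Qed.

Lemma shift_Kel t k m e : m (ix k) 0 = 0 -> push (fun h => h + m) (Kel t k e) = Kel t k (e + m).
Proof.
move=> mk; apply: push_Kel => // [|i|].
- by exists (fun h => h - m) => h; rewrite ?addrK ?subrK.
- by rewrite addrAC.
by rewrite vD mk addr0.
Qed.

Lemma Xm_Kel t k m e : m (ix k) 0 = 0 -> lmul t (mono m) (Kel t k e) = vp (lam t m e) *: Kel t k (m + e).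
Proof.
move=> mk; rewrite addrC -shift_Kel //; apply: cf_ext => h; rewrite cf_XmM cfZ.
rewrite -{3}(subrK m h) cf_push; last exact: addIr.
have [[i E]|Nh] := pselect (exists i : int, h - m = e + i *: bc t k).
  by rewrite E lamDr lamZr lam_bcr mk !mulr0 ?oppr0 ?mulr0 addr0.
by rewrite cf_Kel_out ?mulr0 // => i hE; case: Nh; exists i.
Qed.

Record sim t s (sg : 'I_nu -> 'I_nu) (W : lattice -> lattice) : Prop := Sim {
  simD : forall m m', W (m + m') = W m + W m';
  sim_lam : forall m m', lam s (W m) (W m') = lam t m m';
  sim_bij : bijective W;
  sim_bc : forall k, W (bc t k) = bc s (sg k);
  sim_dk : forall k, dk s (sg k) = dk t k
}.

Section OneSim.
Variables (t s : seed nu nf) (sg : {perm 'I_nu}) (W : lattice -> lattice).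
Hypothesis tsW : sim t s sg W.

Lemma sim_ent k m : W m (ix (sg k)) 0 = m (ix k) 0.
Proof.
apply: (mulfI (dk_neq0 t k)); rewrite -{1}(sim_dk tsW) -lam_bc -(sim_bc tsW) (sim_lam tsW).
by rewrite lam_bc.
Qed.

Lemma simN m : W (- m) = - W m.
Proof. exact: (addN (simD tsW)). Qed.

Lemma simZ (x : int) m : W (x *: m) = x *: W m.
Proof. exact: (addZ (simD tsW)). Qed.

Lemma sim_inj : injective W.
Proof. exact: bij_inj (sim_bij tsW). Qed.

Lemma sim_B k l : sB s (ix (sg k)) (sg l) = sB t (ix k) l.
Proof. by rewrite -!bcE -(sim_bc tsW) sim_ent. Qed.

Lemma sim_Bz (n : 'cV[int]_nu) : W (Bz t n) = Bz s (\col_l n ((sg^-1)%g l) 0).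
Proof.
rewrite !Bz_bc add_sum; last exact: simD tsW.
rewrite [RHS](reindex_inj (@perm_inj _ sg)); apply: eq_bigr => k _.
by rewrite simZ (sim_bc tsW) mxE permK.
Qed.

Lemma sim_push_Kel k e : push W (Kel t k e) = Kel s (sg k) (W e).
Proof.
apply: push_Kel; first exact: sim_bij tsW.
- by move=> i; rewrite (simD tsW) simZ (sim_bc tsW).
- exact: sim_dk tsW k.
exact: sim_ent.
Qed.

Lemma push_lmul y z : push W (lmul t y z) = lmul s (push W y) (push W z).
Proof.
rewrite /lmul push_lin lin_push; apply: eq_lin => g _.
rewrite push_lin lin_push; apply: eq_lin => h _.
by rewrite pushZ push_mono (simD tsW) (sim_lam tsW).
Qed.

Lemma sim_le m g : le t m g -> le s (W m) (W g).
Proof.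
case=> n n0 ->; exists (\col_l n ((sg^-1)%g l) 0) => [k|]; first by rewrite mxE.
by rewrite (simD tsW) sim_Bz.
Qed.

(** Similarity persists under parallel mutations, after conjugating [W] by one linear piece. By
    [sim_tau_eq] the choice of piece is immaterial, so the conjugate intertwines the tropical
    mutations. *)
Lemma sim_tau (b : bool) k : sim (mutate k t) (mutate (sg k) s) sg
  (fun m => tau b s (sg k) (W (tau b t k m))).
Proof.
split=> [m m'|m m'||l|l].
- by rewrite !tauD (simD tsW) tauD.
- by rewrite (lam_mut b) !tauK (sim_lam tsW) -(lam_mut b).
- exact: bij_comp (inv_bij (tauK b s (sg k))) (bij_comp (sim_bij tsW) (inv_bij (tauK b t k))).
- have [->|lk] := eqVneq l k.
    by rewrite tau_bc_k simN (sim_bc tsW) tauN bc_mutate tau_id // bc_diag.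
  rewrite tau_bc // (simD tsW) simZ !(sim_bc tsW); apply: (@tau_inj _ _ b s (sg k)).
  by rewrite tauK tau_bc ?(inj_eq perm_inj) // sim_B.
by rewrite !dk_mut (sim_dk tsW).
Qed.

Lemma sim_tau_eq (b b' : bool) k m :
  tau b s (sg k) (W (tau b t k m)) = tau b' s (sg k) (W (tau b' t k m)).
Proof.
suff H x : tau false s (sg k) (W (tau false t k x)) = tau true s (sg k) (W (tau true t k x)).
  by case: b; case: b'; rewrite ?H.
rewrite !tau_diff (simD tsW) simZ (sim_bc tsW) tauD tauZ (tau_id _ _ (bc_diag _ _)).
by rewrite vD vZ bc_diag mulr0 addr0 !sim_ent tau_k scaleNr addrK.
Qed.

Lemma sim_trop k m : trop_mut (sg k) s (W m) =
  tau true s (sg k) (W (tau true t k (trop_mut k t m))).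
Proof.
case: (lerP 0 (m (ix k) 0)) => m0.
  by rewrite !trop_mut_ge ?sim_ent // (sim_tau_eq true false) tauK.
by rewrite !trop_mut_le ?sim_ent ?(ltW m0) // tauK.
Qed.

End OneSim.
End Similarity.

(** * One mutation *)

Section States.
Variables (K : qring) (nu nf : nat) (Q : qfield K nu nf).
Local Notation lattice := 'cV[int]_(nu + nf).
Local Notation ix := (lshift nf).
Local Notation tor := (tor Q).
Local Notation mono := (mono tor).
Local Notation vp := (@vp K).
Local Notation Kel := (Kel Q).
Local Notation xp := (xp Q).
Local Notation tbasis := (@tbasis K nu nf Q).
Implicit Types (t u s : seed nu nf) (k l j : 'I_nu) (m g h e x : lattice) (a b c y z : tor).
Implicit Types (o : lorder (nu + nf)) (f : lattice -> tor).

Lemma npos_bcN t o k (i : int) : npos t o -> 0 <= i -> o (i *: bc t k) = false.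
Proof.
move=> oN; rewrite le_eqVlt => /orP[/eqP <-|i0]; first by rewrite scale0r lpos0.
rewrite -[_ *: _]opprK lpos_asym // -Bz_delta -BzZ; apply: npos_Bz => // [l|].
  by rewrite !mxE; case: (_ && _); rewrite ?mulr1 ?mulr0 // ltW.
by apply/eqP => /colP/(_ k); rewrite !mxE !eqxx mulr1; lia.
Qed.

Lemma Kel_ptd t k o : npos t o -> ptd o (Kel t k).
Proof.
move=> oN g; have [Ks K0 _] := Kel_strand Q t k g; split=> // m /Ks[i _ ->] ne.
have := lposT o (x := i%:Z *: bc t k); rewrite (npos_bcN k oN) // orFb opprD addNKr; apply.
by apply: contraNneq ne => ->; rewrite addr0.
Qed.

Lemma isv_neq0 o t (X : Q t) g : isv o X g -> X != 0.
Proof.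
case=> a [b [ga [gb [aL bL E _]]]]; apply: contraTneq (em_neq0 t (LO_neq0 aL)) => X0.
by rewrite -E X0 mul0r eqxx.
Qed.

Lemma isv_LO o t y g : isv o (em Q t y) g -> isLO o y g.
Proof.
move=> v; have := isv_neq0 v; rewrite em_eq0 => /(LO_ex o)[g' gL].
by rewrite (isv_uniq v (isv_em t gL)).
Qed.

Lemma LO_ptd o f g : ptd o f -> isLO o (f g) g.
Proof. by move=> fP; split; [rewrite suppE (fP g).1 oner_neq0|apply: (fP g).2]. Qed.

(** Transport of valuations through a mutation: the condition on [o (bc t k)] says that
    [tau eps t k] gives the leads of the monomials for [o]. *)
Lemma isv_qmu (eps : bool) t k o o' (X : Q (mutate k t)) g :
  (forall x, o' x = o (tau eps t k x)) -> o (bc t k) = ~~ eps -> isv o' X g ->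
  isv o (qmu Q k t X) (tau eps t k g).
Proof.
move=> o'E oB.
have V : isv_monos Q o (mstep k t) (tau eps t k).
  have := @isv_step _ _ _ Q o t t (mnil t) k id (isom_id t); rewrite oB negbK; apply.
  by move=> m; apply/isv_em/LO_mono.
have one y h : isLO o' y h -> isv o (qmu Q k t (em Q _ y)) (tau eps t k h).
  move=> yL; have [m0 [m0y + m0P]] := isv_lin (tauD eps t k) (@tau_inj _ _ eps t k) V (LO_neq0 yL).
  suff -> : h = m0 by [].
  by apply: LO_uniq yL _; split=> // m my mm0; rewrite o'E tauB; apply: m0P.
case=> a [b [ga [gb [aL bL E ->]]]].
have E' : qmu Q k t X = qmu Q k t (em Q _ a) * (qmu Q k t (em Q _ b))^-1.
  rewrite -E rmorphM mulrK // qF_unit // -(rmorph0 (qmu Q k t)) (inj_eq (@qmu_inj _ _ _ Q k t)).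
  exact: em_neq0 (LO_neq0 bL).
by rewrite E' tauB; apply: isv_mul; [apply: one|apply/isv_inv/one].
Qed.

Lemma ord_false t r r2 (n : 'cV[int]_nu) : (forall k, k \in r -> 0 <= n k 0) ->
  (exists2 k, k \in r & n k 0 != 0) -> ord t (r ++ r2) (Bz t n) = false.
Proof.
elim: r => [|i r IH] n0 [k kr nk] //; rewrite -[_ ++ _]/(i :: (r ++ r2)) ord_head.
case: eqP => [ni|/eqP ni]; last by rewrite ltNge n0 ?mem_head.
apply: IH => [l lr|]; first by apply: n0; rewrite inE lr orbT.
by exists k => //; move: kr; rewrite inE => /orP[/eqP ki|//]; rewrite ki ni eqxx in nk.
Qed.

(** All strands with entry [- r] at [k] have full length [r]. In the [Kel]-expansion of the
    difference, the member starting farthest along the strand starts beyond [e], so its far end lies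
    outside the allowed segment. *)
Lemma Kel_uniq t k e (r : nat) y : e (ix k) 0 = - r%:Z ->
  (forall m, m \in supp y -> strand t k e r m) -> cf y e = 1 -> inV t k y -> y = Kel t k e.
Proof.
move=> er ys y1 Vy; apply/eqP; rewrite -subr_eq0; apply/negPn/negP => d0.
have Vd := inVB Vy (inV_Kel Q t k e); set d := y - _ in d0 Vd.
have [w /span_Kel[kap dE]] := Vd; have N := ord_enum t; set o := ord t _ in N.
have rk g : g (ix k) 0 = - r%:Z -> krank k g = r by rewrite /krank => ->; case: ifP; lia.
have ds m : m \in supp d -> exists2 i : int, 1 <= i <= r%:Z & m = e + i *: bc t k.
  move=> md; have [i ir mE] : strand t k e r m.
    case: (suppD md); first exact: ys.
    by rewrite suppN; have [Ks _ _] := Kel_strand Q t k e; rewrite (rk _ er) in Ks => /Ks.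
  exists i%:Z => //; rewrite lez_nat ir andbT; case: i ir mE => // _ mE.
  move: md; rewrite mE scale0r addr0 suppE cfB y1.
  by have [_ -> _] := Kel_strand Q t k e; rewrite subrr eqxx.
pose P m := exists2 i : int, 1 <= i & m = e + i *: bc t k.
have kapP : forall m, m \in supp kap -> P m.
  apply: (coord_supp (Kel_ptd k N)) => [g m [i i1 ->]|m].
    have [Ks _ _] := Kel_strand Q t k (e + i *: bc t k) => /Ks[i' _ ->].
    by exists (i + i'%:Z); [lia|lat].
  by rewrite -dE => /ds[i /andP[i1 _] ->]; exists i.
have kap0 : kap != 0 by apply: contraNneq d0 => k0; rewrite dE k0 lin0.
(* The reversed order selects the member farthest along [bc t k]. *)
have [o' o'E] := @pull_order_ex _ o -%R (@opprD _) oppr_inj.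
have [e1 e1L] := LO_ex o' kap0; have [i1 i11 e1E] := kapP _ e1L.1.
have ent (i : int) : (e + i *: bc t k) (ix k) 0 = - r%:Z by rewrite !vE bc_diag er; lia.
have : e1 + r%:Z *: bc t k \in supp d.
  rewrite suppE dE cf_lin (big_fsetD1 e1) ?e1L.1 //=.
  have [_ _ K1] := Kel_strand Q t k e1; rewrite rk in K1; last by rewrite e1E ent.
  rewrite K1 mulr1 big_seq big1 ?addr0 -?suppE ?e1L.1 // => e'.
  rewrite -[_ \in _]/(e' \in (supp kap `\ e1)%fset) in_fsetD1 => /andP[e'1 e'k].
  have [i' i'1 e'E] := kapP _ e'k; rewrite (@cf_out _ _ _ (Kel t k e')) ?mulr0 //.
  apply/negP; have [Ks _ _] := Kel_strand Q t k e'; rewrite rk in Ks; last by rewrite e'E ent.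
  case/Ks => i'' i''r; rewrite e1E e'E -!addrA -!scalerDl => /addrI/bc_mulz_inj E.
  have := e1L.2 _ e'k e'1; rewrite o'E opprB e1E e'E.
  have -> : e + i' *: bc t k - (e + i1 *: bc t k) = (i' - i1) *: bc t k by lat.
  by rewrite (npos_bcN k N) //; lia.
case/ds => i /andP[_ ir]; rewrite e1E -addrA -scalerDl => /addrI/bc_mulz_inj; lia.
Qed.

(* The induction hypothesis of the propagation along mutation sequences; [p]
   leads to the shift of [t], whose triangular basis is the image of [f] by [W]. *)
Record state t f s (p : mpath t s) (sg : {perm 'I_nu}) (W : lattice -> lattice) : Prop := State {
  st_basis : tbasis t f;
  st_sim : sim t s sg W;
  st_comp : forall g h, trop p g = W h -> qmus p (em Q s (push W (f h))) = em Q t (f g);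
  st_shift : forall g, (forall k, W g (ix k) 0 <= 0) -> trop p g = - W g
}.

Section OneState.
Variables (t s : seed nu nf) (f : lattice -> tor) (p : mpath t s) (sg : {perm 'I_nu}).
Variables (W Wi : lattice -> lattice).
Hypothesis stP : state f p sg W.
Hypotheses (WK : cancel W Wi) (WiK : cancel Wi W).

Let fB := st_basis stP.
Let tsW := st_sim stP.
(* The degree at [t] of the cluster monomial of exponent [m] of [s]. *)
Definition Ef m := - Wi m.

Lemma WiD m m' : Wi (m + m') = Wi m + Wi m'.
Proof. by apply: (can_inj WK); rewrite (simD tsW) !WiK. Qed.

Lemma Wi_ent m k : Wi m (ix k) 0 = m (ix (sg k)) 0.
Proof. by rewrite -(sim_ent tsW) WiK. Qed.

Lemma Ef_ent m k : Ef m (ix k) 0 = - m (ix (sg k)) 0.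
Proof. by rewrite vN Wi_ent. Qed.

Lemma EfD m m' : Ef (m + m') = Ef m + Ef m'.
Proof. by rewrite /Ef WiD opprD. Qed.

Lemma W_Ef m : W (Ef m) = - m.
Proof. by rewrite /Ef (simN tsW) WiK. Qed.

Lemma Ef_lam m m' : lam t (Ef m) (Ef m') = lam s m m'.
Proof. by rewrite lamNl lamNr opprK -(sim_lam tsW) !WiK. Qed.

Lemma Ef_bc k : Ef (bc s (sg k)) = - bc t k.
Proof. by rewrite /Ef -(sim_bc tsW) WK. Qed.

Lemma Ef_Bz (n : 'cV[int]_nu) : Ef (Bz s n) = - Bz t (\col_k n (sg k) 0).
Proof.
rewrite /Ef; congr (- _); apply: (can_inj WK); rewrite WiK (sim_Bz tsW); congr Bz.
by apply/colP => k; rewrite !mxE permKV.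
Qed.

Lemma Ef_bij : bijective Ef.
Proof.
by exists (fun m => W (- m)) => m; rewrite /Ef ?opprK ?WiK // WK opprK.
Qed.

Lemma trop_Ef m : ppos m -> trop p (Ef m) = m.
Proof.
move=> m0; rewrite (st_shift stP) ?W_Ef ?opprK // => k.
by rewrite vN oppr_le0.
Qed.

Lemma push_W_mono m : ppos m -> push W (f (Wi m)) = mono m.
Proof. by move=> m0; rewrite (tb_ppos fB) ?push_mono ?WiK // => k; rewrite Wi_ent. Qed.

Lemma st_mono m : ppos m -> qmus p (em Q s (mono m)) = em Q t (f (Ef m)).
Proof.
by move=> m0; rewrite -push_W_mono // (st_comp stP (g := Ef m)) // trop_Ef // WiK.
Qed.

Lemma add_ext (G H : lattice -> lattice) : (forall m m', G (m + m') = G m + G m') ->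
  (forall m m', H (m + m') = H m + H m') -> (forall m, ppos m -> G m = H m) -> G =1 H.
Proof.
move=> GD HD GH m; pose m1 : lattice := \col_i posp (m i 0); pose m2 : lattice := \col_i posp (- m i 0).
have mE : m = m1 - m2 by apply/colP => i; rewrite vD vN !mxE pospB.
by rewrite mE GD HD (addN GD) (addN HD) !GH // => k; rewrite mxE posp_ge0.
Qed.

(** Both maps are additive and agree on cluster monomials, which are basis elements of known
    degree. *)
Lemma isv_Ef o : npos t o -> isv_monos Q o p Ef.
Proof.
have [G [iG Gv _]] := leads Q p => oN m; rewrite -(_ : G m = Ef m); first exact: Gv.
apply: add_ext m; [exact: isomD iG|exact: EfD|move=> m m0].
by apply: isv_uniq (Gv _ oN m) _; rewrite st_mono //; exact: isv_em (LO_ptd _ (tb_ptd fB oN)).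
Qed.

Lemma mul_Ef m m' : ppos m -> ppos m' ->
  lmul t (f (Ef m)) (f (Ef m')) = vp (lam s m m') *: f (Ef (m + m')).
Proof.
move=> m0 m'0; apply: (em_inj (t := t)); rewrite emM -!st_mono // -qmusM -emM lmulX.
by rewrite emZ qmusZ st_mono ?emZ // => i; rewrite vD addr_ge0.
Qed.

(** Only left multiplication is given. Combinations $X^a f$ with [f] at the degree of a cluster
    monomial of [s] are unitriangular, and remain so after multiplication on the right, where two
    cluster monomials merge; [inv_tri] then reaches every basis element. *)
Lemma right_mul g m : ppos m -> exists y,
  [/\ lmul t (f g) (f (Ef m)) = vp (lam t g (Ef m)) *: lin f y, mtri y (g + Ef m),
      cf y (g + Ef m) = 1 & forall h, h \in supp y -> le t h (g + Ef m)].
Proof.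
move=> m0; set x := Ef m.
have xN i : x (ix i) 0 <= 0 by rewrite Ef_ent oppr_le0.
have [z zE] : exists z : lattice -> tor, forall g, lmul t (f g) (f x) = vp (lam t g x) *: lin f (z g).
  have /choice[z zE] : forall g, exists z : tor, lmul t (f g) (f x) = vp (lam t g x) *: lin f z.
    move=> h; have [y yE] := tb_mul fB h x; exists (vp (- lam t h x) *: y).
    by rewrite linZ -yE scalerA vpN scale1r.
  by exists z.
have zP h : cf (z h) (h + x) = 1 /\ forall m', m' \in supp (z h) -> le t m' (h + x).
  have [c1 cle] := top_mul h x fB.
  have E : lin f (z h) = vp (- lam t h x) *: lmul t (f h) (f x) by rewrite zE vpZK.
  apply: (tb_coord fB); rewrite E; first by rewrite cfZ c1 -vpD addNr vp0.
  by move=> m' /suppZ/cle.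
exists (z g); have [z1 zle] := zP g; split=> //.
apply: (@inv_tri _ _ _ Q t x z (fun g h => lam t (h - g) x)) => [h h' [n n0 ->]|h|h h'|h|h].
- rewrite addrC addKr lam_Bz sumr_le0 // => i _; rewrite mulr_ge0_le0 // mulr_ge0_le0 //.
  by rewrite ltW // dk_gt0.
- by rewrite subrr lam0l.
- by case: (zP h) => _; apply.
- by case: (zP h).
(* Positive and negative parts: [h = a - v], where [- v] is the degree of the cluster monomial of
   exponent [W v]. *)
pose v : lattice := \col_i posp (- h i 0); have v0 : ppos v by move=> i; rewrite mxE posp_ge0.
have Wv0 : ppos (W v) by move=> i; rewrite -(permKV sg i) (sim_ent tsW).
have EWv : Ef (W v) = - v by rewrite /Ef WK.
pose a := h + v; have a0 : ppos a.
  move=> i; rewrite vD; have -> : v (ix i) 0 = posp (- h (ix i) 0) by rewrite mxE.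
  by have := pospB (- h (ix i) 0); rewrite opprK; have := posp_ge0 (h (ix i) 0); lia.
have [w [wE wt w1 wle]] := tb_iter fB (- v) a0.
have ah : a - v = h by rewrite /a addrK.
rewrite ah in wt w1 wle; exists w; split=> //.
have x'0 : ppos (W v + m) by move=> i; rewrite vD addr_ge0.
have [u [uE ut _ _]] := tb_iter fB (Ef (W v + m)) a0.
have ax : a + Ef (W v + m) = h + x by rewrite EfD EWv addrA ah.
rewrite ax in ut; set v' := lin _ w; suff -> : v' = u by [].
apply: (tb_inj fB); rewrite /v' (@lin_comp _ _ _ _ _ _ (lin f)); last exact: linP.
rewrite [LHS](@eq_lin _ _ _ _ _ (fun h' => vp (- lam t h x) *: lmul t (f h') (f x))); last first.
  by move=> h' _; rewrite zE linZ scalerA -vpD lamBl addrC.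
rewrite lin_scale_fun -lmul_linl -[lin f w](vpZK (lam t a (- v))) -wE lmulZl -lmulA -EWv.
rewrite -/x mul_Ef // lmulZr uE !scalerA -!vpD (_ : _ + _ = 0) ?vp0 ?scale1r //.
rewrite -Ef_lam EfD -/x EWv -ah.
by rewrite !(lamDl, lamDr, lamNl, lamNr) lammm; ring.
Qed.

Section Direction.
Variable k : 'I_nu.
Let j := sg k.
Let t' := mutate k t.

Lemma st_back : exists q : mpath t' s, exists G : lattice -> lattice,
  [/\ forall X, qmu Q k t (qmus q X) = qmus p X,
      forall g, trop q g = trop p (trop_mut k t' g),
      isom t' s G, forall o, npos t' o -> isv_monos Q o q G &
      forall m, (forall k, G m (ix k) 0 <= 0) -> trop q (G m) = m].
Proof.
have [r [rK [_ rT]]] := step_back Q t k; exists (mcat r p).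
have [G [iG Gv Gt]] := leads Q (mcat r p); exists G; split=> // [X|g].
  by rewrite qmus_cat rK.
by rewrite trop_cat rT.
Qed.

(* The leads of the variables of [s] at [t'] are those at [t] moved across the
   single wall between the two chambers of orders. *)
Lemma wall_crossing (q : mpath t' s) (G : lattice -> lattice) :
  (forall X, qmu Q k t (qmus q X) = qmus p X) ->
  isom t' s G -> (forall o, npos t' o -> isv_monos Q o q G) ->
  forall m, tau false t k (G m) = Ef m + m (ix j) 0 *: bc t k.
Proof.
move=> qE iG Gv; pose D m := tau false t k (G m) - Ef m.
have DD m m' : D (m + m') = D m + D m' by rewrite /D (isomD iG) tauD EfD; lat.
have D1 m : ppos m -> exists2 r : int, 0 <= r & D m = r *: bc t k.
  (* With [k] inspected last, any nonzero coordinate of [n] away from [k] would place the exponent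
     [Ef m] above the lead; only a multiple of [bc t k] is possible. *)
  move=> m0; pose ro := [seq i <- enum 'I_nu | i != k] ++ [:: k].
  have roF i : i \in ro by have [->|ik] := eqVneq i k; rewrite mem_cat ?mem_head ?orbT // mem_filter ik mem_enum.
  have N' := ord_npos t' roF; set o' := ord t' ro in N'.
  have [o oE] := @pull_order_ex _ o' (tau false t k) (tauD false t k) (@tau_inj _ _ false t k).
  have o'E x : o' x = o (tau false t k x) by rewrite oE tauK.
  have oB : o (bc t k) = true by rewrite oE tau_id ?bc_diag // -[bc t k]opprK -bc_mutate; exact: N'.
  have v := isv_qmu o'E oB (Gv _ N' m); rewrite qE st_mono // in v.
  have [hin hP] := isv_LO v; have [n n0 hE] := tb_le fB hin.
  have Em : Ef m \in supp (f (Ef m)) by rewrite suppE (tb_one fB) oner_neq0.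
  exists (n k 0) => //; rewrite /D hE addrC addKr.
  suff nE : n = n k 0 *: delta_mx k 0 by rewrite {1}nE BzZ Bz_delta.
  apply/colP => i; rewrite !mxE andbT; have [->|ik] := eqVneq i k; first by rewrite mulr1.
  rewrite mulr0; apply/eqP/negPn/negP => ni.
  have ne : Ef m != tau false t k (G m).
    rewrite hE -subr_eq0 opprD addNKr oppr_eq0 -(Bz0 t) (inj_eq (@Bz_inj _ _ t)).
    by apply: contraNneq ni => ->; rewrite mxE.
  have := hP _ Em ne; rewrite hE addrC addKr oE.
  have [n' n'E] := tau_Bz' false t k n; rewrite n'E tauK.
  have nn' l : l != k -> n' l 0 = n l 0.
    move=> lk; apply: (mulIf (dk_neq0 t l)).
    by rewrite -{1}(dk_mut t k l) -!lam_Bz_fvec n'E -{2}(tau_fvec false t (ix_neq nf lk)) -lam_mut.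
  rewrite ord_false // => [l|]; first by rewrite mem_filter => /andP[lk _]; rewrite nn'.
  by exists i; rewrite ?nn' // mem_filter ik mem_enum.
have D2 m : exists r : int, D m = r *: bc t k.
  pose m1 : lattice := \col_i posp (m i 0); pose m2 : lattice := \col_i posp (- m i 0).
  have mE : m = m1 - m2 by apply/colP => i; rewrite vD vN !mxE pospB.
  have [r1 _ E1] : exists2 r : int, 0 <= r & D m1 = r *: bc t k by apply: D1 => i; rewrite mxE posp_ge0.
  have [r2 _ E2] : exists2 r : int, 0 <= r & D m2 = r *: bc t k by apply: D1 => i; rewrite mxE posp_ge0.
  by exists (r1 - r2); rewrite mE DD (addN DD) E1 E2 scalerBl.
have tG m r : D m = r *: bc t k -> tau false t k (G m) = Ef m + r *: bc t k.
  by move=> <-; rewrite /D addrC subrK.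
(* Both lead maps are isometries, which forces the multiple to be proportional to the entry at [j];
   it then suffices to find it at one unit vector. *)
have cross m m' (r r' : int) : D m = r *: bc t k -> D m' = r' *: bc t k ->
    r' * m (ix j) 0 = r * m' (ix j) 0.
  move=> /tG E /tG E'; have := Ef_lam m m'; rewrite -(isom_lam iG) (lam_mut false) E E'.
  rewrite !(lamDl, lamDr, lamZl, lamZr) lammm lam_bc lam_bcr !Ef_ent -/j.
  move: (lam t (Ef m) (Ef m')) (m (ix j) 0) (m' (ix j) 0) (dk_neq0 t k) => X Y Z.
  move: (dk t k) => d d0 H; apply: (mulfI d0).
  by move: H => /eqP; rewrite -subr_eq0 => /eqP H; apply/eqP; rewrite -subr_eq0 -oppr_eq0; apply/eqP; rewrite -[RHS]H; ring.
set fj : lattice := fvec (ix j); have fj1 : fj (ix j) 0 = 1 by rewrite fvecE eqxx.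
have fj0 : ppos fj by move=> i; rewrite fvecE; case: (_ == _).
have [r r0 rE] := D1 _ fj0.
suff r1 : r = 1.
  move=> m; have [r' r'E] := D2 m; have := cross _ _ _ _ rE r'E.
  by rewrite fj1 r1 mul1r mulr1 => r'm; rewrite -r'm; apply: tG.
have N := ord_enum t; have N' := ord_enum t'; set o := ord t _ in N; set o' := ord t' _ in N'.
have Dr m : D m = (r * m (ix j) 0) *: bc t k.
  by have [r' r'E] := D2 m; have := cross _ _ _ _ rE r'E; rewrite fj1 mulr1 => <-.
(* Expand the mutated variable in [s]: for [r > 1], the exponent giving its lead at [t'] would
   exceed at [t] the lead [xa t k]. *)
have rle : r <= 1.
  have [y yE] := laurent_phenomenon Q q (ix k).
  have y0 : y != 0.
    apply: contraTneq (mono_neq0 tor (fvec (ix k))) => y0; rewrite negbK.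
    by rewrite -(em_eq0 t') yE y0 em0 qmus0.
  have xpE : em Q t (xp t k) = qmus p (em Q s y) by rewrite -qE -yE qmu_eq.
  have [m1 [m1y m1v m1P]] := isv_lin EfD (bij_inj Ef_bij) (isv_Ef N) y0.
  have [m0 [m0y m0v _]] := isv_lin (isomD iG) (bij_inj (isom_bij iG)) (Gv _ N') y0.
  have E0 : G m0 = fvec (ix k).
    by apply: (isv_uniq m0v); rewrite -yE; apply/isv_em/LO_mono.
  have E1 : Ef m1 = xa t k.
    apply: (isv_uniq m1v); rewrite -xpE; apply: isv_em.
    rewrite -[xp t k]/(mono (xa t k) + mono (xa t k + bc t k)).
    apply: LO_add; [exact: LO_mono|exact: LO_mono|].
    by rewrite opprD addNKr; apply: N.
  have := tG _ _ (Dr m0); rewrite E0 tau_diff fvecE eqxx scale1r -/(xa t k) => E.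
  have m0j : m0 (ix j) 0 = 1.
    have /colP/(_ (ix k)) := E; rewrite !vD vZ bc_diag xa_k Ef_ent -/j mulr0 !addr0 => /eqP.
    by rewrite eqr_opp => /eqP.
  rewrite m0j mulr1 in E; rewrite leNgt; apply/negP => r1.
  have E' : Ef m1 - Ef m0 = (r - 1) *: bc t k.
    by rewrite E1 -(addrK (r *: bc t k) (Ef m0)) -E; lat.
  have [m01|m01] := eqVneq m0 m1.
    by move: E'; rewrite m01 subrr => /esym/eqP; rewrite scale_bc_eq0; lia.
  by have := m1P _ m0y m01; rewrite E' npos_bcN //; lia.
suff : r != 0 by lia.
(* For [r = 0] the expansion at [t'] of this basis element would contain [tau false t k (Ef fj)],
   whose lead at [t] is [Ef fj - bc t k], above the degree [Ef fj]. *)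
apply/eqP => rr0; have [y yE] := tb_U fB (mstep k t) (Ef fj).
have GE : G fj = tau false t k (Ef fj).
  by apply: (@tau_inj _ _ false t k); rewrite tauK (tG _ _ rE) rr0 scale0r addr0.
have zE : qmus q (em Q s (mono fj)) = em Q t' y.
  by apply: (@qmu_inj _ _ _ Q k t); rewrite qE st_mono // yE.
have := Gv _ N' fj; rewrite zE GE => /isv_LO yL.
have oB : o (bc t k) = false by have := npos_bcN (i := 1) k N isT; rewrite scale1r.
have V : isv_monos Q o (mstep k t) (tau true t k).
  have := @isv_step _ _ _ Q o t t (mnil t) k id (isom_id t); rewrite oB; apply.
  by move=> m; apply/isv_em/LO_mono.
have [m0 [m0y m0v m0P]] := isv_lin (tauD true t k) (@tau_inj _ _ true t k) V (LO_neq0 yL).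
have E0 : tau true t k m0 = Ef fj.
  by apply: (isv_uniq m0v); rewrite -yE; exact: isv_em (LO_ptd _ (tb_ptd fB N)).
have E1 : tau true t k (tau false t k (Ef fj)) = Ef fj - bc t k.
  rewrite tau_diff Ef_ent -/j fj1 tauD tauK tauZ tau_id ?bc_diag //; by rewrite scaleNr scale1r.
have ne : tau false t k (Ef fj) != m0.
  apply: contraNneq (bc_neq0 t k) => E; move: E1; rewrite E E0 => /eqP.
  by rewrite -subr_eq0 opprD addNKr opprK.
have := m0P _ yL.1 ne; rewrite E0 E1 opprD addNKr opprK oB //.
Qed.

Lemma push_inj : injective (push W : tor -> tor).
Proof.
move=> y z E; apply: cf_ext => h.
by rewrite -[LHS](cf_push _ _ (sim_inj tsW)) -[RHS](cf_push _ _ (sim_inj tsW)) E.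
Qed.

Lemma ppos_sg m : (forall i, 0 <= m (ix (sg i)) 0) -> ppos m.
Proof. by move=> H i; rewrite -(permKV sg i). Qed.

(** The hypotheses say that [g] is the degree at [s] of a cluster monomial of [mutate j s]. The
    image of the basis there is Laurent at that seed, and comparing dominance at [s] with leads at
    [t] confines it to one strand, where [Kel_uniq] applies. *)
Lemma cluster_wall g : g (ix j) 0 <= 0 -> ppos (trop_mut j s g) ->
  trop p (Ef g + g (ix j) 0 *: bc t k) = g /\ push W (f (Wi g)) = Kel s j g.
Proof.
move=> gj gpos; set x := Ef g + _.
have [q [G [qE qT iG Gv Gt]]] := st_back; have GE := wall_crossing qE iG Gv.
have Gx : G g = tau false t k x by rewrite /x -GE tauK.
have xk : x (ix k) 0 = - g (ix j) 0 by rewrite /x vD vZ bc_diag Ef_ent mulr0 addr0.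
have Gneg i : G g (ix i) 0 <= 0.
  rewrite Gx mxE (inj_eq (@lshift_inj _ _)) xk; case: (i =P k) => [_|/eqP ik]; first by rewrite opprK.
  rewrite /x vD vZ bcE Ef_ent.
  have := gpos (sg i); rewrite trop_mut_le // mxE (inj_eq (@lshift_inj _ _)) (inj_eq perm_inj) (negbTE ik).
  rewrite (sim_B tsW) -{2}(pospB (sB t (ix i) k)).
  move: (g _ _) (g _ _) (posp _) (posp _) => x1 x2 x3 x4; lia.
have xT : trop p x = g.
  rewrite -[RHS](Gt g Gneg) qT trop_mut_le //; congr (trop p _).
  by rewrite (tau_mutate false) Gx tauK.
split=> //; pose r := `|(g (ix j) 0)%R|%N; have gr : g (ix j) 0 = - r%:Z by rewrite /r; lia.
set y := push W _; have yE : qmus p (em Q s y) = em Q t (f x).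
  by apply: (st_comp stP); rewrite xT WiK.
apply: (Kel_uniq gr) => [m my||]; last 2 first.
- have -> : cf y g = cf y (W (Wi g)) by rewrite WiK.
  by rewrite cf_push ?(tb_one fB) //; apply: sim_inj tsW.
- have [w wE] := tb_U fB (mcat p (mstep j s)) x; exists w.
  by apply: (@qmus_inj _ _ _ Q _ _ p); rewrite yE wE qmus_cat.
have [n n0 mE] : le s m g.
  by case/supp_push: (my) => m' /(tb_le fB)/(sim_le tsW); rewrite WiK => L ->.
have y0 : y != 0 by apply: contraTneq my => ->; rewrite suppE cf0 eqxx.
pose n' : 'cV[int]_nu := \col_i n (sg i) 0 + (g (ix j) 0) *: delta_mx k 0.
have xE : x - Ef m = Bz t n'.
  by rewrite mE EfD Ef_Bz /x /n' BzD BzZ Bz_delta; lat.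
(* The lead at [t] bounds each coordinate from above, one order per coordinate; with [n0] this
   leaves only the coordinate at [j], of size at most [r]. *)
have n'le i : n' i 0 <= 0.
  have rF l : l \in i :: enum 'I_nu by rewrite inE mem_enum orbT.
  have N := ord_npos t rF; set o := ord t _ in N.
  have [m0 [m0y m0v m0P]] := isv_lin EfD (bij_inj Ef_bij) (isv_Ef N) y0.
  have E0 : Ef m0 = x by apply: (isv_uniq m0v); rewrite yE; exact: isv_em (LO_ptd _ (tb_ptd fB N)).
  have [mm0|mm0] := eqVneq m m0.
    move: xE; rewrite mm0 E0 subrr -(Bz0 t) => /(@Bz_inj _ _ t) <-; by rewrite mxE.
  have := m0P _ my mm0; rewrite E0 xE /o ord_head; case: eqP => [-> //|_]; exact: ltW.
have nE : n = n j 0 *: delta_mx j 0.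
  apply/colP => i; rewrite !mxE andbT; have [->|ij] := eqVneq i j; first by rewrite mulr1.
  rewrite mulr0; apply/eqP; rewrite eq_le n0 andbT.
  have := n'le ((sg^-1)%g i); rewrite !mxE permKV andbT -(inj_eq (@perm_inj _ sg)) permKV -/j.
  by rewrite (negbTE ij) mulr0 addr0.
have njr : n j 0 <= r%:Z by have := n'le k; rewrite !mxE !eqxx mulr1 gr -/j; lia.
exists `|(n j 0)%R|%N; first by have := n0 j; lia.
by rewrite mE {1}nE BzZ Bz_delta gez0_abs.
Qed.

(** The statement at [s] is [cluster_wall]; the similarity brings it back to [t]. It shows that the
    cluster monomials of [mutate k t] belong to the basis. *)
Lemma Kel_basis e : e (ix k) 0 <= 0 -> ppos (trop_mut k t e) -> f e = Kel t k e.
Proof.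
move=> ek ep; apply: push_inj; rewrite (sim_push_Kel _ tsW).
have We : W e (ix j) 0 <= 0 by rewrite (sim_ent tsW).
have Wp : ppos (trop_mut j s (W e)).
  rewrite (sim_trop tsW); apply: ppos_sg => i; rewrite (sim_ent (sim_tau tsW true k)).
  exact: ep.
by have [_ <-] := cluster_wall We Wp; rewrite WK.
Qed.

Lemma xp_basis : f (xa t k) = xp t k.
Proof.
have xk := xa_k t k; rewrite Kel_basis ?xk // => [|i]; first by rewrite Kel_m1.
by rewrite trop_mut_le ?xk // tau_xa fvecE; case: (_ == _).
Qed.

Definition good g e := le t e g /\ le t' (trop_mut k t e) (trop_mut k t g).

Lemma good_trans g h e : good g h -> good h e -> good g e.
Proof. by case=> [L1 L2] [L3 L4]; split; [apply: le_trans L1 L3|apply: le_trans L2 L4]. Qed.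

Lemma trop_mut_inj : injective (@trop_mut nu nf k t).
Proof. exact: bij_inj (trop_mut_bij k t). Qed.

Lemma trop_coset e (n : 'cV[int]_nu) : exists n', trop_mut k t (e + Bz t n) = trop_mut k t e + Bz t' n'.
Proof.
have bcE' : bc t k = Bz t' (- delta_mx k 0) by rewrite BzN Bz_delta bc_mutate opprK.
have T g : exists i : int, trop_mut k t g = tau true t k g + i *: bc t k.
  rewrite trop_mutE; case: ltP => _; first by exists 0; rewrite scale0r addr0.
  by exists (g (ix k) 0); rewrite tau_diff.
have [i1 ->] := T (e + Bz t n); have [i2 ->] := T e.
have [n' n'E] := tau_Bz' true t k n.
exists (n' + (i1 - i2) *: - delta_mx k 0); rewrite tauD n'E tauK BzD BzZ -bcE'; lat.
Qed.

Lemma Kel_le e m : m \in supp (Kel t k e) -> le t m e.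
Proof.
have [Ks _ _] := Kel_strand Q t k e; case/Ks => i _ ->; exists (i%:Z *: delta_mx k 0); last by rewrite BzZ Bz_delta.
by move=> l; rewrite !mxE; case: (_ && _); rewrite ?mulr1 ?mulr0.
Qed.

Lemma Kel_le' e m : m \in supp (Kel t' k e) -> le t' m e.
Proof.
have [Ks _ _] := Kel_strand Q t' k e; case/Ks => i _ ->; exists (i%:Z *: delta_mx k 0); last by rewrite BzZ Bz_delta.
by move=> l; rewrite !mxE; case: (_ && _); rewrite ?mulr1 ?mulr0.
Qed.

Lemma qmu_lin_Kel y : qmu Q k t (em Q t' (lin (Kel t' k) (push (trop_mut k t) y))) = em Q t (lin (Kel t k) y).
Proof.
rewrite lin_push !em_lin (@lin_comp _ _ _ _ _ _ (qmu Q k t)); last by move=> ? ? ?; rewrite linearP.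
by apply: eq_lin => e _; rewrite qmu_Kel.
Qed.

(** At [t'] the exponents lie in one coset of the span of the columns, so leads for all orders turn
    into dominance by [ord_supp]. *)
Lemma good_of_leads g X (kap : tor) : f g = lin (Kel t k) kap -> qmu Q k t X = em Q t (f g) ->
  (forall o', npos t' o' -> isv o' X (trop_mut k t g)) -> forall e, e \in supp kap -> good g e.
Proof.
move=> kapE XE Xv e ek; have N := ord_enum t; have N' := ord_enum t'.
have L1 : forall h, h \in supp kap -> le t h g.
  apply: (coord_supp (Kel_ptd k N)) => [h m hg /Kel_le|m]; first exact: le_trans.
  by rewrite -kapE => /(tb_le fB).
split; first exact: L1.
set y := lin (Kel t' k) (push (trop_mut k t) kap).
have XE' : X = em Q t' y by apply: (@qmu_inj _ _ _ Q k t); rewrite qmu_lin_Kel XE kapE.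
have yle m : m \in supp y -> le t' m (trop_mut k t g).
  move=> my; have [n mE] : exists n, m = trop_mut k t g + Bz t' n.
    case/supp_lin: (my) => h' /supp_push[h /L1[n _ ->] ->] /Kel_le'[n2 _ ->].
    have [n1 ->] := trop_coset g n; by exists (n1 + n2); rewrite BzD addrA.
  exists n => //; apply: (@ord_supp _ _ _ Q t' y (trop_mut k t g) m n) => // r rF.
  by apply: (@isv_LO _ t'); rewrite -XE'; apply/Xv/ord_npos.
have : trop_mut k t e \in supp (push (trop_mut k t) kap) by rewrite supp_pushE //; apply: trop_mut_inj.
move: (trop_mut k t e); apply: (coord_supp (Kel_ptd k N')) => // h m hg /Kel_le'; exact: le_trans.
Qed.

Lemma Kel_coords g : exists kap : tor, f g = lin (Kel t k) kap.
Proof. by have [w wE] := tb_U fB (mstep k t) g; have := span_Kel wE. Qed.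

Lemma Kel_inj y z : lin (Kel t k) y = lin (Kel t k) z -> y = z.
Proof. exact: lin_inj (Kel_ptd k (ord_enum t)). Qed.

Lemma Kel_bar (kap : tor) g : f g = lin (Kel t k) kap -> forall e, qbar (cf kap e) = cf kap e.
Proof.
move=> kE e; rewrite -barT_coef; congr (cf _ e); apply: Kel_inj.
rewrite -kE -(tb_bar fB g) kE; elim/fm_ind: {kE} kap => [|x h y IH]; first by rewrite barT0 lin0 barT0.
by rewrite barTD barTZ barT_mono !linD !linZ lin1 barTD barTZ IH barT_Kel.
Qed.

(* The combination is [X^a f_y] with [a_k = 0] and [f_y] a cluster monomial of [s]
   or of its mutation in direction [j]. *)
Lemma two_sided g : exists w beta : tor,
  [/\ mtri w g /\ cf w g = 1, forall h, h \in supp w -> le t h g,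
      lin f w = lin (Kel t k) beta, forall e, e \in supp beta -> good g e
    & g (ix k) 0 <= 0 -> exists a m : lattice, [/\ a (ix k) 0 = 0, ppos a, ppos m, g = a + Ef m
      & lmul t (mono a) (f (Ef m)) = vp (lam t a (Ef m)) *: lin f w]].
Proof.
have [q [G [qE qT iG Gv Gt]]] := st_back; have GE := wall_crossing qE iG Gv.
suff [y [X [XE Xv yk ay y0]]] : exists y : lattice, exists X, [/\ qmu Q k t X = em Q t (f y),
    forall o', npos t' o' -> isv o' X (trop_mut k t y), y (ix k) 0 = g (ix k) 0, ppos (g - y)
    & g (ix k) 0 <= 0 -> exists2 m, ppos m & y = Ef m].
  have [kap kapE] := Kel_coords y; pose a := g - y.
  have kg := good_of_leads kapE XE Xv.
  have ak : a (ix k) 0 = 0 by rewrite /a vD vN yk subrr.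
  have ga : a + y = g by rewrite /a subrK.
  have [w [wE wt w1 wle]] := tb_iter fB y ay; rewrite -/a ga in wE wt w1 wle.
  exists w, (lin (fun e => vp (lam t a e - lam t a y) *: mono (a + e)) kap); split=> //.
  - rewrite -[lin f w](vpZK (lam t a y)) -wE kapE lmul_linr.
    rewrite (@lin_comp _ _ _ _ _ _ (lin (Kel t k))); last exact: linP.
    rewrite -lin_scale_fun; apply: eq_lin => e _.
    by rewrite linZ lin1 Xm_Kel // scalerA -vpD addrC.
  - move=> e /supp_lin[h hk /suppZ]; rewrite supp_mono => /eqP ->.
    have T x : trop_mut k t (a + x) = trop_mut k t x + a.
      rewrite !trop_mutE vD ak add0r tauD [tau _ t k a]tau_id //; exact: addrC.
    have [L L'] := kg _ hk; split; first by rewrite -ga ![a + _]addrC; apply: le_add.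
    by rewrite -ga !T; apply: le_add.
  by move=> /y0[m m0 yE]; exists a, m; rewrite -yE.
case: (lerP (g (ix k) 0) 0) => gk.
  (* For [g (ix k) 0 <= 0] the negative part of [g] is the degree of a cluster monomial of [s]. *)
  pose v : lattice := \col_i posp (- g i 0); have v0 : ppos v by move=> i; rewrite mxE posp_ge0.
  have Wv0 : ppos (W v) by apply: ppos_sg => i; rewrite (sim_ent tsW).
  have EWv : Ef (W v) = - v by rewrite /Ef WK.
  have vk : v (ix k) 0 = - g (ix k) 0 by rewrite mxE posp_pos ?oppr_ge0.
  exists (- v), (qmus q (em Q s (mono (W v)))); split; last by exists (W v).
  - by rewrite qE st_mono // EWv.
  - move=> o' N'; rewrite trop_mut_le ?vN ?vk ?opprK //.
    suff -> : tau true t k (- v) = G (W v) by apply: Gv.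
    apply: (@tau_inj _ _ false t k); rewrite GE EWv (sim_ent tsW) vk.
    by rewrite tau_diff tauK tau_k !vN vk opprK.
  - by rewrite vN vk opprK.
  have vi i : v (ix i) 0 = posp (- g (ix i) 0) by rewrite mxE.
  move=> i; rewrite opprK vD vi; have := pospB (- g (ix i) 0); rewrite opprK.
  by have := posp_ge0 (g (ix i) 0); lia.
(* For [g (ix k) 0 > 0] the degree must lie across the wall. The entry at [k] is imposed; the others
   are large enough for [W c] to be the degree of a cluster monomial of [mutate j s] and for [g - y]
   to be nonnegative. *)
pose c : lattice := \col_i (if i == ix k then - g (ix k) 0
  else `|g i 0| + g (ix k) 0 * `|sB t i k|).
have ck : c (ix k) 0 = - g (ix k) 0 by rewrite mxE eqxx.
have Wcj : W c (ix j) 0 = - g (ix k) 0 by rewrite (sim_ent tsW).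
have Wc0 : W c (ix j) 0 <= 0 by rewrite Wcj oppr_le0 ltW.
have Wcp : ppos (trop_mut j s (W c)).
  rewrite (sim_trop tsW); apply: ppos_sg => i; rewrite (sim_ent (sim_tau tsW true k)).
  rewrite trop_mut_le ?ck ?oppr_le0 ?(ltW gk) // mxE ck; case: eqP => ik; first by rewrite opprK ltW.
  rewrite mxE; case: eqP => // _; move: gk; move: (g (ix i) 0) (g (ix k) 0) (sB t (ix i) k) => x1 x2 x3 gk.
  have : posp (- x3) <= `|x3| by rewrite /posp; lia.
  by move: (posp _) => x4; nia.
have [yT yK] := cluster_wall Wc0 Wcp; set y := _ + _ in yT; rewrite Wcj in y yT.
have yE : y = - c - g (ix k) 0 *: bc t k by rewrite /y /Ef WK scaleNr.
have yk : y (ix k) 0 = g (ix k) 0 by rewrite yE vD !vN vZ bc_diag mulr0 ck opprK subr0.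
exists y, (qmus q (em Q s (Kel s j (W c)))); split=> //.
- by rewrite qE -yK WK; apply: (st_comp stP).
- move=> o' N'; set z := Kel s j _; have [zs z1 _] := Kel_strand Q s j (W c).
  have zin : W c \in supp z by rewrite suppE z1 oner_neq0.
  have z0 : z != 0 by apply: contraTneq zin => ->; rewrite suppE cf0 eqxx.
  have [m0 [m0z m0v m0P]] := isv_lin (isomD iG) (bij_inj (isom_bij iG)) (Gv _ N') z0.
  have GB : G (bc s j) = bc t' k.
    apply: (@tau_inj _ _ false t k); rewrite GE Ef_bc bc_diag scale0r addr0 tau_bc_k //.
  have m0E : m0 = W c.
    apply/eqP/negPn/negP => ne; have := m0P _ zin; rewrite eq_sym => /(_ ne).
    have [i _ ->] := zs _ m0z; rewrite (isomD iG) (addZ (isomD iG)) GB addrC addKr.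
    by rewrite (npos_bcN k N').
  suff -> : trop_mut k t y = G m0 by [].
  rewrite trop_mut_ge ?yk ?(ltW gk) //; apply: (@tau_inj _ _ false t k).
  by rewrite tauK m0E GE Wcj.
- move=> i; rewrite vD vN yE vD !vN vZ bcE mxE (inj_eq (@lshift_inj _ _)).
  case: eqP => [->|_]; first by rewrite sB_diag mulr0 oppr0 addr0 opprK subrr.
  by move: gk; move: (g (ix i) 0) (g (ix k) 0) (sB t (ix i) k) => x1 x2 x3 gk; nia.
Qed.

(* The failure of [good] at minimal height would be a bar-invariant coefficient
   in [mm]. *)
Lemma good_coords g (kap : tor) : f g = lin (Kel t k) kap -> forall e, e \in supp kap -> good g e.
Proof.
have [ka kaE] : exists ka : lattice -> tor, forall g, f g = lin (Kel t k) (ka g).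
  by have /choice[ka kaE] := Kel_coords; exists ka.
have [w wP] : exists w : lattice -> tor, forall g, exists beta : tor,
    [/\ mtri (w g) g /\ cf (w g) g = 1, forall h, h \in supp (w g) -> le t h g,
      lin f (w g) = lin (Kel t k) beta & forall e, e \in supp beta -> good g e].
  have /choice[w wP] : forall g, exists w : tor, exists beta : tor,
    [/\ mtri w g /\ cf w g = 1, forall h, h \in supp w -> le t h g,
      lin f w = lin (Kel t k) beta & forall e, e \in supp beta -> good g e].
    by move=> g'; have [w [beta [P1 P2 P3 P4 _]]] := two_sided g'; exists w, beta.
  by exists w.
have N := ord_enum t.
have kle g' e : e \in supp (ka g') -> le t e g'.
  move: e; apply: (coord_supp (Kel_ptd k N)) => [h m hg /Kel_le|m]; first exact: le_trans.
  by rewrite -kaE => /(tb_le fB).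
have ka1 g' : cf (ka g') g' = 1.
  have k0 : ka g' != 0.
    apply: contraTneq (oner_neq0 K) => k0; rewrite -(tb_one fB g') kaE k0 lin0 cf0 negbK //.
  have [h hL] := LO_ex (ord t (enum 'I_nu)) k0; have [E L] := LO_lin (Kel_ptd k N) hL.
  rewrite -kaE in E L; have hE := LO_uniq L (LO_ptd _ (tb_ptd fB N)).
  by rewrite hE in E; rewrite -E (tb_one fB).
suff main (n0 : nat) g' (n : 'cV[int]_nu) : (forall i, 0 <= n i 0) -> \sum_i n i 0 <= n0%:Z -> ~ good g' (g' + Bz t n) ->
    cf (ka g') (g' + Bz t n) = 0 /\ cf (w g') (g' + Bz t n) = 0.
  move=> kapE; have -> : kap = ka g by apply: Kel_inj; rewrite -kapE kaE.
  move=> e ek; apply: contrapT => bad; have [n n0 eE] := kle _ _ ek.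
  have L : \sum_i n i 0 <= (absz (\sum_i n i 0))%:Z by rewrite ler_norm.
  rewrite eE in bad; have [E _] := main _ _ _ n0 L bad.
  by move: ek; rewrite suppE eE E eqxx.
elim: n0 g' n => [|n0 IH] g' n nn nsum bad.
  case: bad; have -> : n = 0; last by rewrite Bz0 addr0; split; apply: le_refl.
  have : \sum_i n i 0 == 0 by rewrite eq_le nsum sumr_ge0.
  rewrite psumr_eq0 // => /allP n00; apply/colP => i; rewrite mxE; apply/eqP/n00/mem_index_enum.
set e := g' + Bz t n in bad *; have [beta [[wt w1] wle wE bg]] := wP g'.
have eg : e != g' by apply: contra_notN bad => /eqP ->; split; apply: le_refl.
have be : cf beta e = 0 by apply: cf_out; apply/negP => /bg.
have Ebeta : beta = lin ka (w g').
  apply: Kel_inj; rewrite -wE (@lin_comp _ _ _ _ _ _ (lin (Kel t k))); last exact: linP.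
  by apply: eq_lin => h _; rewrite kaE.
(* The top term and the term at [e] are isolated. A contribution through an intermediate [h] would,
   by induction, make both steps from [g'] to [h] and from [h] to [e] good, hence [e] good. *)
pose w' := w g' - mono g' - cf (w g') e *: mono e.
have w'E : w g' = mono g' + cf (w g') e *: mono e + w'.
  by rewrite /w' -[X in _ + X]addrA -opprD [RHS]addrC subrK.
have w'0 : cf (lin ka w') e = 0.
  rewrite cf_lin big_seq big1 // => h hw'.
  have [hg he] : h != g' /\ h != e.
    split; apply: contraTneq hw' => ->; rewrite suppE !cfB cfZ !cfX eqxx ?(negbTE eg) ?w1.
      by rewrite mulr0 subrr subr0 eqxx.
    by rewrite [g' == e]eq_sym (negbTE eg) mulr1 subr0 subrr eqxx.
  have hw : h \in supp (w g').
    move: hw'; rewrite !suppE !cfB cfZ !cfX [g' == h]eq_sym [e == h]eq_sym (negbTE hg) (negbTE he).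
    by rewrite mulr0 !subr0.
  have [ek|/cf_out ->] := boolP (e \in supp (ka h)); last by rewrite mulr0.
  have [n1 n10 hE] := wle _ hw; have [n2 n20 eE] := kle _ _ ek.
  have nE : n = n1 + n2.
    by apply: (@Bz_inj _ _ t); apply: (addrI g'); rewrite -/e eE hE BzD addrA.
  have n1n : n1 != 0 by apply: contraNneq hg => n1E; rewrite hE n1E Bz0 addr0.
  have n2n : n2 != 0 by apply: contraNneq he => n2E; rewrite eE n2E Bz0 addr0.
  have := sum_col_gt0 n10 n1n; have := sum_col_gt0 n20 n2n.
  have : \sum_i n i 0 = \sum_i n1 i 0 + \sum_i n2 i 0.
    by rewrite nE -big_split; apply: eq_bigr => i _; rewrite mxE.
  move=> SE S2 S1; case: bad; rewrite -/e; apply: (@good_trans _ h).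
    apply: contrapT => bad; rewrite hE in bad.
    have [|_ w0] := IH _ _ n10 _ bad; last by move: hw; rewrite suppE hE w0 eqxx.
    by move: SE S2 nsum; move: (\sum_i n i 0) (\sum_i n1 i 0) (\sum_i n2 i 0); lia.
  apply: contrapT => bad; rewrite eE in bad.
  have [|k0 _] := IH _ _ n20 _ bad; last by move: ek; rewrite suppE eE k0 eqxx.
  by move: SE S1 nsum; move: (\sum_i n i 0) (\sum_i n1 i 0) (\sum_i n2 i 0); lia.
clearbody w'; have E : cf (ka g') e + cf (w g') e = 0.
  rewrite -be Ebeta {2}w'E !linD linZ !lin1 !cfD cfZ ka1 mulr1 w'0 addr0 //.
have kmm : mm (cf (ka g') e).
  by rewrite (_ : cf _ _ = - cf (w g') e); [apply/mmN/wt|apply/eqP; rewrite -addr_eq0 E].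
have k0 := mm_bar kmm (Kel_bar (kaE g') e).
by move: E; rewrite k0 add0r.
Qed.

Lemma Kel_coord_top g (kap : tor) : f g = lin (Kel t k) kap -> cf kap g = 1.
Proof.
move=> kE; have N := ord_enum t; have k0 : kap != 0.
  apply: contraTneq (oner_neq0 K) => k0; rewrite -(tb_one fB g) kE k0 lin0 cf0 negbK //.
have [h hL] := LO_ex (ord t (enum 'I_nu)) k0; have [E L] := LO_lin (Kel_ptd k N) hL.
rewrite -kE in E L; have hE := LO_uniq L (LO_ptd _ (tb_ptd fB N)).
by rewrite hE in E; rewrite -E (tb_one fB).
Qed.

Local Notation T := (trop_mut k t).

Lemma trop_mutK' g : T (trop_mut k t' g) = g.
Proof. by have := trop_mutK t' k g; rewrite /t' mutateK. Qed.

Lemma trop_add (a g : lattice) : a (ix k) 0 = 0 -> T (a + g) = a + T g.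
Proof. by move=> ak; rewrite !trop_mutE vD ak add0r tauD [tau _ t k a]tau_id. Qed.

Section Mutated.
Variable f' : lattice -> tor.
Hypothesis f'E : forall g, qmu Q k t (em Q t' (f' (T g))) = em Q t (f g).
Hypothesis f'K : forall g, exists2 kap : tor, f g = lin (Kel t k) kap & f' (T g) = lin (Kel t' k) (push T kap).

Lemma transfer y : qmu Q k t (em Q t' (lin f' (push T y))) = em Q t (lin f y).
Proof.
rewrite lin_push !em_lin (@lin_comp _ _ _ _ _ _ (qmu Q k t)); last by move=> ? ? ?; rewrite linearP.
by apply: eq_lin => e _; rewrite f'E.
Qed.

Lemma qmu_em_inj y z : qmu Q k t (em Q t' y) = qmu Q k t (em Q t' z) -> y = z.
Proof. by move/(@qmu_inj _ _ _ Q k t)/(@em_inj _ _ _ Q t'). Qed.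

Lemma mutated_pbasis : pbasis t' f'.
Proof.
have N' := ord_enum t'.
have P g : cf (f' (T g)) (T g) = 1 /\ forall m, m \in supp (f' (T g)) -> le t' m (T g).
  have [kap kE ->] := f'K g; have kg := good_coords kE; have k1 := Kel_coord_top kE.
  have L : isLO (ord t' (enum 'I_nu)) (push T kap) (T g).
    split; first by rewrite supp_pushE ?suppE ?k1 ?oner_neq0 //; apply: trop_mut_inj.
    by move=> h /supp_push[e /kg[_ L] ->] ne; exact: le_lt N' L ne.
  have [-> _] := LO_lin (Kel_ptd k N') L; rewrite cf_push //; last exact: trop_mut_inj.
  split=> // m /supp_lin[h /supp_push[e /kg[_ L'] ->] /Kel_le']; exact: le_trans.
by split=> g; rewrite -(trop_mutK' g); case: (P (trop_mut k t' g)).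
Qed.

Lemma mutated_mono m : ppos m -> f' m = mono m.
Proof.
move=> m0; apply: qmu_em_inj; rewrite -{1}(trop_mutK' m) f'E.
have mk : trop_mut k t' m (ix k) 0 <= 0 by rewrite trop_mut_k oppr_le0.
rewrite Kel_basis //; last by rewrite trop_mutK'.
by rewrite -qmu_Kel trop_mutK' Kel_ge0.
Qed.

Lemma mutated_mul g h : exists y, lmul t' (f' g) (f' h) = lin f' y.
Proof.
have [y yE] := tb_mul fB (trop_mut k t' g) (trop_mut k t' h); exists (push T y).
by apply: qmu_em_inj; rewrite transfer -yE !emM rmorphM /= -!f'E !trop_mutK'.
Qed.

Lemma mutated_tri_neq i g : i != ix k -> exists y,
  lmul t' (mono (fvec i)) (f' g) = vp (lam t' (fvec i) g) *: lin f' y /\ mtri y (fvec i + g).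
Proof.
move=> ik; rewrite -(trop_mutK' g); move: (trop_mut k t' g) => {}g.
have fk : (fvec i : lattice) (ix k) 0 = 0 by rewrite fvecE eq_sym (negbTE ik).
have [y [yE yt]] := tb_tri fB i g; exists (push T y); split.
  apply: qmu_em_inj; rewrite emM rmorphM /= f'E qmu_neq // -emM yE !emZ linearZ /= transfer.
  by rewrite trop_mutE (lam_mut (g (ix k) 0 < 0)) tauK tau_fvec.
move=> h; rewrite -(trop_mutK' h) -trop_add // (inj_eq trop_mut_inj) => ne.
by rewrite cf_push; [apply: yt|apply: trop_mut_inj].
Qed.

(** Unitriangular combinations whose product by the new variable is again unitriangular, as
    [inv_tri] requires. When [g (ix k) 0 <= 0], [xp t k] moves past the monomial $X^a$ of
    [two_sided] and, being a basis element, falls under [right_mul]. *)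
Lemma xp_two_sided g : exists (w v : tor) (g2 : lattice),
  [/\ cf w g = 1, mtri w g, forall h, h \in supp w -> le t' (T h) (T g),
      lmul t (xp t k) (lin f w) = vp (lam t' (fvec (ix k)) (T g)) *: lin f v &
      mtri v g2 /\ T g2 = fvec (ix k) + T g].
Proof.
set fk : lattice := fvec (ix k); have fkk : fk (ix k) 0 = 1 by rewrite fvecE eqxx.
have f'B := mutated_pbasis; have N' := ord_enum t'.
have suppT (w : tor) (g' : lattice) : (forall m, m \in supp (lin f' (push T w)) -> le t' m (T g')) ->
    forall h, h \in supp w -> le t' (T h) (T g').
  move=> wle h hw; have : T h \in supp (push T w) by rewrite supp_pushE //; apply: trop_mut_inj.
  move: (T h); apply: (coord_supp (tb_ptd f'B N')) => // m m' L /(tb_le f'B); exact: le_trans.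
case: (lerP (g (ix k) 0) 0) => gk.
  have [w [beta [[wt w1] wle wE bg /(_ gk)[a [m [ak a0 m0 gE mE]]]]]] := two_sided g.
  set y := Ef m in gE mE; have [u [uE ut u1 ule]] := right_mul (xa t k) m0; rewrite -/y in uE ut u1 ule.
  have [v [vE vt]] := iter_lin fB a0 ut u1 ule.
  have gxk : (g + xa t k) (ix k) 0 <= 0 by rewrite vD xa_k; lia.
  exists w, v, (a + (xa t k + y)); split=> //.
  - apply: suppT => m'; have -> : lin f' (push T w) = lin (Kel t' k) (push T beta).
      by apply: qmu_em_inj; rewrite transfer wE qmu_lin_Kel.
    by case/supp_lin => h' /supp_push[e /bg[_ L] ->] /Kel_le'; apply: le_trans.
  - have -> : lin f w = vp (- lam t a y) *: lmul t (mono a) (f y) by rewrite mE vpZK.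
    have comm : lmul t (xp t k) (mono a) = vp (lam t (xa t k) a + lam t (xa t k) a) *: lmul t (mono a) (xp t k).
      have L : lam t (xa t k + bc t k) a = lam t (xa t k) a by rewrite lamDl lam_bc ak mulr0 addr0.
      rewrite lmulDl lmulDr !lmulX L ![lam t a _]lamC L scalerDr !scalerA -!vpD addrK.
      by rewrite ![a + _]addrC.
    rewrite lmulZr lmulA comm lmulZl -lmulA -xp_basis uE lmulZr vE !scalerA -!vpD; congr (vp _ *: _).
    rewrite (lam_mut true) -/fk (trop_mut_le _ gk) tauK -/(xa t k) gE lamDr lamDr.
    by rewrite [lam t a (xa t k)]lamC; ring.
  split=> //; have -> : a + (xa t k + y) = xa t k + g by rewrite gE; lat.
  rewrite trop_mut_le 1?addrC // tauD tau_xa (trop_mut_le _ gk) //; exact: addrC.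
(* For a positive entry, one variable at [k] is split off: its product by [xp t k] is a sum of two
   monomials at [t], and after normalization the second carries the factor [vp (- d)] in [mm]. *)
pose g1 := g - fk; have g1k : g1 (ix k) 0 = g (ix k) 0 - 1 by rewrite vD vN fkk.
have fk0 : ppos fk by move=> i; rewrite fvecE; case: (_ == _).
have [w [wE wt w1 wle]] := tb_iter fB g1 fk0.
have g1E : fk + g1 = g by rewrite /g1 addrC subrK.
rewrite g1E in wt w1 wle.
pose h1 := xa t k + fk; pose h2 := xa t k + bc t k + fk.
have h10 : ppos h1.
  move=> i; rewrite vD; have [->|ik] := eqVneq i k; first by rewrite xa_k fkk.
  by rewrite (xa_neq t (ix_neq nf ik)) fvecE (negbTE (ix_neq nf ik)) addr0 posp_ge0.
have h20 : ppos h2.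
  move=> i; rewrite vD; have [->|ik] := eqVneq i k; first by rewrite vD bc_diag xa_k fkk.
  by rewrite (xaB_neq t (ix_neq nf ik)) fvecE (negbTE (ix_neq nf ik)) addr0 posp_ge0.
have [u1 [u1E u1t u11 _]] := tb_iter fB g1 h10; have [u2 [u2E u2t _ _]] := tb_iter fB g1 h20.
pose d := dk t k * g (ix k) 0; have d0 : - d < 0 by rewrite oppr_lt0 mulr_gt0 // dk_gt0.
exists w, (u2 + vp (- d) *: u1), (h2 + g1); split=> //.
- apply: suppT => m; have -> : lin f' (push T w) = vp (- lam t fk g1) *: lmul t' (xp t' k) (f' (T g1)).
    apply: qmu_em_inj; rewrite transfer -[lin f w](vpZK (lam t fk g1)) -wE !emZ linearZ /= !emM rmorphM /=.
    by rewrite qmu_xp f'E.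
  move=> /suppZ; rewrite -(lpow1 t' (xp t' k)) => /supp_mul[m1 [m2 [m1x /(tb_le f'B) L2 ->]]].
  have g1k0 : 0 <= g1 (ix k) 0 by rewrite g1k; lia.
  have L1 : le t' m1 (tau false t k fk).
    have [xs _ _] := lpow_xp_strand Q t' k 1; have [i _ ->] := xs _ m1x.
    exists (i%:Z *: delta_mx k 0); first by move=> l; rewrite !mxE; case: (_ && _); rewrite ?mulr1 ?mulr0.
    by rewrite BzZ Bz_delta mulr1n xa_mutate tau_diff fkk scale1r.
  have -> : T g = tau false t k fk + T g1.
    by rewrite !trop_mut_ge ?(ltW gk) // -tauD g1E.
  apply: (le_trans (m := m1 + T g1)); first exact: le_add.
  by rewrite ![m1 + _]addrC; apply: le_add.
- have -> : lin f w = vp (- lam t fk g1) *: lmul t (mono fk) (f g1) by rewrite wE vpZK.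
  rewrite lmulZr lmulA lmulDl !lmulX lmulDl !lmulZl -/h1 -/h2 u1E u2E linD linZ !scalerDr !scalerA.
  rewrite -!vpD addrC (lam_mut false) -/fk trop_mut_ge ?(ltW gk) // tauK tau_diff fkk scale1r -/(xa t k).
  congr (vp _ *: _ + vp _ *: _).
    by rewrite /h2 /g1 !(lamDl, lamDr, lamNr) !lam_bc ?fkk !lammm; ring.
  by rewrite /h1 /g1 /d !(lamDl, lamDr, lamNr) !lam_bc ?fkk !lammm; ring.
split.
  move=> h hh; rewrite cfD cfZ; apply: mmD; first exact: u2t.
  have [->|hh1] := eqVneq h (h1 + g1); first by rewrite u11 mulr1; apply: mm_vp.
  by apply: mm_vpM; [rewrite ltW|apply: u1t].
have -> : h2 + g1 = (xa t k + bc t k) + g by rewrite /h2 /g1; lat.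
have E : tau false t k (xa t k + bc t k) = fk.
  by rewrite -[RHS](tauK false t k); congr (tau _ _ _ _); rewrite tau_diff fkk scale1r.
rewrite trop_mut_ge ?vD ?bc_diag ?xa_k; last by lia.
by rewrite tauD E trop_mut_ge // ltW.
Qed.

(** The new variable is the only one whose triangularity does not transfer from [t] by
    [trop_add]. *)
Lemma mutated_tri_eq g : exists y,
  lmul t' (mono (fvec (ix k))) (f' g) = vp (lam t' (fvec (ix k)) g) *: lin f' y /\ mtri y (fvec (ix k) + g).
Proof.
set fk : lattice := fvec (ix k); have fk0 : ppos fk by move=> i; rewrite fvecE; case: (_ == _).
have f'B := mutated_pbasis.
have [z zE] : exists z : lattice -> tor, forall g, lmul t' (mono fk) (f' g) = vp (lam t' fk g) *: lin f' (z g).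
  have /choice[z zE] : forall g, exists z : tor, lmul t' (mono fk) (f' g) = vp (lam t' fk g) *: lin f' z.
    move=> h; have [y yE] := mutated_mul fk h; exists (vp (- lam t' fk h) *: y).
    by rewrite linZ -yE scalerA vpN scale1r (mutated_mono fk0).
  by exists z.
have zP h := tb_tri_top f'B (zE h).
exists (z g); split=> //; rewrite addrC.
apply: (@inv_tri _ _ _ Q t' fk z (fun g h => lam t' fk (h - g))) => [h h' [n n0 ->]|h|h h'|h|h].
- by rewrite addrC addKr lamC lam_Bz_fvec oppr_le0 mulr_ge0 // ltW // dk_gt0.
- by rewrite subrr lam0r.
- by case: (zP h) => _ H /H; rewrite addrC.
- by case: (zP h) => H _; rewrite addrC.
rewrite -(trop_mutK' h); move: (trop_mut k t' h) => {}h.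
have [w [v [g2 [w1 wt wle wE [vt g2E]]]]] := xp_two_sided h.
have Ti := trop_mut_inj.
exists (push T w); split.
- by rewrite cf_push.
- by move=> h'; rewrite -(trop_mutK' h') (inj_eq Ti) cf_push //; apply: wt.
- by move=> h' /supp_push[e /wle L ->].
rewrite addrC -/fk -g2E; set w' := lin _ _; suff -> : w' = push T v.
  by move=> h'; rewrite -(trop_mutK' h') (inj_eq Ti) cf_push //; apply: vt.
apply: (tb_inj f'B); apply: qmu_em_inj; rewrite transfer.
have -> : lin f' w' = vp (- lam t' fk (T h)) *: lmul t' (mono fk) (lin f' (push T w)).
  rewrite /w' (@lin_comp _ _ _ _ _ _ (lin f')); last exact: linP.
  rewrite lmul_linr -lin_scale_fun; apply: eq_lin => h' _.
  by rewrite zE linZ scalerA -vpD lamBr addrC.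
by rewrite emZ linearZ /= emM rmorphM /= qmu_eq transfer -emM wE emZ scalerA -vpD addNr vp0 scale1r.
Qed.

Lemma mutated_tbasis : tbasis t' f'.
Proof.
split.
- exact: mutated_pbasis.
- move=> g; rewrite -(trop_mutK' g); have [kap kE ->] := f'K (trop_mut k t' g).
  apply: barT_lin => e; first exact: barT_Kel.
  rewrite -(trop_mutK' e) cf_push; first exact: Kel_bar kE _.
  exact: trop_mut_inj.
- exact: mutated_mul.
- move=> i g; have [->|ik] := eqVneq i (ix k); first exact: mutated_tri_eq.
  exact: mutated_tri_neq.
- by move=> m m0; apply: mutated_mono => i; apply: m0.
move=> u q g; have [y yE] := tb_U fB (mcons q) (trop_mut k t' g); exists y.
by apply: (@qmu_inj _ _ _ Q k t); rewrite -{1}(trop_mutK' g) f'E yE.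
Qed.

End Mutated.

(** The shift of [t'] is the mutation at [j] of the shift of [t], reached by going back to [t]
    first. *)
Lemma mutated_state : exists s' (p' : mpath t' s') f' W',
  state f' p' sg W' /\ forall g, qmu Q k t (em Q t' (f' (T g))) = em Q t (f g).
Proof.
have [ka kaE] : exists ka : lattice -> tor, forall g, f g = lin (Kel t k) (ka g).
  by have /choice[ka kaE] := Kel_coords; exists ka.
pose f' g := lin (Kel t' k) (push T (ka (trop_mut k t' g))).
have f'E g : qmu Q k t (em Q t' (f' (T g))) = em Q t (f g).
  by rewrite /f' trop_mutK qmu_lin_Kel -kaE.
have f'K g : exists2 kap : tor, f g = lin (Kel t k) kap & f' (T g) = lin (Kel t' k) (push T kap).
  by exists (ka g) => //; rewrite /f' trop_mutK.
have [r [rK [_ rT]]] := step_back Q t k.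
pose W' m := tau true s j (W (tau true t k m)); have simW' := sim_tau tsW true k.
have rE X : qmus r (qmu Q k t X) = X by apply: (@qmu_inj _ _ _ Q k t); rewrite rK.
exists (mutate j s), (mcat r (mcat p (mstep j s))), f', W'; split=> //; split=> //.
- exact: mutated_tbasis f'E f'K.
- move=> g h; rewrite !trop_cat rT /= -(trop_mutK' h) /W' -(sim_trop tsW).
  move: (trop_mut k t' h) => {}h /(bij_inj (trop_mut_bij j s)) E.
  rewrite !qmus_cat /= /f' trop_mutK push_lin lin_push.
  rewrite [in LHS]em_lin (@lin_comp _ _ _ _ _ _ (qmu Q j s)); last by move=> ? ? ?; rewrite linearP.
  rewrite (@eq_lin _ _ _ _ _ (fun e => em Q s (Kel s j (W e)))); last first.
    by move=> e _; rewrite (sim_push_Kel Q simW') -(sim_trop tsW) qmu_Kel.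
  rewrite -em_lin (_ : lin _ (ka h) = push W (f h)); last first.
    by rewrite kaE push_lin; apply: eq_lin => e _; rewrite (sim_push_Kel Q tsW).
  by rewrite (st_comp stP E) -f'E rE trop_mutK'.
(* [m] is the exponent of a cluster monomial of [mutate j s]; [cluster_wall] computes the degree at
   [t] of this monomial, to be matched with [g]. *)
move=> g W'g; pose m := - W' g; have m0 : ppos m by move=> i; rewrite vN oppr_ge0.
pose h := trop_mut j (mutate j s) m.
have hT : trop_mut j s h = m by have := trop_mutK (mutate j s) j m; rewrite mutateK.
have hj : h (ix j) 0 <= 0 by rewrite /h trop_mut_k oppr_le0.
have [xT _] := cluster_wall hj (eq_ind_r (fun m => ppos m) m0 hT).
set x := _ + _ in xT.
have Wx : W x = - h + h (ix j) 0 *: bc s j by rewrite /x (simD tsW) W_Ef (simZ tsW) (sim_bc tsW).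
have gx : T x = g.
  have W'i : injective W' := sim_inj simW'.
  apply: W'i; rewrite {1}/W' -(sim_trop tsW) Wx trop_mut_ge; last first.
    by rewrite !vE bc_diag mulr0 addr0 oppr_ge0.
  rewrite tauD tauN tauZ tau_diff (tau_id _ _ (bc_diag s j)) opprD addrNK -trop_mut_le // hT.
  by rewrite /m opprK.
by rewrite !trop_cat rT /= -gx trop_mutK xT hT /m gx.
Qed.

End Direction.
End OneState.
End States.

(** * The initial seed *)

Section Shifts.
Variables (K : qring) (nu nf : nat) (Q : qfield K nu nf).
Local Notation lattice := 'cV[int]_(nu + nf).
Local Notation ix := (lshift nf).
Local Notation tor := (tor Q).
Local Notation mono := (mono tor).
Local Notation vp := (@vp K).
Local Notation Kel := (Kel Q).
Local Notation tbasis := (@tbasis K nu nf Q).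
Local Notation pbasis := (@pbasis K nu nf Q).
Implicit Types (t u s w : seed nu nf) (k l j : 'I_nu) (m g h e x : lattice) (a b c y z : tor).
Implicit Types (o : lorder (nu + nf)) (f : lattice -> tor) (sg : {perm 'I_nu}).

Lemma back_path t u (q : mpath t u) : exists r : mpath u t, forall X : Q t, qmus q (qmus r X) = X.
Proof.
elim: q => [v|v k v' q [r rP]]; first by exists (mnil v).
have [r' [r'P _]] := step_back Q v k; exists (mcat r r') => X /=.
by rewrite qmus_cat rP r'P.
Qed.

Lemma qmus_frozen t u (q : mpath t u) m : frozen m -> qmus q (em Q u (mono m)) = em Q t (mono m).
Proof.
by elim: q => [//|v k v' q IH] mF /=; rewrite IH // qmu_mono0.
Qed.

Lemma fvec_lshift_ent k l : (fvec (ix k) : lattice) (ix l) 0 = (l == k)%:R.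
Proof. by rewrite fvecE (inj_eq (@lshift_inj _ _)). Qed.

Lemma cluster_laurent t u (q : mpath t u) m : ppos m -> exists y, qmus q (em Q u (mono m)) = em Q t y.
Proof.
pose P m := exists y, qmus q (em Q u (mono m)) = em Q t y; rewrite -/(P m).
apply: ppos_ind => [x xF|x k x0 [y yE]]; first by exists (mono x); apply: qmus_frozen.
have [r rP] := back_path q; have [y' y'E] := laurent_phenomenon Q r (ix k).
exists (vp (- lam u (fvec (ix k)) x) *: lmul t y' y).
by rewrite (monoD _ u) emZ qmusZ emM qmusM yE y'E rP emZ emM.
Qed.

(** The parallel sequence mutates at the images under [sg]. Expansions correspond because each step
    is described by the elements [Kel], on which the similarity is explicit. *)
Lemma path_sim t s sg (W : lattice -> lattice) u (q : mpath t u) : sim t s sg W ->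
  exists u' (q' : mpath s u') (Wu : lattice -> lattice), sim u u' sg Wu /\
  forall m z, ppos m -> qmus q (em Q u (mono m)) = em Q t z ->
    qmus q' (em Q u' (mono (Wu m))) = em Q s (push W z).
Proof.
elim: q s W => [v|v k v' q IH] s W vsW.
  exists s, (mnil s), W; split=> // m z _ /em_inj <-.
  by rewrite push_mono.
have vsW' := sim_tau vsW true k.
have [u' [q' [Wu [uW qW]]]] := IH _ _ vsW'.
exists u', (mcons q'), Wu; split=> // m z m0 /= mz.
have [z' z'E] := cluster_laurent q m0; rewrite (qW _ _ m0 z'E).
rewrite z'E in mz; have [y yE] := span_Kel (esym mz).
have -> : z' = lin (Kel (mutate k v) k) (push (trop_mut k v) y).
  by apply: (em_inj (t := mutate k v)); apply: (@qmu_inj _ _ _ Q k v); rewrite mz qmu_lin_Kel -yE.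
rewrite yE !push_lin lin_push.
have -> : lin (fun e => push (fun m => tau true s (sg k) (W (tau true v k m)))
    (Kel (mutate k v) k (trop_mut k v e))) y =
  lin (Kel (mutate (sg k) s) (sg k)) (push (trop_mut (sg k) s) (push W y)).
  rewrite !lin_push; apply: eq_lin => e _.
  by rewrite (sim_push_Kel Q vsW') -(sim_trop vsW).
rewrite qmu_lin_Kel lin_push; congr em; apply: eq_lin => e _.
by rewrite (sim_push_Kel Q vsW).
Qed.

Definition top t g y := cf y g = 1 /\ forall m, m \in supp y -> le t m g.

Lemma top_LO t o g y : npos t o -> top t g y -> isLO o y g.
Proof.
move=> oN [y1 yle]; split=> [|m my mg]; first by rewrite suppE y1 oner_neq0.
exact: le_lt oN (yle _ my) mg.
Qed.

Definition shift t s (p : mpath t s) sg := forall k, exists g y,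
  [/\ qmus p (em Q s (mono (fvec (ix (sg k))))) = em Q t y, top t g y
    & forall l, g (ix l) 0 = - (l == k)%:R].

Lemma ppos_fvec i : ppos (fvec i : lattice).
Proof. by move=> k; rewrite fvecE; case: eqP. Qed.

(** The lead map [G] fixes frozen exponents and its unfrozen entries are prescribed by the shift;
    being an isometry, it then determines the images of the columns. *)
Lemma shift_sim t s (p : mpath t s) sg : shift p sg -> exists W Wi : lattice -> lattice,
  [/\ sim t s sg W, cancel W Wi, cancel Wi W,
      forall o, npos t o -> isv_monos Q o p (fun m => - Wi m)
    & forall g, (forall k, W g (ix k) 0 <= 0) -> trop p g = - W g].
Proof.
move=> pS; have [G [iG Gv Gt]] := leads Q p; have GD := isomD iG.
have [Gi GK GiK] := isom_bij iG; have N := ord_enum t.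
have GF m : frozen m -> G m = m.
  move=> mF; apply: isv_uniq (Gv _ N m) _; rewrite qmus_frozen //.
  exact/isv_em/LO_mono.
have Gsg k l : G (fvec (ix (sg k))) (ix l) 0 = - (l == k)%:R.
  have [g [y [yE yt gE]]] := pS k; rewrite -gE; congr (fun_of_matrix _ _ _).
  by apply: isv_uniq (Gv _ N _) _; rewrite yE; apply/isv_em/(top_LO N).
have Gent m l : G m (ix l) 0 = - m (ix (sg l)) 0.
  pose P m := G m (ix l) 0 = - m (ix (sg l)) 0; suff : P m by [].
  apply: lat_ind => [|m1 m2|m1|i _]; rewrite /P.
  - by rewrite -(scale0r 0) addZ // !vZ !mul0r oppr0.
  - by rewrite GD !vD => -> ->; rewrite opprD.
  - by rewrite (addN GD) !vN => ->.
  case: (split_ordP i) => [k|k] ->.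
    rewrite -(permKV sg k) Gsg fvec_lshift_ent (inj_eq perm_inj); congr (- _%:R).
  have F : frozen (fvec (rshift nu k) : lattice).
    by move=> l'; rewrite fvecE -[_ == _]/(lshift nf l' == rshift nu k) eq_lrshift.
  by rewrite GF // !F oppr0.
have pos (x : int) k : x * dk t k = dk s (sg k) -> 0 < x.
  by move=> E; rewrite -(pmulr_lgt0 _ (dk_gt0 t k)) E dk_gt0.
have bcx k : exists2 x : int, G (bc s (sg k)) = - (x *: bc t k) & x * dk t k = dk s (sg k).
  have [c cE] := isom_B iG (delta_mx (sg k) 0); rewrite Bz_delta in cE.
  have H l : dk s (sg k) * (l == k)%:R = - (c l 0 * dk t l).
    have := isom_lam iG (bc s (sg k)) (fvec (ix (sg l))).
    rewrite cE lam_bc fvec_lshift_ent (inj_eq perm_inj) eq_sym => <-.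
    rewrite lam_Bz (bigD1 l) //= big1 ?addr0 => [|l' l'l].
      by rewrite Gsg eqxx mulrN1 mulrN.
    by rewrite Gsg (negbTE l'l) oppr0 !mulr0.
  exists (- c k 0); last by have := H k; rewrite eqxx mulr1 => ->; rewrite mulNr.
  rewrite cE Bz_bc (bigD1 k) //= big1 ?addr0 ?scaleNr ?opprK // => l lk.
  have /eqP := H l; rewrite (negbTE lk) mulr0 eq_sym oppr_eq0 mulf_eq0 (negbTE (dk_neq0 t l)) orbF.
  by move=> /eqP ->; rewrite scale0r.
(* The inverse of [G] also sends columns to integral combinations of columns, which exhibits the
   positive integer [x] as a divisor of 1. *)
have x1 k (x : int) : x * dk t k = dk s (sg k) -> x = 1.
  move=> xE; have [c cE] := isom_B' iG (delta_mx k 0); rewrite Bz_delta in cE.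
  have := lam_bc t k (G (fvec (ix (sg k)))).
  rewrite cE (isom_lam iG) lam_Bz_fvec Gent fvec_lshift_ent eqxx -xE.
  rewrite mulrA mulrN1 -[- dk t k]mulN1r => /(mulIf (dk_neq0 t k)) E.
  have x0 := pos _ _ xE; move: E; move: (c _ _) => y yx.
  have : y < 0 by rewrite -(pmulr_llt0 _ x0) yx.
  by move: x0 yx; clear; nia.
have Gbc k : G (bc s (sg k)) = - bc t k.
  by have [x -> /x1 ->] := bcx k; rewrite scale1r.
have dkE k : dk s (sg k) = dk t k by have [x _ xE] := bcx k; rewrite -xE (x1 _ _ xE) mul1r.
have GN := addN GD; have GiD m m' : Gi (m + m') = Gi m + Gi m'.
  by apply: (can_inj GK); rewrite GD !GiK.
exists (fun m => - Gi m), (fun m => - G m); split.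
- split=> [m m'|m m'||k|k].
  + by rewrite GiD opprD.
  + by rewrite lamNl lamNr opprK -(isom_lam iG) !GiK.
  + by exists (fun m => - G m) => m; rewrite ?GN ?GiK ?opprK // (addN GiD) GK opprK.
  + by rewrite -[bc t k]opprK -Gbc (addN GiD) opprK GK.
  + exact: dkE.
- by move=> m; rewrite GN GiK opprK.
- by move=> m; rewrite (addN GiD) GK opprK.
- by move=> o oN m; rewrite opprK; apply: Gv.
move=> g gW; rewrite opprK -{1}(GiK g) Gt ?GiK // => k.
by rewrite -(GiK g) Gent oppr_le0 -oppr_le0 -vN.
Qed.

(* Comparing the greatest and the least exponents of each cluster monomial in
   the other cluster, by the Laurent phenomenon in both directions. *)
Lemma lead_uniq s u w (pu : mpath s u) (pw : mpath s w) o (Gu Gw H : lattice -> lattice) :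
  (forall m m', Gu (m + m') = Gu m + Gu m') -> injective Gu -> isv_monos Q o pu Gu ->
  (forall m m', Gw (m + m') = Gw m + Gw m') -> injective Gw -> isv_monos Q o pw Gw ->
  (forall k, o (Gu (bc u k))) -> (forall m, Gu (H m) = Gw m) -> (forall m, ppos m -> ppos (H m)) ->
  forall m, ppos m -> exists x : K,
    qmus pw (em Q w (mono m)) = x *: qmus pu (em Q u (mono (H m))).
Proof.
move=> GuD Gui Guv GwD Gwi Gwv oB HE Hp m m0.
have [r rP] := back_path pu; pose c := mcat r pw; have [c' c'P] := back_path c.
have cP (X : Q w) : qmus pu (qmus c X) = qmus pw X by rewrite /c qmus_cat rP.
(* The opposite of the order pulled back along [Gu]: its leads are least exponents, and [oB] makes
   it admissible at [u]. *)
have [o' o'E] := @pull_order_ex _ o (fun m => Gu (- m)) (fun x y : lattice => etrans (congr1 Gu (opprD x y)) (GuD _ _))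
  (fun (x y : lattice) E => oppr_inj (Gui _ _ E)).
have oN : npos u o' by move=> k; rewrite o'E opprK.
have [G [iG Gv _]] := leads Q c; have Gi := bij_inj (isom_bij iG).
have [y yE] := cluster_laurent c m0; have [y' y'E] := cluster_laurent c' (Hp _ m0).
have yL : isLO o' y (G m) by apply: (@isv_LO _ _ _ Q _ u); rewrite -yE; apply: Gv.
have [h0 [h0y h0v h0P]] := isv_lin GuD Gui Guv (LO_neq0 yL).
have h0E : h0 = H m.
  by apply: Gui; rewrite HE; apply: isv_uniq h0v _; rewrite -yE cP; apply: Gwv.
have y'0 : y' != 0.
  by rewrite -(em_eq0 w) -y'E qmus_neq0 // em_eq0 mono_neq0.
have Hm : qmus c (em Q w y') = em Q u (mono (H m)) by rewrite -y'E c'P.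
have [m1 [m1y m1v _]] := isv_lin GwD Gwi Gwv y'0.
have m1E : m1 = m.
  by apply: Gwi; rewrite -[Gw m]HE; apply: isv_uniq m1v _; rewrite -cP Hm; apply: Guv.
have [m2 [m2y m2v m2P]] := isv_lin (isomD iG) Gi (Gv _ oN) y'0.
have m2E : G m2 = H m by apply: isv_uniq m2v _; rewrite Hm; apply/isv_em/LO_mono.
have GH : G m = H m.
  apply/eqP/negPn/negP => ne; have := h0P _ yL.1; rewrite h0E => /(_ ne).
  have := m2P _ m1y; rewrite m1E m2E => /(_ (contraNneq _ ne)).
  rewrite o'E opprB GuD (addN GuD) => /(_ _)/lpos_asym; rewrite opprB => -> //.
  by move=> E; rewrite -m2E E.
exists (cf y (H m)); rewrite -cP yE -qmusZ -emZ; congr (qmus pu (em Q u _)).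
apply: cf_ext => h; rewrite cfZ cfX; case: eqVneq => [<-|ne]; first by rewrite mulr1.
rewrite mulr0 cf_out //; apply/negP => hy; rewrite eq_sym in ne.
have := yL.2 _ hy; rewrite GH => /(_ ne); rewrite o'E opprB GuD (addN GuD).
have := h0P _ hy; rewrite h0E => /(_ ne)/lpos_asym; by rewrite opprB => ->.
Qed.

Lemma sum_supp1 (y : tor) x (F : lattice -> K) :
  (forall h, h \in supp y -> h != x -> F h = 0) ->
  \sum_(h <- supp y) cf y h * F h = cf y x * F x.
Proof.
move=> F0; have [xy|xy] := boolP (x \in supp y).
  rewrite (big_fsetD1 x) //= big_seq big1 ?addr0 // => h.
  rewrite -[_ \in _]/(h \in (supp y `\ x)%fset) in_fsetD1 => /andP[hx hy].
  by rewrite F0 // mulr0.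
rewrite (cf_out xy) mul0r big_seq big1 // => h hy; rewrite F0 ?mulr0 //.
by apply: contraNneq xy => <-.
Qed.

(* A coefficient that is bar-invariant and lies in [mm] vanishes; induction on
   the height of the degree below the top one. *)
Lemma triangular_uniq s f f' : pbasis s f -> pbasis s f' ->
  (forall g, barT (f g) = f g) -> (forall g, barT (f' g) = f' g) ->
  (forall g, exists y y' : tor, [/\ lin f y = lin f' y',
    mtri y g /\ top s g y & mtri y' g /\ top s g y']) ->
  f =1 f'.
Proof.
move=> fB f'B fb f'b H.
have [c cP] : exists c : lattice -> tor * tor, forall g, [/\ lin f (c g).1 = lin f' (c g).2,
    mtri (c g).1 g /\ top s g (c g).1 & mtri (c g).2 g /\ top s g (c g).2].
  suff /choice[c cP] : forall g, exists y : tor * tor, [/\ lin f y.1 = lin f' y.2,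
    mtri y.1 g /\ top s g y.1 & mtri y.2 g /\ top s g y.2] by exists c.
  by move=> g; have [y [y' P]] := H g; exists (y, y').
pose D g := f g - f' g; pose E g := (c g).1 - (c g).2.
have DE y : lin D y = lin f y - lin f' y.
  rewrite -[- lin f' y]scaleN1r -lin_scale_fun -lin_add_fun.
  by apply: eq_lin => h _; rewrite scaleN1r.
have EDE g : lin f (E g) + lin D (c g).2 = 0.
  by have [E1 _ _] := cP g; rewrite DE /E linB E1 addrA subrK subrr.
have Dle g h : h \in supp (D g) -> le s h g.
  by case/suppD; rewrite ?suppN; [move/(tb_le fB)|move/(tb_le f'B)].
have Ele g h : h \in supp (E g) -> le s h g.
  have [_ [_ [_ l1]] [_ [_ l2]]] := cP g.
  by case/suppD; rewrite ?suppN; [apply: l1|apply: l2].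
have main (N : nat) : forall g (n : 'cV[int]_nu), (forall k, 0 <= n k 0) -> \sum_k n k 0 < N%:Z ->
    cf (D g) (g + Bz s n) = 0 /\ cf (E g) (g + Bz s n) = 0.
  elim: N => [|N IH] g n n0 nN; first by move: nN; rewrite ltNge sumr_ge0.
  have less (n1 n2 : 'cV[int]_nu) : (forall k, 0 <= n2 k 0) -> n2 != 0 ->
      n = n1 + n2 -> \sum_k n1 k 0 < N%:Z.
    move=> n20 n2n En; have := sum_col_gt0 n20 n2n; move: nN; rewrite En.
    have -> : \sum_k (n1 + n2) k 0 = \sum_k n1 k 0 + \sum_k n2 k 0.
      by rewrite -big_split; apply: eq_bigr => k _; rewrite mxE.
    by move: (\sum_k n1 k 0) (\sum_k n2 k 0) => x1 x2; lia.
  have split_n h (n1 n2 : 'cV[int]_nu) : h = g + Bz s n1 -> g + Bz s n = h + Bz s n2 -> n = n1 + n2.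
    by move=> -> E'; apply: (@Bz_inj _ _ s); rewrite BzD; apply: (addrI g); rewrite E'; lat.
  (* In [EDE], every other contribution at this degree factors through an intermediate degree, where
     one factor vanishes by induction. *)
  have Sum : cf (E g) (g + Bz s n) + cf (D g) (g + Bz s n) = 0.
    have := congr1 (fun y => cf y (g + Bz s n)) (EDE g); rewrite cfD cf0 !cf_lin.
    rewrite (sum_supp1 (x := g + Bz s n)) => [|h hE hx]; last first.
      apply: cf_out; apply/negP => /(tb_le fB)[n2 n20 xE].
      have [n1 n10 hE'] := Ele _ _ hE; have n2n : n2 != 0.
        by apply: contraNneq hx => n2n; rewrite xE n2n Bz0 addr0.
      have [_] := IH g n1 n10 (less _ _ n20 n2n (split_n _ _ _ hE' xE)).
      by rewrite -hE'; apply/eqP; rewrite -suppE.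
    rewrite (tb_one fB) mulr1 (sum_supp1 (x := g)) => [|h hc hx]; last first.
      apply/eqP/negPn; rewrite -suppE; apply/negP => xD.
      have [n2 n20 xE] := Dle _ _ xD; have [_ _ [_ [_ l2]]] := cP g.
      have [n1 n10 hE'] := l2 _ hc; have n1n : n1 != 0.
        by apply: contraNneq hx => n1n; rewrite hE' n1n Bz0 addr0.
      have En : n = n2 + n1 by rewrite addrC; apply: split_n hE' xE.
      have [+ _] := IH h n2 n20 (less _ _ n10 n1n En).
      by rewrite -xE; apply/eqP; rewrite -suppE.
    by have [_ _ [_ [-> _]]] := cP g; rewrite mul1r.
  have [n00|n00] := eqVneq n 0.
    move: Sum; rewrite n00 Bz0 addr0 => Sum; have D0 : cf (D g) g = 0.
      by rewrite /D cfB (tb_one fB) (tb_one f'B) subrr.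
    by rewrite D0 addr0 in Sum.
  have ne : g + Bz s n != g.
    rewrite -subr_eq0 addrAC subrr add0r -(Bz0 s) (inj_eq (@Bz_inj _ _ s)) //.
  have D0 : cf (D g) (g + Bz s n) = 0.
    apply: mm_bar; last first.
      apply: (barTP _).1; rewrite /D -scaleN1r barTD barTZ fb f'b.
      by rewrite qbarN qbar1.
    have -> : cf (D g) (g + Bz s n) = - cf (E g) (g + Bz s n).
      by apply/eqP; rewrite -addr_eq0 addrC Sum.
    have [_ [t1 _] [t2 _]] := cP g.
    by apply: mmN; rewrite cfB; apply: mmD; [apply: t1|apply/mmN/t2].
  by rewrite D0 addr0 in Sum.
move=> g; apply/eqP; rewrite -subr_eq0 -/(D g); apply/negPn/negP => /supp_exists[h hD].
have [n n0 hE] := Dle _ _ hD.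
have [] := main (absz (\sum_k n k 0 + 1)) g n n0.
  by have : 0 <= \sum_k n k 0 by [exact: sumr_ge0]; move: (\sum_k _) => x; lia.
by move=> + _; rewrite -hE; apply/eqP; rewrite -suppE.
Qed.

Section Base.
Variables (t s : seed nu nf) (p : mpath t s) (sg : {perm 'I_nu}) (f fs : lattice -> tor).
Hypotheses (fB : tbasis t f) (fsB : tbasis s fs).
Hypothesis comp : forall g, qmus p (em Q s (fs (trop p g))) = em Q t (f g).
Hypothesis pS : shift p sg.
Variables (s2 : seed nu nf) (p2 : mpath s s2) (sg2 : {perm 'I_nu}).
Hypothesis p2S : shift p2 sg2.
Hypothesis s2M : forall m, (forall i, 0 <= m i 0) -> exists g,
  qmus p2 (em Q s2 (mono m)) = em Q s (fs g).

(** [s2M] covers nonnegative exponents only; arbitrary frozen entries are reached through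
    [tb_frozen]. *)
Lemma shift_monos (G : lattice -> lattice) :
  (forall m m', G (m + m') = G m + G m') -> (forall m m', lam s (G m) (G m') = lam s2 m m') ->
  (forall o, npos s o -> isv_monos Q o p2 G) ->
  forall m, ppos m -> qmus p2 (em Q s2 (mono m)) = em Q s (fs (G m)).
Proof.
move=> GD Gl Gv m m0; have N := ord_enum s.
pose x : lattice := \col_i posp (m i 0); pose z := m - x.
have zF : frozen z by move=> k; rewrite vD vN mxE posp_pos ?m0 // subrr.
have Gz : G z = z.
  by apply: isv_uniq (Gv _ N _) _; rewrite qmus_frozen //; exact/isv_em/LO_mono.
have xE : qmus p2 (em Q s2 (mono x)) = em Q s (fs (G x)).
  have [i|g gE] := s2M (m := x); first by rewrite mxE posp_ge0.
  rewrite gE; congr (em Q s (fs _)); apply: isv_uniq (Gv _ N x); rewrite gE.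
  exact/isv_em/(LO_ptd _ (tb_ptd fsB N)).
have -> : m = z + x by rewrite /z subrK.
rewrite (monoD _ s2) emZ qmusZ emM qmusM qmus_frozen // xE -emM mul_frozen // -emZ.
rewrite scalerA -vpD -{2}Gz Gl addNr vp0 scale1r.
by rewrite GD Gz addrC (tb_frozen fsB).
Qed.

(** The image [f1] of the basis at [t] is shown to be the basis [fs]. The two agree at nonpositive
    degrees, which are those of cluster monomials of the shift of [s]; products by monomials
    propagate the agreement. *)
Lemma base_state : exists W, state f p sg W.
Proof.
have [W [Wi [tsW WK WiK Wv Wt]]] := shift_sim pS.
have [W2 [W2i [ssW2 W2K W2iK W2v _]]] := shift_sim p2S.
(* [s1] is the shift of [s] seen from [f1], whereas [s2] is the one attached to [fs]. *)
have [s1 [p1 [W1 [ss1 p1E]]]] := path_sim p tsW.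
have [W1i W1K W1iK] := sim_bij ss1.
have iD (V Vi : lattice -> lattice) : (forall m m', V (m + m') = V m + V m') -> cancel V Vi ->
    cancel Vi V -> forall m m', Vi (m + m') = Vi m + Vi m'.
  by move=> VD VK ViK m m'; apply: (can_inj VK); rewrite VD !ViK.
have WiD := iD _ _ (simD tsW) WK WiK; have W1iD := iD _ _ (simD ss1) W1K W1iK.
have W2iD := iD _ _ (simD ssW2) W2K W2iK.
pose f1 g := push W (f (Wi g)).
have f1B : pbasis s f1.
  split=> [g|g m /supp_push[h /(tb_le fB) hg ->]].
    by rewrite -{2}(WiK g) cf_push ?(tb_one fB) //; apply: can_inj WK.
  by rewrite -(WiK g); exact: (sim_le tsW hg).
have f1b g : barT (f1 g) = f1 g.
  by apply: barT_push; [exact: can_inj WK|exact: sim_bij tsW|exact: tb_bar fB _].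
have m1E m : ppos m -> qmus p1 (em Q s1 (mono (W1 m))) = em Q s (f1 (- m)).
  move=> m0; rewrite (p1E m (f (- Wi m))) // /f1 ?(addN WiD) //.
  have Wm : W (- Wi m) = - m by rewrite (simN tsW) WiK.
  by rewrite -comp Wt ?Wm ?opprK ?(tb_ppos fsB) // => k; rewrite vN oppr_le0.
have W1ip m : ppos m -> ppos (W1i m).
  by move=> m0 k; rewrite -(sim_ent ss1) W1iK.
pose G1 m := - W1i m; have G1D m m' : G1 (m + m') = G1 m + G1 m' by rewrite /G1 W1iD opprD.
have G1v o : npos s o -> isv_monos Q o p1 G1.
  move=> oN m; have [G [iG Gv _]] := leads Q p1; have := Gv _ oN m.
  rewrite (add_ext (isomD iG) G1D) // => x x0.
  apply: isv_uniq (Gv _ oN x) _; rewrite -{1}(W1iK x) m1E; last exact: W1ip.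
  exact/isv_em/(LO_ptd _ (tb_ptd f1B oN)).
pose G2 m := - W2i m; have G2D m m' : G2 (m + m') = G2 m + G2 m' by rewrite /G2 W2iD opprD.
have G2l m m' : lam s (G2 m) (G2 m') = lam s2 m m'.
  by rewrite /G2 lamNl lamNr opprK -(sim_lam ssW2) !W2iK.
have m2E := shift_monos G2D G2l W2v.
have N := ord_enum s; pose H m := W1 (W2i m).
have G1i : injective G1 by move=> x y /oppr_inj/(can_inj W1iK).
have G2i : injective G2 by move=> x y /oppr_inj/(can_inj W2iK).
have oB k : ord s (enum 'I_nu) (G1 (bc s1 k)).
  by rewrite /G1 -(permKV sg k) -(sim_bc ss1) W1K; apply: N.
have HE m : G1 (H m) = G2 m by rewrite /G1 /H W1K.
have Hp m : ppos m -> ppos (H m).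
  by move=> m0; apply: (ppos_sg (sg := sg)) => i; rewrite (sim_ent ss1) -(sim_ent ssW2) W2iK.
(* Cluster monomials of [s1] and [s2] with equal leads are proportional, and top coefficients equal
   to 1 fix the scalar. *)
have low (y : lattice) : (forall k, y (ix k) 0 <= 0) -> fs y = f1 y.
  move=> y0; have m0 : ppos (- y) by move=> k; rewrite vN oppr_ge0.
  have W2m0 : ppos (W2 (- y)).
    by apply: (ppos_sg (sg := sg2)) => i; rewrite (sim_ent ssW2).
  have [x] := lead_uniq G1D G1i (G1v _ N) G2D G2i (W2v _ N) oB HE Hp W2m0.
  rewrite m2E // /H /G2 W2K m1E // opprK -emZ => /em_inj E.
  have := congr1 (fun z : tor => cf z y) E; rewrite cfZ (tb_one fsB) (tb_one f1B) mulr1 => x1.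
  by rewrite E -x1 scale1r.
have fsE : fs =1 f1.
  apply: triangular_uniq fsB f1B (tb_bar fsB) f1b _ => g.
  pose a : lattice := \col_i posp (g i 0); pose y : lattice := \col_i - posp (- g i 0).
  have gE : g = a + y by apply/colP => i; rewrite vD !mxE pospB.
  have a0 : ppos a by move=> k; rewrite mxE posp_ge0.
  have Wia0 : ppos (Wi a) by move=> k; rewrite -(sim_ent tsW) WiK.
  have y0 (k : 'I_nu) : y (ix k) 0 <= 0 by rewrite mxE oppr_le0 posp_ge0.
  have [c [cE ct c1 cle]] := tb_iter fsB y a0.
  have [d [dE dt d1 dle]] := tb_iter fB (Wi y) Wia0.
  have WE : W (Wi a + Wi y) = g by rewrite (simD tsW) !WiK -gE.
  exists c, (push W d); rewrite gE; split; [|by split|split; [|split]].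
  - have := congr1 (push W) dE; rewrite (push_lmul tsW) push_mono WiK -/(f1 y) -low // cE.
    rewrite pushZ -(sim_lam tsW) !WiK push_lin lin_push => /(congr1 (fun z => vp (- lam s a y) *: z)).
    rewrite !vpZK => ->; apply: eq_lin => h _; by rewrite /f1 WK.
  - move=> h hg; rewrite -(WiK h) cf_push; last exact: can_inj WK.
    by apply: dt; apply: contraNneq hg => E; rewrite -(WiK h) E WE gE.
  - by rewrite -gE -WE cf_push //; exact: can_inj WK.
  - by move=> m /supp_push[h hd ->]; rewrite -gE -WE; apply: (sim_le tsW); apply: dle.
exists W; split=> // g h E.
by rewrite -{1}(WK h) -/(f1 (W h)) -fsE -E comp.
Qed.

End Base.

End Shifts.

(** * Propagation along mutation sequences *)

Section Propagation.
Variables (K : qring) (nu nf : nat) (Q : qfield K nu nf).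
Local Notation lattice := 'cV[int]_(nu + nf).
Implicit Types (t u s : seed nu nf) (f : lattice -> tor Q) (sg : {perm 'I_nu}).

Lemma state_path t f s (p : mpath t s) sg (W : lattice -> lattice) u (q : mpath t u) :
  state f p sg W -> exists s' (p' : mpath u s') f' (W' : lattice -> lattice),
  state f' p' sg W' /\ forall g, qmus q (em Q u (f' (trop q g))) = em Q t (f g).
Proof.
elim: q f s p W => [v|v k v' q IH] f s p W fP; first by exists s, p, f, W.
have [Wi WK WiK] := sim_bij (st_sim fP).
have [s1 [p1 [f1 [W1 [f1P f1E]]]]] := mutated_state fP WK WiK k.
have [s' [p' [f' [W' [f'P f'E]]]]] := IH _ _ _ _ f1P.
by exists s', p', f', W'; split=> // g /=; rewrite f'E f1E.
Qed.

Lemma state_shift t f s (p : mpath t s) sg (W : lattice -> lattice) :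
  state f p sg W -> shift Q p sg /\
  forall m : lattice, (forall i, 0 <= m i 0) -> exists g, qmus p (em Q s (mono (tor Q) m)) = em Q t (f g).
Proof.
move=> fP; have [Wi WK WiK] := sim_bij (st_sim fP); have fB := st_basis fP.
split=> [k|m m0]; last by exists (Ef Wi m); apply: (st_mono fP).
exists (Ef Wi (fvec (lshift nf (sg k)))), (f (Ef Wi (fvec (lshift nf (sg k))))); split.
- by apply: (st_mono fP) => //; apply: ppos_fvec.
- by split; [apply: tb_one fB _|move=> m /(tb_le fB)].
by move=> l; rewrite (Ef_ent fP) ?fvec_lshift_ent ?(inj_eq perm_inj).
Qed.

End Propagation.

(** * The ring [Z[v, v^-1]] and the fields of fractions *)

Section LaurentScalars.

Lemma mcoeff_vpM (a : kk) z y : (vpow z * a)@_y = a@_(y - z).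
Proof.
rewrite -[vpow z * a]/(tmul (w := trivial_cocycle int int) << z >> a).
rewrite (tmulw (w := trivial_cocycle int int) msuppU_le (fsubset_refl _)).
rewrite big_seq_fset1 mcoeffUU [in RHS](monalgE a) !raddf_sum /=.
apply: eq_bigr => x _; rewrite mul1r mulr1 !mcoeffU; congr (_ *+ _).
by rewrite -(inj_eq (addIr (- z))) addrAC subrr add0r.
Qed.

Lemma vpow0 : vpow 0 = 1.
Proof. by []. Qed.

Lemma kbarE (a : kk) z : (kbar a)@_z = a@_(- z).
Proof.
rewrite /kbar raddf_sum /=.
under eq_bigr do rewrite mcoeffU.
have [zs|Nz] := boolP (- z \in msupp a); last first.
  rewrite mcoeff_outdom // big_seq big1 // => y ys.
  case: eqP => [yz|]; last by rewrite mulr0n.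
  by move: Nz; rewrite -yz opprK ys.
rewrite (big_fsetD1 (- z)) //= opprK eqxx mulr1n big_seq big1 ?addr0 // => y.
rewrite in_fsetD1 => /andP[yz _]; case: eqP => [E|]; last by rewrite mulr0n.
by move: yz; rewrite -E opprK eqxx.
Qed.

Lemma kbarD a b : kbar (a + b) = kbar a + kbar b.
Proof. by apply/malgP => z; rewrite kbarE !mcoeffD !kbarE. Qed.

Lemma kbar_vpow z : kbar (vpow z) = vpow (- z).
Proof. by apply/malgP => y; rewrite kbarE !mcoeffU eqr_oppLR. Qed.

Lemma kbar_vpM z a : kbar (vpow z * a) = vpow (- z) * kbar a.
Proof. by apply/malgP => y; rewrite kbarE !mcoeff_vpM kbarE opprB addrC. Qed.

Lemma kk_sum (a : kk) : a = \sum_(z <- msupp a) vpow z *~ a@_z.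
Proof.
rewrite [LHS]monalgE; apply: eq_bigr => z _; apply/malgP => y.
by rewrite raddfMz /= !mcoeffU -mulrzl intz mulrnAr mulr1.
Qed.

Lemma kbarM a b : kbar (a * b) = kbar a * kbar b.
Proof.
have k0 : kbar 0 = 0 by apply: (addrI (kbar 0)); rewrite -kbarD !addr0.
have kN x : kbar (- x) = - kbar x by apply/eqP; rewrite -addr_eq0 -kbarD addNr k0.
have kn x n : kbar (x *+ n) = kbar x *+ n.
  by elim: n => [|n IH]; rewrite ?k0 // !mulrS kbarD IH.
have kz x (n : int) : kbar (x *~ n) = kbar x *~ n.
  by case: n => n; rewrite /intmul /= ?kN kn.
rewrite {1}(kk_sum a) [in RHS](kk_sum a) mulr_suml.
rewrite !(big_morph _ kbarD k0) mulr_suml; apply: eq_bigr => z _.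
by rewrite mulrzAl !kz mulrzAl kbar_vpM kbar_vpow.
Qed.

Lemma in_mm_coef a : in_mm a <-> forall z, 0 <= z -> a@_z = 0.
Proof.
split=> [ma z z0|ca z].
  have [/ma|/mcoeff_outdom //] := boolP (z \in msupp a).
  by rewrite ltNge z0.
by rewrite -mcoeff_neq0 => /eqP az; rewrite ltNge; apply/negP => /ca.
Qed.

Lemma in_mm0 : in_mm 0.
Proof. by apply/in_mm_coef => z _; rewrite mcoeff0. Qed.

Lemma in_mmD a b : in_mm a -> in_mm b -> in_mm (a + b).
Proof.
move=> /in_mm_coef ma /in_mm_coef mb; apply/in_mm_coef => z z0.
by rewrite mcoeffD ma ?mb ?addr0.
Qed.

Lemma in_mmN a : in_mm a -> in_mm (- a).
Proof. by move=> /in_mm_coef ma; apply/in_mm_coef => z z0; rewrite mcoeffN ma ?oppr0. Qed.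

Lemma in_mmM a b : in_mm a -> in_mm b -> in_mm (a * b).
Proof.
move=> ma /in_mm_coef mb; rewrite (kk_sum a) mulr_suml; apply/in_mm_coef => y y0.
rewrite raddf_sum big_seq big1 // => z za /=.
rewrite mulrzAl raddfMz /= mcoeff_vpM mb ?mul0rz // subr_ge0.
by apply: Order.POrderTheory.le_trans y0; rewrite ltW // ma.
Qed.

Lemma in_mm_vpow z : z < 0 -> in_mm (vpow z).
Proof.
move=> z0; apply/in_mm_coef => y y0; rewrite mcoeffU.
by case: eqP => // zy; move: z0; rewrite zy ltNge y0.
Qed.

(** The bar involution turns negative powers of [v] into positive ones. *)
Lemma in_mm_bar a : in_mm a -> kbar a = a -> a = 0.
Proof.
move=> /in_mm_coef ma ba; apply/malgP => z; rewrite mcoeff0.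
case: (lerP 0 z) => [/ma //|z0]; rewrite -ba kbarE ma //.
by rewrite oppr_ge0 ltW.
Qed.

Definition qkk : qring := QRing vpow0 vpowD kbarD kbarM kbar_vpow
  in_mm0 in_mmD in_mmN in_mmM in_mm_vpow in_mm_bar.

End LaurentScalars.

(** * Passage between the original definitions and the abstract interface *)

Section Instance.
Variables nu nf : nat.
Local Notation lattice := 'cV[int]_(nu + nf).

Lemma malg_mcoeffX (h g : lattice) : (<< h >> : {malg kk[lattice]})@_g = (h == g)%:R.
Proof. by rewrite mcoeffU. Qed.

Lemma malg_mem (y : {malg kk[lattice]}) g : (g \in msupp y) = (y@_g != 0).
Proof. by rewrite mcoeff_neq0. Qed.

Lemma malg_expand (y : {malg kk[lattice]}) : y = \sum_(g <- msupp y) y@_g *: << g >>.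
Proof.
rewrite [LHS]monalgE; apply: eq_bigr => g _; move: (y@_g) => x.
by have := tscaleU (trivial_cocycle kk lattice) x 1 g; rewrite (mulr1 x) => ->.
Qed.

Definition malg_free : freemod qkk lattice :=
  @FreeMod kk lattice {malg kk[lattice]} (fun y g => y@_g) (fun y => msupp y) (fun g => << g >>)
    (fun y z g => mcoeffD g y z) (fun c y g => mcoeffZ c y g) malg_mcoeffX malg_mem malg_expand.

Section Fractions.
Variable F : forall t : seed nu nf, frac_field t.
Variable mu : forall (k : 'I_nu) (t : seed nu nf), mut_iso F k t.

Lemma emb_linear t : linear (frac_emb (F t) : {malg kk[lattice]} -> F t).
Proof. by move=> c x y; exact: (linearP (frac_emb (F t)) c x y). Qed.

Lemma emb1 t : frac_emb (F t) (<< 0 >> : {malg kk[lattice]}) = 1.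
Proof. exact: rmorph1. Qed.

Lemma embXX t m m' :
  frac_emb (F t) (<< m >> : {malg kk[lattice]}) * frac_emb (F t) (<< m' >> : {malg kk[lattice]}) =
  vpow (lam t m m') *: frac_emb (F t) (<< m + m' >> : {malg kk[lattice]}).
Proof.
have := congr1 (frac_emb (F t)) (XmM t m m'); rewrite rmorphM linearZ /= -lamE.
exact.
Qed.

Lemma tau_fvec_k e t (k : 'I_nu) : tau e t k (fvec (lshift nf k)) =
  - fvec (lshift nf k) + \sum_j posp (if e then - sB t j k else sB t j k) *: fvec j.
Proof.
apply/colP => i; rewrite mxE !vE summxE (bigD1 i) //= big1 => [|j ji]; last first.
  by rewrite !vE fvecE eq_sym (negbTE ji) mulr0.
rewrite addr0 vZ !fvecE !eqxx !mulr1; case: (eqVneq i) => [->|ik]; last by rewrite oppr0 !add0r.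
by rewrite sB_diag oppr0 if_same posp_pos // addr0.
Qed.

Lemma mu_eq k t (a := tau true t k (fvec (lshift nf k))) :
  mu_fun (mu k t) (frac_emb _ (<< fvec (lshift nf k) >> : {malg kk[lattice]})) =
  frac_emb (F t) ((<< a >> : {malg kk[lattice]}) + << a + bc t k >>).
Proof.
have -> : a + bc t k = tau false t k (fvec (lshift nf k)).
  by rewrite tau_diff fvecE eqxx scale1r.
rewrite /a !tau_fvec_k; exact: mu_fun_eq.
Qed.

Definition qfrac : qfield qkk nu nf :=
  @QField qkk nu nf malg_free (fun t => F t) (fun t => frac_emb (F t))
    emb_linear (fun t => @frac_emb_inj _ _ t (F t)) emb1 embXX (fun t => @frac_unit _ _ t (F t))
    (fun t => @fracP _ _ t (F t)) (fun k t => mu_fun (mu k t)) (fun k t => mu_inv (mu k t))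
    (fun k t => @mu_funK _ _ _ k t (mu k t)) (fun k t => @mu_invK _ _ _ k t (mu k t))
    (fun k t => @mu_fun_neq _ _ _ k t (mu k t)) mu_eq.

Lemma qfrac_em t (z : LP t) : em qfrac t z = @emb nu nf F t z.
Proof. by []. Qed.

Lemma qfrac_mus t u (p : mpath t u) X : qmus (Q := qfrac) p X = mus mu p X.
Proof. by elim: p X => [//|v k w p IH] X /=; rewrite IH. Qed.

Lemma qfrac_mus_inv t u (p : mpath t u) X : qmus_inv (Q := qfrac) p X = mus_inv mu p X.
Proof. by elim: p X => [//|v k w p IH] X /=; rewrite IH. Qed.

Lemma bar_barT t (z : LP t) : bar z = barT (Q := qfrac) z.
Proof.
rewrite /bar /barT; apply: eq_bigr => m _.
by have := tscaleU (trivial_cocycle kk lattice) (kbar z@_m) 1 m; rewrite mulr1 => ->.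
Qed.

Lemma cmul_coef t g (z : LP t) h : (@cmul nu nf t (Xm t g) z)@_h = z@_(h - g).
Proof.
rewrite -[cmul _ _]/(tmul (w := trivial_cocycle kk lattice) << g >> z).
rewrite (tmulw (w := trivial_cocycle kk lattice) msuppU_le (fsubset_refl _)).
rewrite big_seq_fset1 mcoeffUU [in RHS](monalgE z) !raddf_sum /=.
apply: eq_bigr => x _; rewrite mul1r mulr1 !mcoeffU; congr (_ *+ _).
by rewrite -(inj_eq (addIr (- g))) addrAC subrr add0r.
Qed.

Lemma Bz_natz (t : seed nu nf) n : Bz t (natz n) = sB t *m natz n.
Proof. by []. Qed.

Lemma natz_inj : injective (@natz nu).
Proof. by move=> n n' /matrixP E; apply/colP => k; have := E k 0; rewrite !mxE => -[]. Qed.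

Lemma le_natz (t : seed nu nf) m g : le t m g <-> preceq t m g.
Proof.
split=> [[n n0 ->]|[n ->]]; last by exists (natz n) => // k; rewrite mxE.
exists (map_mx absz n); congr (_ + _ *m _); apply/colP => k.
by rewrite !mxE gez0_abs.
Qed.

(** Distinct vectors [n] give distinct exponents because the exchange matrix has full rank, so the
    coefficients of the pointed form can be read off from the support. *)
Lemma top_pointed t g (z : LP t) : pointed g z <-> top (Q := qfrac) t g z.
Proof.
split=> [[s [c [su s0 ->]]]|[z1 zle]].
  have coef h : (@cmul nu nf t (Xm t g) (1 + \sum_(n <- s) c n *: Ym t n))@_h =
      (0 == h - g)%:R + \sum_(n <- s) c n * (Bz t (natz n) == h - g)%:R.
    rewrite cmul_coef mcoeffD mcoeffU raddf_sum /=; congr (_ + _).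
    by apply: eq_bigr => n _; rewrite mcoeffZ mcoeffU.
  split.
    rewrite -[cf _ _]/(_@_g) coef subrr eqxx big_seq big1 ?addr0 // => n ns.
    rewrite -(Bz0 t) (inj_eq (@Bz_inj _ _ t)); case: eqP => [n0|]; last by rewrite mulr0.
    case/negP: s0; suff <- : n = 0 by [].
    by apply: natz_inj; rewrite n0; apply/colP => k; rewrite !mxE.
  move=> m; rewrite suppE -[cf _ _]/(_@_m) coef => nz; apply: contrapT => Nm.
  case/eqP: nz; rewrite big1 ?addr0 => [|n _].
    case: eqP => // E; case: Nm; have -> : m = g by apply/eqP; rewrite -subr_eq0 -E.
    exact: le_refl.
  case: eqP => [E|]; last by rewrite mulr0.
  case: Nm; apply/le_natz; exists n; by rewrite -Bz_natz E addrC subrK.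
have [nn nnE] : exists nn : lattice -> 'cV[nat]_nu, forall m, m \in msupp z -> m = g + Bz t (natz (nn m)).
  suff /choice[nn nnE] : forall m, exists n : 'cV[nat]_nu, m \in msupp z -> m = g + Bz t (natz n).
    by exists nn.
  move=> m; have [mz|] := boolP (m \in msupp z); last by exists 0.
  by have /le_natz[n ->] := zle _ mz; exists n.
have inD m : m \in (msupp z `\ g)%fset = (m != g) && (m \in msupp z) by rewrite in_fsetD1.
exists (map nn (msupp z `\ g)%fset), (fun n => z@_(g + Bz t (natz n))); split.
- rewrite map_inj_in_uniq ?fset_uniq // => m m'; rewrite !inD => /andP[_ mz] /andP[_ m'z] E.
  by rewrite (nnE _ mz) (nnE _ m'z) E.
- apply/mapP => -[m]; rewrite inD => /andP[mg mz] n0; case/eqP: mg.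
  rewrite (nnE _ mz) -n0 (_ : natz 0 = 0) ?Bz0 ?addr0 //.
  by apply/colP => k; rewrite !mxE.
apply/malgP => h; rewrite cmul_coef mcoeffD mcoeffU big_map raddf_sum /=.
have -> : \sum_(m <- (msupp z `\ g)%fset) (z@_(g + Bz t (natz (nn m))) *: Ym t (nn m))@_(h - g) =
    \sum_(m <- (msupp z `\ g)%fset) z@_m * (m == h)%:R.
  rewrite big_seq [RHS]big_seq; apply: eq_bigr => m; rewrite inD => /andP[_ mz].
  rewrite mcoeffZ mcoeffU -!Bz_natz -(nnE _ mz); congr (_ * _%:R).
  by rewrite -(inj_eq (addrI g)) -(nnE _ mz) addrC subrK.
rewrite eq_sym subr_eq0; have [->|hg] := eqVneq h g.
  rewrite big_seq big1 ?addr0; first exact: z1.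
  by move=> m; rewrite inD => /andP[/negbTE -> _]; rewrite mulr0.
rewrite add0r; have [hz|hz] := boolP (h \in msupp z).
  rewrite (big_fsetD1 h) ?inD ?hg //= eqxx mulr1 big_seq big1 ?addr0 // => m.
  by rewrite in_fsetD1 => /andP[/negbTE -> _]; rewrite mulr0.
rewrite mcoeff_outdom // big_seq big1 // => m; rewrite inD => /andP[_ mz].
by case: eqP => [mh|]; rewrite ?mulr0 //; rewrite mh (negbTE hz) in mz.
Qed.

Local Notation emb := (@emb nu nf F).
Local Notation pointedF := (@pointedF nu nf F).

Lemma emb_inj t : injective (@emb t).
Proof. exact: frac_emb_inj. Qed.

Lemma pointedF_top t g (z : LP t) : pointedF g (emb z) <-> top (Q := qfrac) t g z.
Proof.
by split=> [[z' /emb_inj -> /top_pointed//]|zt]; exists z => //; apply/top_pointed.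
Qed.

Lemma top_uniq (Q : qfield qkk nu nf) t g h (y : tor Q) : top t g y -> top t h y -> g = h.
Proof. by move=> yg yh; apply: LO_uniq (top_LO (ord_enum t) yg) (top_LO (ord_enum t) yh). Qed.

Lemma le_prec t m g : le t m g -> m != g -> @prec nu nf t m g.
Proof. by move=> /le_natz L /eqP ne. Qed.

(** An exponent dominating all others is the unique maximal one, so the normalization divides by its
    coefficient. *)
Lemma normalization_top t g (z w : LP t) (x : kk) : x != 0 -> (z : {malg kk[lattice]})@_g = x ->
  (forall m, m \in msupp z -> le t m g) -> normalization z w <-> z = x *: w.
Proof.
move=> x0 zx zle; have gz : g \in msupp z by rewrite -mcoeff_neq0 zx.
have gm : max_degree z g.
  split=> // m /zle mg [/le_natz gm ne]; case: ne; exact: le_anti gm mg.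
split=> [[d [_ dg ->]]|zE]; last first.
  exists g; split; [exact: gm| |rewrite zx; exact: zE].
  move=> d [dz dm]; apply: contrapT => ne; apply: (dm _ gz).
  by apply: le_prec (zle _ dz) _; apply/eqP.
by rewrite -(dg _ gm) zx.
Qed.

Section FromBasis.
Variables (t0 t : seed nu nf) (A L : set (F t)).
Hypothesis Dt : Delta t0 t.
Hypothesis tL : triangular_basis mu t0 A L.

Lemma Delta_cat u (q : mpath t u) : Delta t0 u.
Proof. by case: Dt => p; split; exact: mcat p q. Qed.

Lemma natI_ex (m : lattice) : (forall i, 0 <= m i 0) -> exists n, m = natI n.
Proof.
move=> m0; exists (map_mx absz m); apply/colP => i.
by rewrite !mxE gez0_abs.
Qed.

Lemma basis_family : exists f : lattice -> tor qfrac, tbasis (Q := qfrac) t f /\ L = range (fun g => em qfrac t (f g)).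
Proof.
case: tL => Asub AU [_ Abas] Lbar [Lmon _ [Lg [[LE Lpt] Ltri]]].
have /choice[f fP] : forall g, exists z : LP t, Lg g = emb z /\ top (Q := qfrac) t g z.
  by move=> g; have [z zE zp] := Lpt g; exists z; split=> //; apply/top_pointed.
have fE g : Lg g = em qfrac t (f g) by have [] := fP g.
have LgL g : L (Lg g) by rewrite LE; exists g.
have LgA g : A (Lg g).
  apply/Abas; exists [:: Lg g], (fun=> 1); split=> [x|]; first by rewrite inE => /eqP ->.
  by rewrite big_seq1 scale1r.
have fB : pbasis (Q := qfrac) t f by split=> g; have [_ []] := fP g.
have LX x : L x -> exists g, x = em qfrac t (f g).
  by rewrite LE => -[g _ <-]; exists g.
have Lspan (s : seq (F t)) (c : F t -> kk) : (forall x, x \in s -> L x) ->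
    exists y : tor qfrac, \sum_(x <- s) c x *: x = em qfrac t (lin f y).
  elim: s => [|x s IH] sL; first by exists 0; rewrite big_nil lin0 em0.
  have [y yE] : exists y : tor qfrac, \sum_(x <- s) c x *: x = em qfrac t (lin f y).
    by apply: IH => z zs; apply: sL; rewrite inE zs orbT.
  have [g gE] := LX x (sL _ (mem_head _ _)).
  exists (c x *: mono (tor qfrac) g + y).
  by rewrite big_cons yE linD linZ lin1 emD emZ -gE.
exists f; split; last by rewrite LE; have -> : Lg = (fun g => em qfrac t (f g)) by apply/funext.
split=> //.
- by move=> g; rewrite -bar_barT; apply: Lbar; rewrite -qfrac_em -fE.
- move=> g h; case: Asub => _ AM _; have /Abas[s [c [sL sE]]] := AM _ _ (LgA g) (LgA h).
  have [y yE] := Lspan s c sL; exists y; apply: (em_inj (t := t)).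
  apply: etrans (emM (Q := qfrac) t (f g) (f h)) _.
  apply: etrans (congr2 _ (esym (fE g)) (esym (fE h))) _.
  exact: etrans sE yE.
- move=> i g; have [z [w [s [b [zE zw _ sP wE]]]]] := Ltri i g.
  have zE' : z = lmul (Q := qfrac) t (mono (tor qfrac) (fvec i)) (f g).
    by apply: (em_inj (q := qfrac) (t := t)); rewrite emM -fE; exact: zE.
  pose y : tor qfrac := mono (tor qfrac) (g + fvec i) + \sum_(g' <- s) b g' *: mono (tor qfrac) g'.
  have wE' : w = lin f y.
    apply: (em_inj (q := qfrac) (t := t)); rewrite linD lin1 emD -fE; rewrite [LHS]wE; congr (_ + _).
    elim: s {sP wE y} => [|x s IH]; first by rewrite !big_nil lin0 em0.
    by rewrite !big_cons linD emD linZ lin1 emZ -fE IH.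
  have [z1 zle] := top_Xmul fB (fvec i) g; rewrite -zE' in z1 zle.
  have v0 : vpow (lam t (fvec i) g) != 0 by exact: vp_neq0 qkk _.
  exists y; split; first by rewrite -zE' -wE'; exact: (normalization_top _ v0 z1 zle).1 zw.
  move=> h hg; rewrite /y cfD cfX (addrC g) (eq_sym _ h) (negbTE hg) add0r.
  elim: s sP {zE zw wE y wE'} => [|x s IH] sP; first by rewrite big_nil cf0; apply: mm0.
  rewrite big_cons cfD cfZ cfX; apply: mmD; last first.
    by apply: IH => g' g's; apply: sP; rewrite inE g's orbT.
  have [_ bx] := sP x (mem_head _ _).
  by case: eqP => _; rewrite ?mulr1 // mulr0; apply: mm0.
- move=> m m0; have [n nE] := natI_ex m0; have [g gE] : exists g, emb (Xm t m) = em qfrac t (f g).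
    by apply/LX/Lmon; rewrite nE; exists n.
  have E : mono (tor qfrac) m = f g by apply: (em_inj (q := qfrac) (t := t)).
  have := tb_one fB g; rewrite -E cfX; case: (m =P g) => [mg _|_ /eqP]; first by rewrite E mg.
  by rewrite eq_sym oner_eq0.
move=> u q g; have [Z [z _ <-] ZE] := AU _ (LgA g) u (Delta_cat q) q.
by exists z; rewrite -fE qfrac_mus -ZE.
Qed.

End FromBasis.

Local Notation mus := (mus mu).
Local Notation mus_inv := (mus_inv mu).

Lemma musK t u (q : mpath t u) X : mus_inv q (mus q X) = X.
Proof. by rewrite -qfrac_mus_inv -qfrac_mus qmusK. Qed.

Lemma mus_invK t u (q : mpath t u) X : mus q (mus_inv q X) = X.
Proof. by rewrite -qfrac_mus_inv -qfrac_mus qmus_invK. Qed.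

Lemma mus_lr t u (q : mpath t u) : exists f : {lrmorphism F u -> F t}, mus q =1 f.
Proof.
elim: q => [v|v k w q [f fE]]; first by exists idfun.
by exists (mu_fun (mu k v) \o f)%FUN => X /=; rewrite fE.
Qed.

Lemma mus1 t u (q : mpath t u) : mus q 1 = 1.
Proof. by have [f fE] := mus_lr q; rewrite fE rmorph1. Qed.

Lemma musM t u (q : mpath t u) X Y : mus q (X * Y) = mus q X * mus q Y.
Proof. by have [f fE] := mus_lr q; rewrite !fE rmorphM. Qed.

Lemma musP t u (q : mpath t u) c X Y : mus q (c *: X + Y) = c *: mus q X + mus q Y.
Proof. by have [f fE] := mus_lr q; rewrite !fE linearP. Qed.

Lemma mus0 t u (q : mpath t u) : mus q 0 = 0.
Proof. by have [f fE] := mus_lr q; rewrite fE rmorph0. Qed.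

Lemma mus_sum t u (q : mpath t u) (I : Type) (s : seq I) (c : I -> kk) (G : I -> F u) :
  mus q (\sum_(i <- s) c i *: G i) = \sum_(i <- s) c i *: mus q (G i).
Proof.
elim: s => [|i s IH]; first by rewrite !big_nil mus0.
by rewrite !big_cons musP IH.
Qed.

Lemma mus_cat t u w (p : mpath t u) (q : mpath u w) X : mus (mcat p q) X = mus p (mus q X).
Proof. by elim: p q X => [v|v k v' p IH] q X //=; rewrite IH. Qed.

Lemma mus_invP t u (q : mpath t u) (S : set (F t)) X : (mus_inv q @` S) X <-> S (mus q X).
Proof.
split=> [[Z SZ <-]|SX]; first by rewrite mus_invK.
by exists (mus q X) => //; rewrite musK.
Qed.

Lemma subalgebra_mus_inv t u (q : mpath t u) (A : set (F t)) :
  is_subalgebra A -> is_subalgebra (mus_inv q @` A).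
Proof.
case=> A1 AM AL; split=> [|x y|c x y]; first by apply/mus_invP; rewrite mus1.
  by move=> /mus_invP Ax /mus_invP Ay; apply/mus_invP; rewrite musM; apply: AM.
by move=> /mus_invP Ax /mus_invP Ay; apply/mus_invP; rewrite musP; apply: AL.
Qed.

Lemma Uq_mus_inv t0 t u (q : mpath t u) (A : set (F t)) :
  A `<=` @Uq _ _ F mu t0 t -> mus_inv q @` A `<=` @Uq _ _ F mu t0 u.
Proof.
move=> AU X /mus_invP /AU UX u' Du' r.
have [Y LY] := UX u' Du' (mcat q r); rewrite mus_cat => /(congr1 (mus_inv q)).
by rewrite !musK => YX; exists Y.
Qed.

Lemma basis_mus_inv t u (q : mpath t u) (A L : set (F t)) :
  is_basis A L -> is_basis (mus_inv q @` A) (mus_inv q @` L).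
Proof.
have fi : injective (mus q) := can_inj (musK q).
case=> Lfree Lspan; split=> [s su sL c s0 x xs|z].
  have := Lfree (map (mus q) s); rewrite map_inj_uniq // => /(_ su).
  have sL' y : y \in map (mus q) s -> L y by case/mapP => x' /sL/mus_invP Lx' ->.
  move=> /(_ sL' (fun y => c (mus_inv q y))); rewrite big_map.
  have -> : \sum_(i <- s) c (mus_inv q (mus q i)) *: mus q i = mus q (\sum_(i <- s) c i *: i).
    by rewrite mus_sum; apply: eq_bigr => i _; rewrite musK.
  rewrite s0 mus0 => /(_ erefl (mus q x)); rewrite musK; apply.
  exact: map_f.
split=> [/mus_invP/Lspan[s [c [sL zE]]]|[s [c [sL ->]]]].
  exists (map (mus_inv q) s), (fun y => c (mus q y)); split.
    by move=> x /mapP[y /sL Ly ->]; apply/mus_invP; rewrite mus_invK.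
  apply: fi; rewrite zE big_map mus_sum; apply: eq_bigr => y _.
  by rewrite mus_invK.
apply/mus_invP/Lspan; exists (map (mus q) s), (fun y => c (mus_inv q y)); split.
  by move=> x /mapP[y /sL/mus_invP Ly ->].
by rewrite big_map mus_sum; apply: eq_bigr => y _; rewrite musK.
Qed.

Lemma family_pointed t (L : set (F t)) (f : lattice -> tor qfrac) : tbasis (Q := qfrac) t f ->
  L = range (fun g => em qfrac t (f g)) -> pointed_family L (fun g => em qfrac t (f g)).
Proof.
move=> fB LE; split=> // g; apply/pointedF_top.
by split; [exact: tb_one fB g|move=> m /(tb_le fB)].
Qed.

Section ToBasis.
Variables (t0 t : seed nu nf) (A L : set (F t)) (f : lattice -> tor qfrac).
Hypotheses (Asub : is_subalgebra A) (AU : A `<=` @Uq _ _ F mu t0 t) (Abas : is_basis A L).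
Hypothesis LE : L = range (fun g => em qfrac t (f g)).
Variables (s : seed nu nf) (p : mpath t s) (sg : {perm 'I_nu}) (W : lattice -> lattice).
Hypothesis fP : state (Q := qfrac) f p sg W.

Lemma natI_ge0 (n : 'cV[nat]_(nu + nf)) i : 0 <= natI n i 0.
Proof. by rewrite mxE. Qed.

Lemma state_triangular : triangular_basis mu t0 A L.
Proof.
have fB := st_basis fP; have [pS pM] := state_shift fP.
split=> //; first by move=> z; rewrite LE bar_barT => -[g _ /(em_inj (q := qfrac)) <-]; apply: tb_bar fB g.
split.
- move=> X [m _ <-]; rewrite LE; exists (natI m) => //=.
  by rewrite (tb_mono fB) // => i; apply: natI_ge0.
- exists s, p; split.
    exists sg => k; have [g [y [yE yt gE]]] := pS k; exists g; split.
      by rewrite -qfrac_mus; move/pointedF_top: yt; rewrite -qfrac_em -yE.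
    by apply/colP => l; rewrite !mxE gE eqxx andbT.
  move=> X [m _ <-]; rewrite LE; have [g gE] := pM _ (natI_ge0 m); exists g => //.
exists (fun g => em qfrac t (f g)); split; first exact: family_pointed.
move=> i g; have [y [yE yt]] := tb_tri fB i g; have [y1 yle] := tb_tri_top fB yE.
pose z : LP t := lmul (Q := qfrac) t (mono (tor qfrac) (fvec i)) (f g).
pose w : LP t := lin f y; pose d := fvec i + g.
have zE : z = vpow (lam t (fvec i) g) *: w by exact: yE.
have [z1 zle] := top_Xmul fB (fvec i) g.
have v0 : vpow (lam t (fvec i) g) != 0 by exact: vp_neq0 qkk _.
exists z, w, (supp y `\ d)%fset, (cf y); split.
- exact: (emM (Q := qfrac) t _ _).
- exact: (normalization_top (z := z) _ v0 z1 zle).2 zE.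
- exact: fset_uniq.
- move=> h; rewrite -[_ \in _]/(h \in (supp y `\ d)%fset) in_fsetD1 => /andP[hd hy].
  by split; [rewrite addrC; apply: le_prec (yle _ hy) hd|apply: yt].
by rewrite [g + _]addrC; exact: em_lin_top y1.
Qed.

End ToBasis.

Lemma qmus_inj_inv t u (q : mpath t u) X Y : qmus (Q := qfrac) q X = Y -> mus_inv q Y = X.
Proof. by rewrite qfrac_mus => <-; rewrite musK. Qed.

Lemma family_mus_inv t u (q : mpath t u) (L : set (F t)) (f f' : lattice -> tor qfrac) :
  L = range (fun g => em qfrac t (f g)) ->
  (forall g, qmus (Q := qfrac) q (em qfrac u (f' (trop q g))) = em qfrac t (f g)) ->
  mus_inv q @` L = range (fun g => em qfrac u (f' g)).
Proof.
move=> -> ff'; apply/seteqP; split=> [X [Y [g _ <-] <-]|X [h _ <-]].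
  by exists (trop q g) => //; rewrite (qmus_inj_inv (ff' g)).
have [r _ rK] := trop_bij q; rewrite -(rK h); exists (em qfrac t (f (r h))); first by exists (r h).
exact: qmus_inj_inv (ff' _).
Qed.

(** A pointed element has only one degree, so being compatibly pointed determines which member of
    the basis at [t1] corresponds to [f g]. *)
Lemma base_compat t t1 (p : mpath t t1) (L : set (F t)) (f fs : lattice -> tor qfrac) :
  tbasis (Q := qfrac) t f -> tbasis (Q := qfrac) t1 fs ->
  L = range (fun g => em qfrac t (f g)) -> mus_inv p @` L = range (fun g => em qfrac t1 (fs g)) ->
  compatibly_pointed mu p L ->
  forall g, qmus (Q := qfrac) p (em qfrac t1 (fs (trop p g))) = em qfrac t (f g).
Proof.
move=> fB fsB LE L1E Lp g; have Lg : L (em qfrac t (f g)) by rewrite LE; exists g.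
have [_ _ [g' [/pointedF_top gt]]] := Lp _ Lg.
have fgt : top (Q := qfrac) t g (f g) by split; [exact: tb_one fB g|move=> m /(tb_le fB)].
have [h _ hE] : range (fun g => em qfrac t1 (fs g)) (mus_inv p (em qfrac t (f g))).
  by rewrite -L1E; exists (em qfrac t (f g)).
have hE' : mus_inv p (em qfrac t (f g)) = em qfrac t1 (fs h) by rewrite -hE.
rewrite hE' -(top_uniq fgt gt) => /pointedF_top pt.
have hst : top (Q := qfrac) t1 h (fs h) by split; [exact: tb_one fsB h|move=> m /(tb_le fsB)].
by rewrite (top_uniq pt hst) -hE' qfrac_mus mus_invK.
Qed.

Lemma shift_of_pointed t u (q : mpath t u) (sg : {perm 'I_nu}) :
  (forall k : 'I_nu, exists g : lattice,
    pointedF g (mus q (emb (Xm u (fvec (lshift nf (sg k)))))) /\ usubmx g = - delta_mx k 0) ->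
  shift qfrac q sg.
Proof.
move=> qS k; have [g [[z zE /top_pointed zt] gk]] := qS k; exists g, z; split=> //.
by move=> l; move/matrixP: gk => /(_ l 0); rewrite !mxE andbT.
Qed.

End Fractions.
End Instance.

Theorem theorem6p5p3 (nu nf : nat)
    (F : forall t : seed nu nf, frac_field t)
    (mu : forall (k : 'I_nu) (t : seed nu nf), mut_iso F k t)
    (t0 t t1 : seed nu nf) (p : mpath t t1) (A L : set (F t)) :
  Delta t0 t ->
  is_shift mu p ->
  triangular_basis mu t0 A L ->
  compatibly_pointed mu p L ->
  triangular_basis mu t0 (mus_inv mu p @` A) (mus_inv mu p @` L) ->
  common_triangular_basis mu t0 A L.
Proof.
pose Q := qfrac mu; move=> Dt [sg pS] tL cL tL1; have [f [fB LE]] := basis_family Dt tL.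
have Dt1 : Delta t0 t1 := Delta_cat Dt p.
have [fs [fsB L1E]] := basis_family Dt1 tL1.
have comp := base_compat fB fsB LE L1E cL.
(* The triangular basis at [t1] provides a shift [s2] of [t1]; this second shift feeds the
   uniqueness argument. *)
case: (tL1) => _ _ _ _ [_ [s2 [p2 [[sg2 p2S] p2M]]] _].
have s2M (m : 'cV[int]_(nu + nf)) : (forall i, 0 <= m i 0) -> exists g,
    qmus p2 (em Q s2 (mono (tor Q) m)) = em Q t1 (fs g).
  move=> m0; have [n nE] := natI_ex m0.
  have [g _ gE] : range (fun g => em Q t1 (fs g)) (mus mu p2 (emb F (Xm s2 m))).
    by rewrite -L1E; apply: p2M; rewrite nE; exists n.
  by exists g; rewrite qfrac_mus -gE.
have [W fW] := base_state fB fsB comp (shift_of_pointed pS) (shift_of_pointed p2S) s2M.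
case: (tL) => As AU Ab _ _.
split=> [t' Dt' q|t' t'' _ _ q q'].
  have [s' [p' [f' [W' [fW' f'E]]]]] := state_path q fW.
  apply: (state_triangular _ _ _ (family_mus_inv LE f'E) fW').
  - exact: subalgebra_mus_inv.
  - exact: Uq_mus_inv.
  - exact: basis_mus_inv.
have [s' [p' [f' [W' [fW' f'E]]]]] := state_path q fW.
have [s'' [p'' [f'' [W'' [fW'' f''E]]]]] := state_path q' fW'.
have LE' := family_mus_inv LE f'E.
exists (fun g => em Q t' (f' g)), (fun g => em Q t'' (f'' g)); split.
- exact: family_pointed (st_basis fW') LE'.
- exact: family_pointed (st_basis fW'') (family_mus_inv LE' f''E).
by move=> g; apply: qmus_inj_inv (f''E g).
Qed.
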